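(* Let $k$ be an algebraically closed field of characteristic zero and let $r,s$ be positive integers. Put $T=\sqrt[r]{t}$ (so $t=T^r$) and $Z'=\frac{1}{\sqrt[r+s]{t'}}$ (so $t'=Z'^{-(r+s)}$ and $z'=1/t'=Z'^{r+s}$). Let $\alpha\in k((T))$ be a formal Laurent series of order $-s$ with respect to $T$. Consider the system of equations $$\partial_t(\alpha(\sqrt[r]{t}))+t'=0,\qquad \alpha(\sqrt[r]{t})+tt'=\beta\Big(\tfrac{1}{\sqrt[r+s]{t'}}\Big).$$ Using the first equation one finds an expression of $T=\sqrt[r]{t}$ as a formal power series (of order $1$) in $Z'=\frac{1}{\sqrt[r+s]{t'}}$; substituting this expression into the second equation gives $\beta=\beta(Z')$, which is a formal Laurent series in $k((Z'))$ of order $-s$ with respect to $Z'$. Then for any regular formal connection $R$ on $k((T))$ we have an isomorphism of formal connections on $k((z'))$ $$\mathcal F^{(0,\infty)}\Big([r]_*\big([T\partial_T(\alpha)]\otimes_{k((T))}R\big)\Big)\cong[r+s]_*\Big(\big[Z'\partial_{Z'}(\beta)+\tfrac{s}{2}\big]\otimes_{k((Z'))}R\Big),$$ where the $R$ on the right means the formal connection on $k((Z'))$ obtained from $R$ by replacing the variable $T$ with $Z'$.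
   Context: A formal connection on $k((t))$ is a pair $(M,t\partial_t)$ with $M$ a finite dimensional $k((t))$-vector space and $t\partial_t:M\to M$ a $k$-linear map with $t\partial_t(fm)=t\partial_t(f)m+f\,t\partial_t(m)$ for $f\in k((t))$, $m\in M$; similarly for any other variable. Write $\partial_t=t^{-1}\cdot(t\partial_t)$ on $M$. Equality of connections means isomorphism. For $f\in k((t))$, $[f]$ is the one dimensional connection $k((t))e$ with $t\partial_t(ge)=(t\partial_t(g)+fg)e$. (Same notation for other variables, e.g. for $f\in k((T))$ with $T\partial_T$.) A connection is regular if its irregularity is $0$; equivalently, it has a $k[[t]]$-lattice stable under $t\partial_t$ (with the analogous meaning in any other variable). Tensor products of connections carry the usual Leibniz action. For the inclusion $[r]:k((t))\hookrightarrow k((T))$, $t=T^r$, and a connection $N$ on $k((T))$, $[r]_*N$ is $N$ regarded as a $k((t))$-vector space with $t\partial_t=\frac1r T\partial_T$. Similarly $[r+s]_*$ for $k((z'))\hookrightarrow k((Z'))$, $z'=Z'^{r+s}$, with $z'\partial_{z'}=\frac{1}{r+s}Z'\partial_{Z'}$. The derivation $\partial_t$ extends to $k((T))$ by $\partial_t=\frac{1}{rT^{r-1}}\partial_T$. Local Fourier transform $\mathcal F^{(0,\infty)}$ (Bloch–Esnault). It sends formal connections on $k((t))$ to formal connections on $k((z'))$, where $t'$ is the Fourier dual coordinate of $t$ and $z'=1/t'$. On a connection $M$ all of whose slopes are positive (as is the case here) it is described as follows: $\partial_t:M\to M$ is bijective, and there is an isomorphism of $k$-vector spaces $\iota:M\to\mathcal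 F^{(0,\infty)}(M)$ with $\iota\circ t=-z'^2\partial_{z'}\circ\iota$ and $\iota\circ\partial_t=-\frac1{z'}\circ\iota$. That is, $\mathcal F^{(0,\infty)}(M)$ is the $k$-vector space $M$ on which $z'$ acts as $-\partial_t^{-1}$ (this extends by continuity for the $t$-adic topology to an action of $k((z'))$, making it finite dimensional over $k((z'))$) and on which $-z'^2\partial_{z'}$ acts as multiplication by $t$. *)

(* Defs.v *)
From HB Require Import structures.
From mathcomp Require Import all_boot all_order all_algebra.
From mathcomp Require Import boolp classical_sets fsbigop.
From mathcomp Require Import zify ring.

Set Implicit Arguments.
Unset Strict Implicit.
Unset Printing Implicit Defensive.

Import Order.TTheory GRing.Theory Num.Theory.
Local Open Scope ring_scope.

Lemma fsbig_int_interval (k : fieldType) (F : int -> k) (a : int) (m : nat) :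
    (forall i, F i != 0 -> a <= i < a + m%:Z) ->
  \sum_(i \in [set: int]) F i = \sum_(j < m) F (a + j%:Z).
Proof.
move=> hF; rewrite (fsbigE [seq a + j%:Z | j <- iota 0 m]).
- rewrite big_map -[X in iota _ X]subn0 -/(index_iota 0 m) big_mkord.
  by apply: eq_bigl => j; rewrite in_setT.
- by rewrite map_inj_uniq ?iota_uniq// => x y; lia.
- by [].
move=> i _ hi; apply/eqP; apply: contraNT hi => /hF hi.
by apply/mapP; exists `|i - a|%N; [rewrite mem_iota; lia | lia].
Qed.

Section Laurent.
Variable k : fieldType.

Record laurent := Laurent {
  lcoef :> int -> k;
  lcoef_bounded : exists N : int, forall n : int, n < N -> lcoef n = 0
}.

Lemma laurentP (f g : laurent) : (forall n, f n = g n) -> f = g.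
Proof.
case: f g => [f hf] [g hg] /= /funext e; case: g / e hg => hg.
by congr Laurent; apply: Prop_irrelevance.
Qed.

HB.instance Definition _ := gen_eqMixin laurent.
HB.instance Definition _ := gen_choiceMixin laurent.

Fact lzero_subproof : exists N : int, forall n : int, n < N -> 0 = 0 :> k.
Proof. by exists 0. Qed.
Definition lzero := Laurent lzero_subproof.

Fact ladd_subproof (f g : laurent) :
  exists N : int, forall n : int, n < N -> f n + g n = 0.
Proof.
have [a ha] := lcoef_bounded f; have [b hb] := lcoef_bounded g.
exists (Order.min a b) => n; rewrite lt_min => /andP[na nb].
by rewrite ha// hb// addr0.
Qed.
Definition ladd f g := Laurent (ladd_subproof f g).

Fact lopp_subproof (f : laurent) :
  exists N : int, forall n : int, n < N -> - f n = 0.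
Proof.
by have [a ha] := lcoef_bounded f; exists a => n /ha ->; rewrite oppr0.
Qed.
Definition lopp f := Laurent (lopp_subproof f).

Fact laddA : associative ladd.
Proof. by move=> f g h; apply: laurentP => n /=; rewrite addrA. Qed.
Fact laddC : commutative ladd.
Proof. by move=> f g; apply: laurentP => n /=; rewrite addrC. Qed.
Fact ladd0 : left_id lzero ladd.
Proof. by move=> f; apply: laurentP => n /=; rewrite add0r. Qed.
Fact laddN : left_inverse lzero lopp ladd.
Proof. by move=> f; apply: laurentP => n /=; rewrite addNr. Qed.

HB.instance Definition _ := GRing.isZmodule.Build laurent laddA laddC ladd0 laddN.

Fact lconst_subproof (c : k) :
  exists N : int, forall n : int, n < N -> (if n == 0 then c else 0) = 0.
Proof. by exists 0 => n; case: eqP => // ->. Qed.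
Definition lconst c := Laurent (lconst_subproof c).

Lemma lmul_small (f g : laurent) (a b : int) :
    (forall n, n < a -> f n = 0) -> (forall n, n < b -> g n = 0) ->
  forall n, n < a + b -> \sum_(i \in [set: int]) f i * g (n - i) = 0.
Proof.
move=> ha hb n hn; apply: fsbig1 => i _.
have [ia|ai] := ltP i a; first by rewrite ha ?mul0r.
by rewrite [g _]hb ?mulr0//; lia.
Qed.

Fact lmul_subproof (f g : laurent) : exists N : int, forall n : int, n < N ->
  \sum_(i \in [set: int]) f i * g (n - i) = 0.
Proof.
have [a ha] := lcoef_bounded f; have [b hb] := lcoef_bounded g.
by exists (a + b); apply: lmul_small.
Qed.
Definition lmul f g := Laurent (lmul_subproof f g).

Lemma lmul_conv (f g : laurent) (a b : int) (m : nat) :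
    (forall n, n < a -> f n = 0) -> (forall n, n < b -> g n = 0) ->
  lmul f g (a + b + m%:Z) =
  \sum_(i < m.+1) f (a + i%:Z) * g (b + (m - i)%N%:Z).
Proof.
move=> ha hb; rewrite /= (@fsbig_int_interval _ _ a m.+1).
  by apply: eq_bigr => i _; congr (_ * g _); have := ltn_ord i; lia.
move=> i; rewrite mulf_eq0 negb_or => /andP[fi gi].
have ai : a <= i by rewrite leNgt; apply: contraNN fi => /ha ->.
have : b <= a + b + m%:Z - i by rewrite leNgt; apply: contraNN gi => /hb ->.
lia.
Qed.

Let trunc (f : laurent) (a : int) (m : nat) : {poly k} :=
  \poly_(i < m.+1) f (a + i%:Z).

Let lmul_trunc (f g : laurent) (a b : int) (m i : nat) :
    (forall n, n < a -> f n = 0) -> (forall n, n < b -> g n = 0) ->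
  (i <= m)%N -> lmul f g (a + b + i%:Z) = (trunc f a m * trunc g b m)`_i.
Proof.
move=> ha hb im; rewrite lmul_conv// coefM; apply: eq_bigr => j _.
by rewrite !coef_poly !ifT//; have := ltn_ord j; lia.
Qed.

Let split_int (n a : int) : n < a \/ exists m : nat, n = a + m%:Z.
Proof.
have [na|an] := ltP n a; [by left | right].
by exists `|n - a|%N; lia.
Qed.

Fact lmulC : commutative lmul.
Proof.
move=> f g; apply: laurentP => n.
have [a ha] := lcoef_bounded f; have [b hb] := lcoef_bounded g.
have [nab|[m ->]] := split_int n (a + b).
  by rewrite /= (lmul_small ha hb)// (lmul_small hb ha)// addrC.
rewrite (lmul_trunc ha hb (leqnn m)) mulrC -(lmul_trunc hb ha (leqnn m)).
by rewrite (addrC a).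
Qed.

Fact lmulA : associative lmul.
Proof.
move=> f g h; apply: laurentP => n.
have [a ha] := lcoef_bounded f; have [b hb] := lcoef_bounded g.
have [c hc] := lcoef_bounded h.
have hab := lmul_small ha hb; have hbc := lmul_small hb hc.
have [nab|[m ->]] := split_int n (a + (b + c)).
  rewrite /= (@lmul_small f (lmul g h) _ _ ha hbc)//.
  by rewrite (@lmul_small (lmul f g) h _ _ hab hc)// -addrA.
rewrite (@lmul_conv f (lmul g h) _ _ _ ha hbc) addrA.
rewrite (@lmul_conv (lmul f g) h _ _ _ hab hc).
transitivity (trunc f a m * (trunc g b m * trunc h c m))`_m.
  rewrite coefM; apply: eq_bigr => i _.
  rewrite (lmul_trunc hb hc (leq_subr i m)) coef_poly ifT//.
rewrite mulrA coefM; apply: eq_bigr => i _.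
have im : (i <= m)%N by rewrite -ltnS.
by rewrite (lmul_trunc ha hb im) coef_poly ifT// ltnS leq_subr.
Qed.

Fact lmul1 : left_id (lconst 1) lmul.
Proof.
move=> f; apply: laurentP => n /=.
rewrite (@fsbig_int_interval _ _ 0 1); first by rewrite big_ord1 /= mul1r subr0.
by move=> i; have [->//|i0] := eqVneq i 0; rewrite mul0r eqxx.
Qed.

Fact lmulDl : left_distributive lmul ladd.
Proof.
move=> f g h; apply: laurentP => n.
have [a ha] := lcoef_bounded f; have [b hb] := lcoef_bounded g.
have [c hc] := lcoef_bounded h; pose d := Order.min a b.
have hda i : i < d -> f i = 0 by rewrite lt_min => /andP[/ha].
have hdb i : i < d -> g i = 0 by rewrite lt_min => /andP[_ /hb].
have hdd i : i < d -> ladd f g i = 0 by move=> id /=; rewrite hda// hdb// addr0.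
have [nd|[m ->]] := split_int n (d + c).
  rewrite [LHS](lmul_small hdd hc)//= (lmul_small hda hc)//.
  by rewrite (lmul_small hdb hc)// addr0.
rewrite (lmul_conv _ hdd hc).
rewrite -[RHS]/(lmul f h (d + c + m%:Z) + lmul g h (d + c + m%:Z)).
rewrite (lmul_conv m hda hc) (lmul_conv m hdb hc).
by rewrite -big_split; apply: eq_bigr => i _; rewrite mulrDl.
Qed.

Fact lone_neq0 : lconst 1 != 0.
Proof.
by apply/eqP => /(congr1 (fun f : laurent => f 0))/= /eqP; rewrite oner_eq0.
Qed.

HB.instance Definition _ :=
  GRing.Zmodule_isComNzRing.Build laurent lmulA lmulC lmul1 lmulDl lone_neq0.

Definition has_order (f : laurent) (v : int) : Prop :=
  f v != 0 /\ forall n, n < v -> f n = 0.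

Lemma has_order_ex (f : laurent) : f != 0 -> exists v, has_order f v.
Proof.
move=> f0; have [a ha] := lcoef_bounded f.
have ex : exists m : nat, f (a + m%:Z) != 0.
  apply: contrapT => /forallNP h; move/eqP: f0; apply; apply: laurentP => n.
  have [/ha//|[m ->]] := split_int n a.
  by have /negP := h m; rewrite negbK => /eqP.
exists (a + (ex_minn ex)%:Z); case: ex_minnP => m fm hm; split => // n nm.
have [/ha//|[j nj]] := split_int n a.
move: nm; rewrite nj => nm; apply/eqP; apply: contraTT nm => /hm; lia.
Qed.

Let inv_seq (F : nat -> k) := fix S (n : nat) : seq k :=
  if n is m.+1 then
    rcons (S m)
      (((m == 0)%:R - \sum_(i < m) F (m - i)%N * nth 0 (S m) i) / F 0%N)
  else [::].

Let inv_series (F : nat -> k) : F 0%N != 0 -> exists G : nat -> k,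
  forall m, \sum_(i < m.+1) F (m - i)%N * G i = (m == 0)%:R.
Proof.
move=> F0; have sz n : size (inv_seq F n) = n.
  by elim: n => //= n IH; rewrite size_rcons IH.
have st n i : (i < n)%N -> nth 0 (inv_seq F n) i = nth 0 (inv_seq F i.+1) i.
  elim: n => // n IH; rewrite ltnS leq_eqVlt => /orP[/eqP->//|ni].
  by rewrite {1}/inv_seq -/(inv_seq F) nth_rcons sz ni IH.
exists (fun i => nth 0 (inv_seq F i.+1) i) => m.
rewrite big_ord_recr /= nth_rcons sz ltnn eqxx subnn.
under [in X in X + _]eq_bigr => i _.
  rewrite -[rcons _ _]/(inv_seq F i.+1) -(st m)//.
over.
by rewrite mulrCA divff// mulr1 addrC subrK.
Qed.

Lemma linv_ex (f : laurent) : f != 0 -> exists g : laurent, g * f = 1.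
Proof.
move=> /has_order_ex[v [fv hv]].
have [|G hG] := @inv_series (fun i => f (v + i%:Z)); first by rewrite addr0.
pose g (n : int) := if 0 <= n + v then G (absz (n + v)) else 0.
have hg : forall n : int, n < - v -> g n = 0 by move=> n nv; rewrite /g ifF//; lia.
exists (Laurent (ex_intro _ (- v) hg)); apply: laurentP => n.
have [nd|[m ->]] := split_int n (- v + v).
  have -> : (1 : laurent) n = 0 by rewrite /= ifF//; lia.
  exact: (@lmul_small (Laurent (ex_intro _ (- v) hg)) f _ _ hg hv).
rewrite [LHS](@lmul_conv (Laurent (ex_intro _ (- v) hg)) f _ _ _ hg hv) /=.
transitivity (\sum_(i < m.+1) f (v + (m - i)%N%:Z) * G i).
  apply: eq_bigr => i _; rewrite mulrC /g; congr (_ * _).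
  rewrite ifT; last lia.
  by congr G; lia.
by rewrite hG addNr add0r; case: m.
Qed.

Definition linv (f : laurent) : laurent := xget 0 [set g | g * f = 1].

Fact lmulVf f : f != 0 -> linv f * f = 1.
Proof. by move=> /linv_ex[g gf]; rewrite /linv; case: xgetP => [x _ //|/(_ g)]. Qed.

Fact linv0 : linv 0 = 0.
Proof.
rewrite /linv; case: xgetP => // x _ /=; rewrite mulr0 => /esym/eqP.
by rewrite oner_eq0.
Qed.

HB.instance Definition _ := GRing.ComNzRing_isField.Build laurent lmulVf linv0.

(* The variable of the series field, whatever its name (t, T, z', Z'). *)
Fact lvar_subproof :
  exists N : int, forall n : int, n < N -> (n == 1)%:R = 0 :> k.
Proof. by exists 1 => n; case: eqP => // ->. Qed.
Definition lvar := Laurent lvar_subproof.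

(* f \in k[[t]] *)
Definition lintegral (f : laurent) : Prop := forall n : int, n < 0 -> f n = 0.

(* t * d/dt *)
Fact ltheta_subproof (f : laurent) :
  exists N : int, forall n : int, n < N -> n%:~R * f n = 0.
Proof.
by have [a ha] := lcoef_bounded f; exists a => n /ha ->; rewrite mulr0.
Qed.
Definition ltheta f := Laurent (ltheta_subproof f).

(* d/dt *)
Definition lderiv (f : laurent) : laurent := lvar^-1 * ltheta f.

(* The series with coefficients c if c vanishes near -oo, and 0 otherwise. *)
Definition mklaurent (c : int -> k) : laurent :=
  if pselect (exists N : int, forall n : int, n < N -> c n = 0) is left h
  then Laurent h else 0.

(* Composition f(g(t)), for g of order 1: the coefficient of t^m in           *)
(* \sum_n f_n g^n is a finite sum by lcomp_coef below; f may have a pole.     *)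
Definition lcomp (f g : laurent) : laurent :=
  mklaurent (fun m => \sum_(n \in [set: int]) f n * (g ^ n) m).

Lemma lcoef_mul (f g : laurent) (n : int) :
  (f * g) n = \sum_(i \in [set: int]) f i * g (n - i).
Proof. by []. Qed.

Lemma lcoef_add (f g : laurent) (n : int) : (f + g) n = f n + g n.
Proof. by []. Qed.

Lemma lcoef_const_mul (c : k) (f : laurent) (n : int) :
  (lconst c * f) n = c * f n.
Proof.
rewrite lcoef_mul (@fsbig_int_interval _ _ 0 1).
  by rewrite big_ord1 /= subr0.
by move=> i /=; have [->//|i0] := eqVneq i 0; rewrite mul0r eqxx.
Qed.

Lemma lconstD (c d : k) : lconst (c + d) = lconst c + lconst d.
Proof. by apply: laurentP => n /=; case: eqP; rewrite ?addr0. Qed.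

Lemma lconst_nat (m : nat) : lconst m%:R = m%:R.
Proof.
elim: m => [|m IH]; first by apply: laurentP => n /=; case: eqP.
by rewrite -natr1 lconstD IH [RHS]mulrSr.
Qed.

Lemma ltheta_const (c : k) : ltheta (lconst c) = 0.
Proof. by apply: laurentP => n /=; case: eqP => [->|_]; rewrite ?mul0r ?mulr0. Qed.

Lemma lthetaD (f g : laurent) : ltheta (f + g) = ltheta f + ltheta g.
Proof. by apply: laurentP => n /=; rewrite mulrDr. Qed.

Lemma lthetaM (f g : laurent) :
  ltheta (f * g) = ltheta f * g + f * ltheta g.
Proof.
have [a ha] := lcoef_bounded f; have [b hb] := lcoef_bounded g.
have ha' i : i < a -> ltheta f i = 0 by move=> /ha /= ->; rewrite mulr0.
have hb' i : i < b -> ltheta g i = 0 by move=> /hb /= ->; rewrite mulr0.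
apply: laurentP => n.
rewrite -[LHS]/(n%:~R * lmul f g n) lcoef_add.
rewrite -[RHS]/(lmul (ltheta f) g n + lmul f (ltheta g) n).
have [nab|[m ->]] := split_int n (a + b).
  rewrite /= (lmul_small ha hb)// (lmul_small ha' hb)// (lmul_small ha hb')//.
  by rewrite mulr0 addr0.
rewrite (lmul_conv _ ha hb) (lmul_conv _ ha' hb) (lmul_conv _ ha hb').
rewrite mulr_sumr -big_split; apply: eq_bigr => i _ /=.
rewrite (_ : a + b + m%:Z = a + i%:Z + (b + (m - i)%N%:Z)).
  by rewrite rmorphD mulrDl -mulrA; congr (_ + _); rewrite mulrCA.
by have := ltn_ord i; lia.
Qed.

Lemma has_order_mul (f g : laurent) (a b : int) :
  has_order f a -> has_order g b -> has_order (f * g) (a + b).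
Proof.
move=> [fa ha] [gb hb]; split; last exact: lmul_small.
have := lmul_conv 0 ha hb; rewrite big_ord1 !addr0 => ->.
by rewrite mulf_neq0.
Qed.

Lemma has_order1 : has_order 1 0.
Proof. by split=> [/=|n n0]; [rewrite oner_neq0 | rewrite /= ifF//; lia]. Qed.

Lemma has_order_neq0 (f : laurent) (a : int) : has_order f a -> f != 0.
Proof. by move=> [fa _]; apply: contraNneq fa => ->. Qed.

Lemma has_order_uniq (f : laurent) (a b : int) :
  has_order f a -> has_order f b -> a = b.
Proof.
move=> [fa ha] [fb hb]; have [/hb|/ha|//] := ltgtP a b.
  by move/eqP; rewrite (negPf fa).
by move/eqP; rewrite (negPf fb).
Qed.

Lemma has_orderV (f : laurent) (a : int) :
  has_order f a -> has_order f^-1 (- a).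
Proof.
move=> fa; have f0 := has_order_neq0 fa.
have [b fb] : exists b, has_order f^-1 b by apply: has_order_ex; rewrite invr_eq0.
have := has_order_mul fa fb; rewrite divff// => /has_order_uniq /(_ has_order1).
by move=> ab; rewrite (_ : - a = b)//; lia.
Qed.

Lemma has_order_exprz (f : laurent) (a n : int) :
  has_order f a -> has_order (f ^ n) (n * a).
Proof.
move=> fa; have nat_case (m : nat) : has_order (f ^+ m) (m%:Z * a).
  elim: m => [|m IH]; first by rewrite mul0r; apply: has_order1.
  rewrite exprS (_ : m.+1%:Z * a = a + m%:Z * a); first exact: has_order_mul.
  by rewrite intS mulrDl mul1r.
case: n => [m|m]; first exact: nat_case.
by rewrite NegzE mulNr; apply/has_orderV/nat_case.
Qed.

Lemma lcomp_coef (f g : laurent) (m : int) : has_order g 1 ->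
  lcomp f g m = \sum_(n \in [set: int]) f n * (g ^ n) m.
Proof.
move=> g1; rewrite /lcomp /mklaurent; case: pselect => //; case.
have [a ha] := lcoef_bounded f; exists a => n na; apply: fsbig1 => i _.
have [ia|ai] := ltP i a; first by rewrite ha ?mul0r.
have [_ ->] := has_order_exprz i g1; first by rewrite mulr0.
by rewrite mulr1; lia.
Qed.

Section Substitution.
Variables (r : nat) (r_gt0 : (0 < r)%N).

(* f(T) |-> f(T^r), the embedding k((t)) -> k((T)) with t = T^r. *)
Fact lsubst_subproof (f : laurent) : exists N : int, forall n : int, n < N ->
  (if (r%:Z %| n)%Z then f (n %/ r%:Z)%Z else 0) = 0.
Proof.
have [a ha] := lcoef_bounded f; exists (a * r%:Z) => n na; case: ifP => // _.
by apply: ha; rewrite ltz_divLR.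
Qed.
Definition lsubst f := Laurent (lsubst_subproof f).

Let mulr_inj : injective (fun q : int => q * r%:Z).
Proof. by apply: mulIf; lia. Qed.

Lemma lsubst_mul_coef (f g : laurent) (n : int) :
  (lsubst f * g) n = \sum_(q \in [set: int]) f q * g (n - q * r%:Z).
Proof.
rewrite lcoef_mul -(fsbig_widen (range (fun q : int => q * r%:Z)))//=.
  rewrite fsbig_image; last by move=> ? ? _ _; apply: mulr_inj.
  by apply: eq_fsbigr => q _; rewrite dvdz_mull// mulzK//; lia.
move=> i [_ hi] /=; case: ifP => [/dvdzP[q iq]|_]; last by rewrite mul0r.
by case: hi; exists q.
Qed.

Lemma lsubstD (f g : laurent) : lsubst (f + g) = lsubst f + lsubst g.
Proof. by apply: laurentP => n /=; case: ifP; rewrite ?addr0. Qed.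

Lemma lsubst_const (c : k) : lsubst (lconst c) = lconst c.
Proof.
apply: laurentP => n /=; have [->|n0] := eqVneq n 0.
  by rewrite dvdz0 div0z eqxx.
by case: ifP => // /dvdzP[q nq]; rewrite ifF// nq mulzK//; lia.
Qed.

Lemma lsubst1 : lsubst 1 = 1. Proof. exact: lsubst_const. Qed.

Lemma lsubstM (f g : laurent) : lsubst (f * g) = lsubst f * lsubst g.
Proof.
apply: laurentP => n; rewrite lsubst_mul_coef /=; case: ifP => [/dvdzP[p ->]|rn].
  apply: eq_fsbigr => q _; rewrite -mulrBl dvdz_mull// !mulzK//; lia.
rewrite fsbig1// => q _; rewrite ifF ?mulr0//; apply: contraFF rn => rn.
by have := rpredD rn (dvdz_mull q (dvdzz r%:Z)); rewrite subrK.
Qed.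

Lemma ltheta_subst (f : laurent) : ltheta (lsubst f) = r%:R * lsubst (ltheta f).
Proof.
rewrite -lconst_nat; apply: laurentP => n; rewrite lcoef_const_mul /=.
case: ifP => [/dvdzP[q ->]|_]; last by rewrite !mulr0.
by rewrite mulzK ?mulrA; [rewrite intrM [q%:~R * _]mulrC | lia].
Qed.

(* k((T)) is the direct sum of the T^i k((t)) for i < r: lsplit and ljoin     *)
(* give the coordinates of a series in T and recover it from them.            *)
Fact lsplit_subproof (f : laurent) (i : nat) :
  exists N : int, forall n : int, n < N -> f (n * r%:Z + i%:Z) = 0.
Proof.
have [a ha] := lcoef_bounded f.
exists ((a - i%:Z) %/ r%:Z)%Z => n na; apply: ha.
have := divz_eq (a - i%:Z) r%:Z; have : (0 <= (a - i%:Z) %% r%:Z)%Z.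
  by apply: modz_ge0; lia.
nia.
Qed.
Definition lsplit f i := Laurent (lsplit_subproof f i).

Fact ljoin_subproof (w : 'I_r -> laurent) :
  exists N : int, forall n : int, n < N ->
  w (Ordinal (ltn_pmod (absz (n %% r%:Z)%Z) r_gt0)) (n %/ r%:Z)%Z = 0.
Proof.
pose b i := xget 0 [set N : int | forall n : int, n < N -> w i n = 0].
have hb i n : n < b i -> w i n = 0.
  rewrite /b; case: xgetP => [x _ /= + /[dup]|none]; first by move=> + _; apply.
  by have [N hN] := lcoef_bounded (w i); case: (none N).
exists ((\big[Order.min/0]_i b i) * r%:Z) => n nb; apply: hb.
rewrite -ltz_divLR in nb; last by lia.
by apply: lt_le_trans nb _; apply: bigmin_le.
Qed.
Definition ljoin w := Laurent (ljoin_subproof w).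

Lemma ljoinK (w : 'I_r -> laurent) (i : 'I_r) : lsplit (ljoin w) i = w i.
Proof.
apply: laurentP => n /=; have ir := ltn_ord i.
have er : ((n * r%:Z + i%:Z) %/ r%:Z)%Z = n.
  by rewrite divzMDl; [rewrite divz_small ?addr0//; lia | lia].
have em : ((n * r%:Z + i%:Z) %% r%:Z)%Z = i%:Z by rewrite modzMDl modz_small//; lia.
rewrite er; congr (w _ n); apply: val_inj; rewrite /= em /=.
by rewrite modn_small.
Qed.

Lemma lsplitK (f : laurent) : ljoin (fun i => lsplit f i) = f.
Proof.
apply: laurentP => n /=; congr (f _).
have m0 : (0 <= n %% r%:Z)%Z by apply: modz_ge0; lia.
have mr : ((n %% r%:Z)%Z < r%:Z)%R by apply: ltz_pmod; lia.
rewrite modn_small; last by lia.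
by rewrite [RHS](divz_eq n r%:Z); lia.
Qed.

Lemma lsplit_lin (f g h : laurent) (i : nat) :
  lsplit (lsubst f * g + h) i = f * lsplit g i + lsplit h i.
Proof.
apply: laurentP => n; rewrite lcoef_add lcoef_mul.
rewrite -[LHS]/((lsubst f * g) (n * r%:Z + i%:Z) + lsplit h i n).
rewrite lsubst_mul_coef; congr (_ + _); apply: eq_fsbigr => q _ /=.
by congr (_ * g _); lia.
Qed.

End Substitution.

End Laurent.

Arguments lvar {k}.

Section Connections.
Variable k : fieldType.
Local Notation K := (laurent k).

(* cdelta is the action of t * d/dt. *)
Record connection := Connection {
  cspace :> vectType K;
  cdelta : cspace -> cspace;
  cdelta_linear : forall (c : k) (u v : cspace),
    cdelta (lconst c *: u + v) = lconst c *: cdelta u + cdelta v;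
  cdelta_leibniz : forall (f : K) (u : cspace),
    cdelta (f *: u) = ltheta f *: u + f *: cdelta u
}.

(* d/dt = t^-1 * (t * d/dt) *)
Definition cderiv (M : connection) (u : M) : M := lvar^-1 *: cdelta u.

Definition conn_iso (M N : connection) : Prop :=
  exists phi : {linear M -> N},
    bijective phi /\ forall u : M, phi (cdelta u) = cdelta (phi u).

(* k[[t]]-lattices: the finitely generated k[[t]]-submodules that span M. *)
Definition is_lattice (M : connection) (L : set M) : Prop :=
  exists (n : nat) (e : n.-tuple M),
    <<e>>%VS = fullv /\
    L = [set u | exists2 c : 'I_n -> K, (forall i, lintegral (c i)) &
                   u = \sum_(i < n) c i *: tnth e i]%classic.

(* Irregularity 0, as existence of a lattice stable under t * d/dt. *)
Definition regular (M : connection) : Prop :=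
  exists2 L : set M, is_lattice L & forall u, L u -> L (cdelta u).

Lemma cdeltaD (M : connection) (u v : M) :
  cdelta (u + v) = cdelta u + cdelta v.
Proof. by have := cdelta_linear 1 u v; rewrite !scale1r. Qed.

Lemma cdelta0 (M : connection) : cdelta 0 = 0 :> M.
Proof. by apply: (addrI (cdelta 0)); rewrite -cdeltaD !addr0. Qed.

Lemma cdelta_sum (M : connection) (I : finType) (F : I -> M) :
  cdelta (\sum_i F i) = \sum_i cdelta (F i).
Proof. exact: (big_morph _ (@cdeltaD M) (cdelta0 M)). Qed.

Section Rank1.
Variable f : K.

Definition rank1_delta (g : K^o) : K^o := ltheta g + f * g.

Fact rank1_linear (c : k) (u v : K^o) : rank1_delta (lconst c *: u + v) =
  lconst c *: rank1_delta u + rank1_delta v.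
Proof.
rewrite /rank1_delta lthetaD lthetaM ltheta_const mul0r add0r.
by rewrite /GRing.scale /=; ring.
Qed.

Fact rank1_leibniz (g : K) (u : K^o) :
  rank1_delta (g *: u) = ltheta g *: u + g *: rank1_delta u.
Proof.
by rewrite /rank1_delta /GRing.scale /= lthetaM mulrDr addrA [f * _]mulrCA.
Qed.

Definition rank1 : connection := Connection rank1_linear rank1_leibniz.

End Rank1.

Section Tensor.
Variables M N : connection.

Local Notation bM := (vbasis {:M}).
Local Notation bN := (vbasis {:N}).

(* M \otimes N, in the coordinates of the bases bM and bN: its elements are   *)
(* the matrices X, standing for \sum_(i, j) X i j *: (bM`_i \otimes bN`_j).   *)
Definition tens_space : vectType K := 'M[K]_(\dim {:M}, \dim {:N}).

Definition tens (u : M) (v : N) : tens_space :=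
  \matrix_(i, j) (coord bM i u * coord bN j v).

Definition tens_delta (X : tens_space) : tens_space :=
  \sum_i \sum_j
    (ltheta (X i j) *: tens bM`_i bN`_j +
     X i j *: (tens (cdelta bM`_i) bN`_j + tens bM`_i (cdelta bN`_j))).

Lemma tens_lin_l (f : K) (u u' : M) (v : N) :
  tens (f *: u + u') v = f *: tens u v + tens u' v.
Proof. by apply/matrixP => i j; rewrite !mxE linearP mulrDl mulrA. Qed.

Lemma tens_lin_r (f : K) (u : M) (v v' : N) :
  tens u (f *: v + v') = f *: tens u v + tens u v'.
Proof. by apply/matrixP => i j; rewrite !mxE linearP mulrDr mulrCA. Qed.

Lemma tens_suml (I : finType) (c : I -> K) (u : I -> M) (v : N) :
  tens (\sum_i c i *: u i) v = \sum_i c i *: tens (u i) v.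
Proof.
apply/matrixP => p q; rewrite summxE !mxE linear_sum /= mulr_suml.
by apply: eq_bigr => i _; rewrite !mxE linearZ /= mulrA.
Qed.

Lemma tens_sumr (I : finType) (c : I -> K) (u : M) (v : I -> N) :
  tens u (\sum_i c i *: v i) = \sum_i c i *: tens u (v i).
Proof.
apply/matrixP => p q; rewrite summxE !mxE linear_sum /= mulr_sumr.
by apply: eq_bigr => i _; rewrite !mxE linearZ /= mulrCA.
Qed.

Lemma tens_basis (X : tens_space) : X = \sum_i \sum_j X i j *: tens bM`_i bN`_j.
Proof.
apply/matrixP => p q; rewrite summxE (bigD1 p)//= summxE (bigD1 q)//= !mxE.
rewrite !coord_free ?(basis_free (vbasisP _))// !eqxx !mulr1 !big1 ?addr0//.
  move=> i ip; rewrite summxE big1// => j _; rewrite !mxE.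
  by rewrite coord_free ?(basis_free (vbasisP _))// (negPf ip) mul0r mulr0.
move=> j jq; rewrite !mxE !coord_free ?(basis_free (vbasisP _))//.
by rewrite (negPf jq) !mulr0.
Qed.

Fact tens_linear (c : k) (X Y : tens_space) : tens_delta (lconst c *: X + Y) =
  lconst c *: tens_delta X + tens_delta Y.
Proof.
rewrite /tens_delta scaler_sumr -big_split; apply: eq_bigr => i _ /=.
rewrite scaler_sumr -big_split; apply: eq_bigr => j _ /=.
set w := tens _ _ + tens _ _; rewrite !mxE lthetaD lthetaM ltheta_const.
by rewrite mul0r add0r !scalerDl -!scalerA [lconst c *: (_ + _)]scalerDr addrACA.
Qed.

Fact tens_leibniz (f : K) (X : tens_space) :
  tens_delta (f *: X) = ltheta f *: X + f *: tens_delta X.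
Proof.
rewrite {2}(tens_basis X) /tens_delta !scaler_sumr -big_split.
apply: eq_bigr => i _ /=; rewrite !scaler_sumr -big_split.
apply: eq_bigr => j _ /=; set w := tens _ _ + tens _ _; rewrite !mxE lthetaM.
by rewrite scalerDl -!scalerA [f *: (_ + _)]scalerDr addrA.
Qed.

Definition tensor : connection := Connection tens_linear tens_leibniz.

Lemma tensor_delta (u : M) (v : N) :
  cdelta (tens u v : tensor) = tens (cdelta u) v + tens u (cdelta v).
Proof.
have expand (V : connection) (w : V) :
  w = \sum_i coord (vbasis {:V}) i w *: (vbasis {:V})`_i.
  by apply: coord_vbasis; apply: memvf.
have expandD (V : connection) (w : V) : cdelta w =
    \sum_i ltheta (coord (vbasis {:V}) i w) *: (vbasis {:V})`_i +
    \sum_i coord (vbasis {:V}) i w *: cdelta (vbasis {:V})`_i.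
  rewrite {1}(expand V w) cdelta_sum -big_split.
  by apply: eq_bigr => i _; rewrite cdelta_leibniz.
have addl x y : tens (x + y) v = tens x v + tens y v.
  by have := tens_lin_l 1 x y v; rewrite !scale1r.
have addr x y : tens u (x + y) = tens u x + tens u y.
  by have := tens_lin_r 1 u x y; rewrite !scale1r.
rewrite (expandD M u) (expandD N v) addl addr !tens_suml !tens_sumr.
rewrite -[LHS]/(tens_delta (tens u v)) /tens_delta.
under eq_bigr => i _ do under eq_bigr => j _ do
  rewrite mxE lthetaM scalerDr !scalerDl -!scalerA.
pose x i := coord bM i u; pose y j := coord bN j v.
have -> : \sum_i ltheta (x i) *: tens bM`_i v =
  \sum_i \sum_j ltheta (x i) *: (y j *: tens bM`_i bN`_j).
  apply: eq_bigr => i _; rewrite {1}(expand N v) tens_sumr scaler_sumr.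
  by [].
have -> : \sum_i x i *: tens (cdelta bM`_i) v =
  \sum_i \sum_j x i *: (y j *: tens (cdelta bM`_i) bN`_j).
  apply: eq_bigr => i _; rewrite {1}(expand N v) tens_sumr scaler_sumr.
  by [].
have -> : \sum_j ltheta (y j) *: tens u bN`_j =
  \sum_i \sum_j x i *: (ltheta (y j) *: tens bM`_i bN`_j).
  rewrite exchange_big; apply: eq_bigr => j _.
  rewrite {1}(expand M u) tens_suml scaler_sumr.
  by apply: eq_bigr => i _; rewrite scalerA mulrC -scalerA.
have -> : \sum_j y j *: tens u (cdelta bN`_j) =
  \sum_i \sum_j x i *: (y j *: tens bM`_i (cdelta bN`_j)).
  rewrite exchange_big; apply: eq_bigr => j _.
  rewrite {1}(expand M u) tens_suml scaler_sumr.
  by apply: eq_bigr => i _; rewrite scalerA mulrC -scalerA.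
rewrite -!big_split; apply: eq_bigr => i _; rewrite -!big_split.
by apply: eq_bigr => j _ /=; rewrite [LHS]addrACA.
Qed.

End Tensor.

End Connections.

(* [r]_* M is M itself, seen as a vector space over k((t)) through lsubst.    *)
Definition pushforward_space (k : fieldType) (r : nat) (r_gt0 : (0 < r)%N)
  (V : vectType (laurent k)) : Type := V.

Section PushforwardSpace.
Variables (k : fieldType) (r : nat) (r_gt0 : (0 < r)%N).
Variable V : vectType (laurent k).
Local Notation K := (laurent k).
Local Notation W := (pushforward_space r_gt0 V).

HB.instance Definition _ := GRing.Zmodule.on W.

Definition pushforward_scale (f : K) (u : W) : W := lsubst r_gt0 f *: (u : V).

Fact pushforward_scaleA (f g : K) (u : W) :
  pushforward_scale f (pushforward_scale g u) = pushforward_scale (f * g) u.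
Proof. by rewrite /pushforward_scale scalerA -lsubstM. Qed.

Fact pushforward_scale1 : left_id 1 pushforward_scale.
Proof. by move=> u; rewrite /pushforward_scale lsubst1 scale1r. Qed.

Fact pushforward_scaleDr : right_distributive pushforward_scale +%R.
Proof. by move=> f u v; rewrite /pushforward_scale scalerDr. Qed.

Fact pushforward_scaleDl (u : W) :
  {morph pushforward_scale^~ u : f g / f + g}.
Proof. by move=> f g; rewrite /pushforward_scale lsubstD scalerDl. Qed.

HB.instance Definition _ := GRing.Zmodule_isLmodule.Build K W
  pushforward_scaleA pushforward_scale1 pushforward_scaleDr pushforward_scaleDl.

Fact pushforward_findim : Vector.axiom (r * \dim {:V}) W.
Proof.
pose c (u : V) j := coord (vbasis {:V}) j u.
exists (fun u : W => mxvec (\matrix_(i < r, j < \dim {:V}) lsplit r_gt0 (c u j) i)).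
  move=> f u v; rewrite -linearP; congr mxvec; apply/matrixP => i j.
  by rewrite !mxE /c linearP lsplit_lin.
exists (fun w => \sum_j ljoin r_gt0 (fun i => vec_mx w i j) *: (vbasis {:V})`_j).
  move=> u; rewrite mxvecK [RHS](coord_vbasis (memvf u)); apply: eq_bigr => j _.
  congr (_ *: _); rewrite -[RHS](lsplitK r_gt0); congr ljoin.
  by apply/funext => i; rewrite mxE.
move=> w; apply: (can_inj vec_mxK); rewrite mxvecK; apply/matrixP => i j.
rewrite mxE -[RHS](ljoinK r_gt0 (fun i => vec_mx w i j)) /c.
congr (lsplit _ _ _); rewrite coord_sum_free// (basis_free (vbasisP _))//.
Qed.

HB.instance Definition _ := Lmodule_hasFinDim.Build K W pushforward_findim.

End PushforwardSpace.

Section Pushforward.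
Variables (k : fieldType) (char0 : [pchar k] =i pred0).
Variables (r : nat) (r_gt0 : (0 < r)%N) (M : connection k).
Local Notation K := (laurent k).
Local Notation W := (pushforward_space r_gt0 M).

Definition pushforward_delta (u : W) : W := (r%:R^-1 : K) *: cdelta (u : M).

Fact pushforward_linear (c : k) (u v : W) :
  pushforward_delta (lconst c *: u + v) =
  lconst c *: pushforward_delta u + pushforward_delta v.
Proof.
rewrite /pushforward_delta -[_ *: u]/(lsubst r_gt0 (lconst c) *: (u : M)).
rewrite -[lconst c *: (_ : W)]/(lsubst r_gt0 (lconst c) *: (_ : M)).
by rewrite lsubst_const cdelta_linear scalerDr !scalerA [_ * lconst c]mulrC.
Qed.

Fact pushforward_leibniz (f : K) (u : W) :
  pushforward_delta (f *: u) = ltheta f *: u + f *: pushforward_delta u.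
Proof.
have r0 : r%:R != 0 :> K.
  apply/eqP => /(congr1 (fun g : K => g 0)); rewrite -lconst_nat /=.
  by apply/eqP; have /pcharf0P -> := char0; rewrite -lt0n.
rewrite /pushforward_delta -[f *: u]/(lsubst r_gt0 f *: (u : M)).
rewrite -[f *: (_ : W)]/(lsubst r_gt0 f *: (_ : M)).
rewrite -[_ *: u]/(lsubst r_gt0 (ltheta f) *: (u : M)).
rewrite cdelta_leibniz ltheta_subst scalerDr !scalerA mulKf//.
by rewrite [_^-1 * _]mulrC.
Qed.

Definition pushforward : connection k :=
  Connection pushforward_linear pushforward_leibniz.

End Pushforward.

(* F is the local Fourier transform F^(0,oo)(M) of a connection M on k((t))   *)
(* with positive slopes; here lvar stands for t on M and for z' on F. The     *)
(* last clause says that iota^-1 is continuous for the z'-adic topology on F  *)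
(* and the t-adic topology on M (lattices form a basis of neighbourhoods of   *)
(* 0): k((z')) acts on M by the t-adically continuous extension of the action *)
(* of z' as - (d/dt)^-1.                                                      *)
Definition is_local_fourier_0oo (k : fieldType) (M F : connection k) : Prop :=
  exists iota : M -> F,
  [/\ bijective iota /\ (forall (c : k) (u v : M),
        iota (lconst c *: u + v) = lconst c *: iota u + iota v),
      forall u : M, iota (lvar *: u) = - (lvar ^+ 2 *: cderiv (iota u)),
      forall u : M, iota (cderiv u) = - (lvar^-1 *: iota u)
    & forall L : set M, is_lattice L ->
        exists2 L' : set F, is_lattice L' & forall u : M, L' (iota u) -> L u].

(* d/dt = 1 / (r T^(r-1)) * d/dT on k((T)), with t = T^r. *)
Definition lderiv_root (k : fieldType) (r : nat) (f : laurent k) : laurent k :=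
  (r%:R * lvar ^+ r.-1)^-1 * lderiv f.

(* T = phi(Z') is a series of order 1 in Z' that solves                       *)
(* d/dt (alpha)(T) + t' = 0, where t' = Z'^(-(r+s)).                          *)
Definition stationary_point (k : fieldType) (r s : nat)
    (alpha phi : laurent k) : Prop :=
  has_order phi 1 /\
  lcomp (lderiv_root r alpha) phi + lvar ^- (r + s) = 0.

(* Main.v *)
(* A regular R has a basis in which the derivation is theta + A with A a       *)
(* constant matrix (theta = T d/dT), all of whose eigenvalues are fixed        *)
(* representatives modulo the integers.  Let q = r + s.  Substituting          *)
(* T = phi(Z), the stationary point, and writing t = tau(Z) = phi(Z)^r, turns  *)
(* - d/dt on the left-hand side into D = Z^(-q) - (1 / theta tau) (theta + A). *)
(* Put x = theta + A.  The equation D U = U Z^(-q) is solved by an operator    *)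
(* U = sum_m Z^m u_m(x) with polynomials u_m, since the difference operator    *)
(* p(x) |-> p(x - q) - p(x) is onto in characteristic 0.  The operator         *)
(* Theta = q z' d/dz' satisfies D Theta = Theta D + q D, so U^(-1) Theta U - x *)
(* commutes with Z^q; its coefficients are polynomials in x invariant under    *)
(* x |-> x - q, that is constants: Theta U = U (x + w) with w a series in Z.   *)
(* The polar part of w is that of theta beta, and the second difference of the *)
(* quadratic polynomial u_s gives the constant term r + s/2.  Finally x + w    *)
(* and x + theta beta + s/2 differ by a gauge transformation of order -r.      *)
(* Uniqueness of the local Fourier transform: a continuous k-linear map that   *)
(* commutes with z' is k((z'))-linear.                                         *)

From HB Require Import structures.
Require Import Defs.
From mathcomp Require Import all_boot all_order all_algebra.
From mathcomp Require Import boolp classical_sets fsbigop.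
From mathcomp Require Import zify ring.

Set Implicit Arguments.
Unset Strict Implicit.
Unset Printing Implicit Defensive.

Import Order.TTheory GRing.Theory Num.Theory.
Local Open Scope ring_scope.

(** The theorem is the method of stationary phase made algebraic. Write [q = r + s]. A regular [R]
    is isomorphic to [theta + A] with a constant matrix [A] ([regular_matrix], [gauge_constant]).
    Substituting the stationary point [T = phi(Z)] ([substitution]) puts both sides on row vectors
    over [k((Z))]. On the left, [t] becomes multiplication by [tau = phi^r], and by the stationarity
    equation [- d/dt] becomes [opD], whose dominant part is [Z^(-q)]. On the right, [1/z'] is
    exactly [Z^(-q)]. What is sought is therefore an operator conjugating [opD] into [Z^(-q)].

    Such an operator is a series [U = sum_m Z^m u_m(theta + A)]: the equation for [U] is a chain of
    difference equations, solvable in characteristic 0 by [difference_surj] ([wave_ex], [opD_pop]).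
    It remains to see what [U] does to [Theta = q z' d/dz']. The commutation rule of [Theta] with
    [opD] forces [U^(-1) Theta U - (theta + A)] to commute with [Z^(-q)], and periodic polynomials
    are constant ([periodic_const]), so this difference is multiplication by a scalar series [w],
    the same for all [A] ([wave_ex_weight]). Its polar part is that of [theta beta], by the Legendre
    identity [theta_beta], and its constant term is [r + s/2] ([wave_weight_low]); a scalar gauge
    factor removes the rest ([phase_operator]).

    The resulting map [iota] ([stationary_phase]) realizes the local Fourier transform
    ([phase_is_fourier]). Any other realization differs from it by a continuous map commuting with
    [1/z'], which is linear over [k((z'))] ([continuous_linear], [fourier_unique]). Throughout,
    operators are inverted by inspecting leading terms ([filtered_bij]) and compared on monomials
    ([filtered_ext]). *)

Lemma strong_recursion (T : Type) (t0 : T) (P : (nat -> T) -> nat -> T -> Prop) :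
    (forall f g n t, (forall i, (i < n)%N -> f i = g i) -> P f n t -> P g n t) ->
    (forall f n, exists t, P f n t) ->
  exists f, forall n, P f n (f n).
Proof.
move=> Pext Pex; have [F hF] := choice (fun fn => Pex fn.1 fn.2).
(* [S n] lists the first [n] values chosen; [nth] returns the default [t0] beyond them, which [Pext]
   makes harmless. *)
pose fix S (n : nat) : seq T :=
  if n is m.+1 then rcons (S m) (F (fun i => nth t0 (S m) i, m)) else [::].
have sz n : size (S n) = n by elim: n => //= n IH; rewrite size_rcons IH.
have st n i : (i < n)%N -> nth t0 (S n) i = nth t0 (S i.+1) i.
  elim: n => // n IH; rewrite ltnS leq_eqVlt => /orP[/eqP->//|ni].
  by rewrite {1}/S -/S nth_rcons sz ni IH.
exists (fun i => nth t0 (S i.+1) i) => n.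
rewrite {2}/S -/S nth_rcons sz ltnn eqxx.
by apply: (Pext _ _ _ _ _ (hF (fun i => nth t0 (S n) i, n))) => i /= /st.
Qed.

(** * Complete filtered abelian groups *)

Section Filtration.

(** Decreasing, exhaustive and separated; [fil_lim] is completeness, phrased with partial sums of
    terms of growing degree instead of Cauchy sequences. *)
Record filtration (X : zmodType) (F : int -> X -> Prop) : Prop := {
  fil0 : forall i, F i 0;
  filB : forall i x y, F i x -> F i y -> F i (x - y);
  fil_le : forall i j x, i <= j -> F j x -> F i x;
  fil_ex : forall x, exists i, F i x;
  fil_sep : forall x, (forall i, F i x) -> x = 0;
  fil_lim : forall i (x : nat -> X), (forall m, F (i + m%:Z) (x m)) ->
    exists y, forall m, F (i + m%:Z) (y - \sum_(j < m) x j) }.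

Variables (X : zmodType) (F : int -> X -> Prop) (hF : filtration F).

Lemma filN i x : F i x -> F i (- x).
Proof. by move=> Fx; rewrite -sub0r; apply: filB Fx => //; apply: fil0. Qed.

Lemma filD i x y : F i x -> F i y -> F i (x + y).
Proof. by move=> Fx Fy; rewrite -[y]opprK; apply: filB => //; apply: filN. Qed.

Lemma fil_sum i (I : Type) (s : seq I) (P : pred I) (x : I -> X) :
  (forall j, P j -> F i (x j)) -> F i (\sum_(j <- s | P j) x j).
Proof. by move=> Fx; elim/big_ind: _ => //; [apply: fil0 | apply: filD]. Qed.

Variables (Y : zmodType) (G : int -> Y -> Prop) (hG : filtration G).

(** Subtracting leading terms taken from [S] pushes [x] arbitrarily deep without changing
    [f x - g x], which therefore lies in every [G j]. Identities between operators on series are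
    reduced to monomials this way. *)
Lemma filtered_ext (d : int) (f g : X -> Y) (S : int -> X -> Prop) :
    {morph f : x y / x - y} -> {morph g : x y / x - y} ->
    (forall i x, F i x -> G (i + d) (f x)) ->
    (forall i x, F i x -> G (i + d) (g x)) ->
    (forall i x, F i x -> exists2 y, S i y & F (i + 1) (x - y)) ->
    (forall i y, S i y -> f y = g y) ->
  f =1 g.
Proof.
move=> fB gB fF gF hS fg x; apply/eqP; rewrite -subr_eq0; apply/eqP.
apply: (fil_sep hG) => j; have [i Fx] := fil_ex hF x.
have [y Fy e] : exists2 y, F (i + (absz (j - d - i)%R)%:Z) y & f x - g x = f y - g y.
  elim: (absz (j - d - i)%R) => [|m [y Fy ->]]; first by exists x; rewrite ?addr0.
  have [z Sz Fyz] := hS _ _ Fy; exists (y - z).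
    by move: Fyz; congr F; lia.
  by rewrite fB gB (fg _ _ Sz) opprB addrA subrK.
by rewrite e; apply: filB => //; [move: (fF _ _ Fy)|move: (gF _ _ Fy)];
  apply: (fil_le hG); lia.
Qed.

Variables (d : int) (f : X -> Y).
Hypothesis fB : {morph f : x y / x - y}.
Hypothesis fF : forall i x, F i x -> G (i + d) (f x).
Hypothesis finj : forall i x, F i x -> G (i + d + 1) (f x) -> F (i + 1) x.

(** Injectivity on graded pieces lets [x] climb one degree at a time, starting from any degree that
    contains it. *)
Lemma filtered_strict i x : G (i + d) (f x) -> F i x.
Proof.
move=> Gfx; have [j Fx] := fil_ex hF x.
have [ij|ji] := leP i j; first exact: fil_le ij Fx.
have e : i = j + (absz (i - j)%R)%:Z by lia.
have : (j + (absz (i - j)%R)%:Z <= i) by lia.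
rewrite [X in F X]e; elim: (absz (i - j)%R) => [|m IH]; first by rewrite addr0.
move=> h; have -> : j + m.+1%:Z = j + m%:Z + 1 by lia.
apply: finj; first by apply: IH; lia.
by apply: fil_le Gfx => //; lia.
Qed.

(** Surjectivity on graded pieces gives successive corrections, which can be summed by completeness;
    injectivity is strictness together with separatedness. *)
Lemma filtered_bij :
    (forall i y, G (i + d) y ->
      exists2 x, F i x & G (i + d + 1) (y - f x)) ->
  bijective f.
Proof.
move=> fsurj; have f0 : f 0 = 0 by rewrite -(subrr 0) fB subrr.
have fD x y : f (x + y) = f x + f y.
  by rewrite -{1}[y]opprK fB -[- y]sub0r fB f0 sub0r opprK.
have surj y : exists x, f x = y.
  have [j Gy] := fil_ex hG y; pose i := j - d.
  have [sel hsel] : exists sel : nat -> Y -> X, forall m y, G (i + m%:Z + d) y ->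
      F (i + m%:Z) (sel m y) /\ G (i + m.+1%:Z + d) (y - f (sel m y)).
    have ex (my : nat * Y) : exists x, G (i + my.1%:Z + d) my.2 ->
        F (i + my.1%:Z) x /\ G (i + my.1.+1%:Z + d) (my.2 - f x).
      case: my => m z /=.
      have [Gz|nGz] := pselect (G (i + m%:Z + d) z); last by exists 0 => /nGz.
      have [x Fx Gx] := fsurj _ _ Gz; exists x => _; split => //.
      by move: Gx; congr G; lia.
    have [s hs] := choice ex.
    by exists (fun m z => s (m, z)) => m z /(hs (m, z)).
  (* [res m] is what remains of [y] after [m] corrections. *)
  pose fix res m := if m is m'.+1 then res m' - f (sel m' (res m')) else y.
  have Gres m : G (i + m%:Z + d) (res m).
    elim: m => [|m IH] /=; first by move: Gy; congr G; rewrite /i; lia.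
    by have [] := hsel _ _ IH.
  have [x hx] := fil_lim hF (fun m => (hsel _ _ (Gres m)).1).
  exists x; apply/eqP; rewrite -subr_eq0; apply/eqP; apply: (fil_sep hG) => l.
  have fsum m : res m = y - f (\sum_(j < m) sel j (res j)).
    elim: m => [|m IH]; first by rewrite big_ord0 f0 subr0.
    by rewrite big_ord_recr /= IH fD opprD addrA.
  have /fF := hx (absz (l - i - d)%R); rewrite fB => Gd.
  have := filB hG Gd (Gres _); rewrite fsum opprB addrA subrK.
  by apply: fil_le => //; lia.
have [g hg] := choice surj; exists g => // x.
apply/eqP; rewrite -subr_eq0; apply/eqP; apply: (fil_sep hF) => i.
by apply: filtered_strict; rewrite fB hg subrr; apply: fil0.
Qed.

End Filtration.

(** * Series *)

(* An abstract interface to [laurent k], which keeps unification from          *)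
(* unfolding the arithmetic of series.                                         *)
Record series_model (k : fieldType) := SeriesModel {
  series :> fieldType;
  scoef : series -> int -> k;
  sconst : k -> series;
  svar : series;
  stheta : series -> series;
  scomp : series -> series -> series;
  sorder f v := scoef f v != 0 /\ forall n, n < v -> scoef f n = 0;
  sfil i f := forall m, m < i -> scoef f m = 0;
  scoefP : forall f g, (forall i, scoef f i = scoef g i) -> f = g;
  scoef_bounded : forall f, exists i, sfil i f;
  scoefB : forall f g i, scoef (f - g) i = scoef f i - scoef g i;
  scoef_mk : forall (c : int -> k) (i : int), (forall n, n < i -> c n = 0) ->
    exists f, forall n, scoef f n = c n;
  scoef_conv : forall f g i j m, sfil i f -> sfil j g ->
    scoef (f * g) (i + j + m%:Z) =
    \sum_(l < m.+1) scoef f (i + l%:Z) * scoef g (j + (m - l)%N%:Z);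
  scoef_const : forall c i, scoef (sconst c) i = if i == 0 then c else 0;
  scoef_constM : forall c f i, scoef (sconst c * f) i = c * scoef f i;
  scoef_var : forall i, scoef svar i = (i == 1)%:R;
  scoef_theta : forall f i, scoef (stheta f) i = i%:~R * scoef f i;
  sthetaM : forall f g, stheta (f * g) = stheta f * g + f * stheta g;
  sorder_ex : forall f, f != 0 -> exists v, sorder f v;
  sorder_mul : forall f g i j, sorder f i -> sorder g j -> sorder (f * g) (i + j);
  sorder_exprz : forall f i n, sorder f i -> sorder (f ^ n) (n * i);
  scomp_conv : forall f p i m (M : nat), sorder p 1 -> sfil i f ->
    m < i + M%:Z ->
    scoef (scomp f p) m =
    \sum_(l < M) scoef f (i + l%:Z) * scoef (p ^ (i + l%:Z)) m }.

Arguments svar {k s}.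
Arguments sconst {k s}.

Section Series.
Variables (k : fieldType) (K : series_model k).
Implicit Types (f g : K) (i m : int).

Lemma scoef0 i : scoef (0 : K) i = 0.
Proof. by have := scoefB (0 : K) 0 i; rewrite !subrr. Qed.

Lemma scoefN f i : scoef (- f) i = - scoef f i.
Proof. by rewrite -sub0r scoefB scoef0 sub0r. Qed.

Lemma scoefD f g i : scoef (f + g) i = scoef f i + scoef g i.
Proof. by rewrite -[g in LHS]opprK scoefB scoefN opprK. Qed.

Lemma scoef_sum (I : Type) (s : seq I) (P : pred I) (F : I -> K) m :
  scoef (\sum_(i <- s | P i) F i) m = \sum_(i <- s | P i) scoef (F i) m.
Proof.
by elim/big_rec2: _ => [|i y1 y2 _ <-]; rewrite ?scoef0 ?scoefD.
Qed.

Lemma sfil_filtration : filtration (@sfil k K).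
Proof.
split.
- by move=> i m _; rewrite scoef0.
- by move=> i f g Ff Fg m mi; rewrite scoefB Ff// Fg// subrr.
- by move=> i j f ij Ff m mi; apply: Ff; apply: lt_le_trans ij.
- exact: scoef_bounded.
- by move=> f hf; apply: scoefP => n; rewrite scoef0 (hf (n + 1))//; lia.
move=> i x hx.
(* Since [x j] starts in degree [i + j], only the indices [j <= n - i] contribute in degree [n]. *)
pose y n := if n < i then 0 else
  \sum_(j < (absz (n - i)%R).+1) scoef (x j) n.
have [n ni|f hf] := @scoef_mk _ K y i; first by rewrite /y ni.
exists f => m n nm; rewrite scoefB scoef_sum hf /y; case: ltP => ni.
  by rewrite sub0r big1 ?oppr0// => j _; apply: hx; lia.
rewrite -!(big_mkord predT (fun j => scoef (x j) n)).
rewrite (@big_cat_nat _ _ _ (absz (n - i)%R).+1 0 m) //=; last by lia.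
rewrite opprD addrA subrr add0r big_nat_cond big1 ?oppr0//.
by move=> j /andP[/andP[hj _] _]; apply: hx; lia.
Qed.

Lemma sfilM i (j : int) f g : sfil i f -> sfil j g -> sfil (i + j) (f * g).
Proof.
have low (a b : int) f' g' : sfil a f' -> sfil b g' -> scoef (f' * g') (a + b) =
    scoef f' a * scoef g' b.
  by move=> hf hg; have := scoef_conv 0%N hf hg; rewrite big_ord1 !addr0.
(* The bound on [f] is weakened to [m - j], which makes [m] the leading degree of the product. *)
move=> hf hg m mij; have hf' : sfil (m - j) f by move=> l hl; apply: hf; lia.
by have := low _ _ _ _ hf' hg; rewrite subrK => ->; rewrite hf ?mul0r//; lia.
Qed.

Lemma scoef_lead i (j : int) f g : sfil i f -> sfil j g ->
  scoef (f * g) (i + j) = scoef f i * scoef g j.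
Proof.
by move=> hf hg; have := scoef_conv 0%N hf hg; rewrite big_ord1 !addr0.
Qed.

Lemma sorder_fil f i : sorder f i -> sfil i f. Proof. by case. Qed.

Lemma sorder_neq0 f i : sorder f i -> f != 0.
Proof. by case=> f0 _; apply: contraNneq f0 => ->; rewrite scoef0. Qed.

Lemma sorder_uniq f i (j : int) : sorder f i -> sorder f j -> i = j.
Proof.
move=> [fi hi] [fj hj]; have [/hj|/hi|//] := ltgtP i j.
  by move/eqP; rewrite (negPf fi).
by move/eqP; rewrite (negPf fj).
Qed.

Lemma sorderV f i : sorder f i -> sorder f^-1 (- i).
Proof. by move/sorder_exprz => /(_ (-1)); rewrite mulN1r. Qed.

Lemma sconst_fil c : sfil 0 (sconst c : K).
Proof. by move=> m m0; rewrite scoef_const ifF//; lia. Qed.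

Lemma stheta_fil f i : sfil i f -> sfil i (stheta f).
Proof. by move=> hf m mi; rewrite scoef_theta hf// mulr0. Qed.

Lemma svar_order : sorder (svar : K) 1.
Proof.
split; first by rewrite scoef_var oner_neq0.
by move=> n n1; rewrite scoef_var; case: eqP => // n1'; lia.
Qed.

Lemma svar_neq0 : (svar : K) != 0.
Proof. exact: sorder_neq0 svar_order. Qed.

Lemma svar_mul_coef f m : scoef (svar * f) m = scoef f (m - 1).
Proof.
have [j hj] := scoef_bounded f; have [_ h1] := svar_order.
have [mj|jm] := ltP m (1 + j); first by rewrite (sfilM h1 hj)// hj//; lia.
have -> : m = 1 + j + (absz (m - 1 - j)%R)%:Z by lia.
rewrite scoef_conv// big_ord_recl /= addr0 scoef_var eqxx mul1r.
rewrite big1 ?addr0; last by move=> l _; rewrite scoef_var mul0r.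
by congr scoef; lia.
Qed.

Lemma svar_exp_coef f i m : scoef (svar ^ i * f) m = scoef f (m - i).
Proof.
have nat_case (n : nat) (g : K) m' : scoef (svar ^+ n * g) m' = scoef g (m' - n%:Z).
  elim: n g m' => [|n IH] g m'; first by rewrite expr0 mul1r subr0.
  by rewrite exprS -mulrA svar_mul_coef IH; congr scoef; lia.
case: i => [n|n]; first exact: nat_case.
rewrite NegzE -exprnN.
have h : (svar ^+ n.+1 : K) != 0 by rewrite expf_neq0// svar_neq0.
by rewrite -[in RHS](mulVKf h f) nat_case; congr scoef; lia.
Qed.

Lemma svar_exp_fil i (j : int) f : sfil j f -> sfil (i + j) (svar ^ i * f).
Proof. by move=> hf m mi; rewrite svar_exp_coef hf//; lia. Qed.

Lemma sconstB (c d : k) : sconst (c - d) = sconst c - sconst d :> K.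
Proof.
by apply: scoefP => n; rewrite scoefB !scoef_const; case: eqP; rewrite ?subr0.
Qed.

Lemma sconst0 : sconst 0 = 0 :> K.
Proof. by rewrite -(subrr 0) sconstB subrr. Qed.

Lemma sconstN (c : k) : sconst (- c) = - sconst c :> K.
Proof. by rewrite -sub0r sconstB sconst0 sub0r. Qed.

Lemma sconstD (c d : k) : sconst (c + d) = sconst c + sconst d :> K.
Proof. by rewrite -{1}[d]opprK sconstB sconstN opprK. Qed.

Lemma sconstM (c d : k) : sconst (c * d) = sconst c * sconst d :> K.
Proof.
by apply: scoefP => n; rewrite scoef_constM !scoef_const; case: eqP; rewrite ?mulr0.
Qed.

Lemma sconst1 : sconst 1 = 1 :> K.
Proof.
by rewrite -[LHS]mulr1; apply: scoefP => n; rewrite scoef_constM mul1r.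
Qed.

Lemma sconst_nat (n : nat) : sconst n%:R = n%:R :> K.
Proof. by elim: n => [|n IH]; rewrite ?sconst0// -!natr1 sconstD IH sconst1. Qed.

Lemma sconst_int (i : int) : sconst i%:~R = i%:~R :> K.
Proof.
case: i => n; first by rewrite -!pmulrn sconst_nat.
by rewrite NegzE !mulrNz -!pmulrn sconstN sconst_nat.
Qed.

Lemma scoef_natM (n : nat) f m : scoef (n%:R * f) m = n%:R * scoef f m.
Proof. by rewrite -sconst_nat scoef_constM. Qed.

Lemma svar_exp_mono i m : scoef (svar ^ i : K) m = (m == i)%:R.
Proof.
rewrite -[svar ^ i]mulr1 svar_exp_coef -sconst1 scoef_const subr_eq0.
by case: eqP.
Qed.

Lemma smono_coef c i m :
  scoef (sconst c * svar ^ i : K) m = if m == i then c else 0.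
Proof.
by rewrite scoef_constM svar_exp_mono; case: eqP; rewrite ?mulr1 ?mulr0.
Qed.

Lemma smono_fil c i : sfil i (sconst c * svar ^ i : K).
Proof. by move=> m mi; rewrite smono_coef ifF//; lia. Qed.

Lemma smono_lead i f : sfil i f ->
  sfil (i + 1) (f - sconst (scoef f i) * svar ^ i).
Proof.
move=> hf m mi; rewrite scoefB smono_coef.
by case: eqP => [->|e]; rewrite ?subrr// subr0 hf//; lia.
Qed.

Lemma sthetaB f g : stheta (f - g) = stheta f - stheta g.
Proof. by apply: scoefP => m; rewrite scoefB !scoef_theta scoefB mulrBr. Qed.

Lemma stheta0 : stheta (0 : K) = 0.
Proof. by have := sthetaB (0 : K) 0; rewrite !subrr. Qed.

Lemma sthetaD f g : stheta (f + g) = stheta f + stheta g.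
Proof. by apply: scoefP => m; rewrite scoefD !scoef_theta scoefD mulrDr. Qed.

Lemma stheta_const c : stheta (sconst c) = 0 :> K.
Proof.
apply: scoefP => m; rewrite scoef_theta scoef_const scoef0.
by case: eqP => [->|_]; rewrite ?mul0r ?mulr0.
Qed.

Lemma stheta1 : stheta (1 : K) = 0. Proof. by rewrite -sconst1 stheta_const. Qed.

Lemma sthetaV f : f != 0 -> stheta f^-1 = - (stheta f / f ^+ 2).
Proof.
move=> f0; have := sthetaM f f^-1; rewrite divff// stheta1.
move/esym/eqP; rewrite addrC addr_eq0 => /eqP h.
by rewrite -[LHS](mulKf f0) h; field.
Qed.

Lemma stheta_exp f i : f != 0 ->
  stheta (f ^ i) = i%:~R * f ^ i * (stheta f / f).
Proof.
move=> f0; have nat_case (n : nat) :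
    stheta (f ^+ n) = n%:R * f ^+ n * (stheta f / f).
  elim: n => [|n IH]; first by rewrite expr0 stheta1 !mul0r.
  by rewrite exprS sthetaM IH -natr1; field.
case: i => n; first exact: nat_case.
rewrite NegzE -exprnN sthetaV ?expf_neq0// nat_case mulrNz -pmulrn.
have : f ^+ n.+1 != 0 by rewrite expf_neq0.
by move: (f ^+ n.+1) => g g0; field; rewrite f0 g0.
Qed.

Lemma stheta_var i : stheta (svar ^ i : K) = i%:~R * svar ^ i.
Proof.
apply: scoefP => m; rewrite scoef_theta -sconst_int smono_coef svar_exp_mono.
by case: eqP => [->|_]; rewrite ?mulr1 ?mulr0.
Qed.

End Series.

(** * Rows of series *)

Section Rows.
Variables (k : fieldType) (K : series_model k).

Section RowFiltration.
Variable n : nat.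
Implicit Type u : 'rV[K]_n.

Definition rcoef u (i : int) : 'rV[k]_n := \row_c scoef (u 0 c) i.

Definition rconst (v : 'rV[k]_n) : 'rV[K]_n := map_mx sconst v.

Definition rfil (i : int) u : Prop := forall m, m < i -> rcoef u m = 0.

Definition rmono (i : int) u : Prop := exists v, u = svar ^ i *: rconst v.

Lemma rcoefP u u' : (forall i, rcoef u i = rcoef u' i) -> u = u'.
Proof.
move=> e; apply/rowP => c; apply: scoefP => i.
by have /rowP/(_ c) := e i; rewrite !mxE.
Qed.

Lemma rcoef_mk (w : int -> 'rV[k]_n) (i : int) :
  (forall m, m < i -> w m = 0) -> exists u, forall m, rcoef u m = w m.
Proof.
move=> hw; have /fin_all_exists[f hf] (c : 'I_n) : exists f : K, forall m,
    scoef f m = w m 0 c.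
  by apply: (@scoef_mk _ _ _ i) => m /hw ->; rewrite mxE.
by exists (\row_c f c) => m; apply/rowP => c; rewrite !mxE.
Qed.

Lemma rcoef0 i : rcoef 0 i = 0. Proof. by apply/rowP => c; rewrite !mxE scoef0. Qed.

Lemma rcoefD u u' i : rcoef (u + u') i = rcoef u i + rcoef u' i.
Proof. by apply/rowP => c; rewrite !mxE scoefD. Qed.

Lemma rcoefB u u' i : rcoef (u - u') i = rcoef u i - rcoef u' i.
Proof. by apply/rowP => c; rewrite !mxE scoefB. Qed.

Lemma rfilE i u : rfil i u <-> forall c, sfil i (u 0 c).
Proof.
split=> h; first by move=> c m /h/rowP/(_ c); rewrite !mxE.
by move=> m mi; apply/rowP => c; rewrite !mxE h.
Qed.

Lemma rfil_filtration : filtration rfil.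
Proof.
split.
- by move=> i m _; rewrite rcoef0.
- by move=> i u u' hu hu' m mi; rewrite rcoefB hu// hu'// subrr.
- by move=> i j u ij hu m mi; apply: hu; apply: lt_le_trans ij.
- move=> u; pose b c := xget 0 [set N : int | sfil N (u 0 c)]%classic.
  have hb c : sfil (b c) (u 0 c).
    rewrite /b; case: xgetP => // none; have [N hN] := scoef_bounded (u 0 c).
    by case: (none N).
  exists (\big[Order.min/0]_c b c); apply/rfilE => c m mb; apply: hb.
  by apply: lt_le_trans mb _; apply: bigmin_le.
- by move=> u hu; apply: rcoefP => i; rewrite rcoef0 (hu (i + 1))//; lia.
move=> i x hx.
have /fin_all_exists[y hy] (c : 'I_n) : exists y : K, forall m,
    sfil (i + m%:Z) (y - \sum_(j < m) x j 0 c).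
  apply: (fil_lim (sfil_filtration K) (x := fun m => x m 0 c)) => m.
  by move: (hx m) => /rfilE.
exists (\row_c y c) => m; apply/rfilE => c.
by rewrite !mxE summxE.
Qed.

Lemma rfilZ i j (f : K) u : sfil i f -> rfil j u -> rfil (i + j) (f *: u).
Proof. by move=> hf /rfilE hu; apply/rfilE => c; rewrite mxE; apply: sfilM. Qed.

Lemma rcoef_lead i j (f : K) u : sfil i f -> rfil j u ->
  rcoef (f *: u) (i + j) = scoef f i *: rcoef u j.
Proof.
by move=> hf /rfilE hu; apply/rowP => c; rewrite !mxE (scoef_lead hf (hu c)).
Qed.

Lemma rcoef_conv (f : K) u i j (m : nat) : sfil i f -> rfil j u ->
  rcoef (f *: u) (i + j + m%:Z) =
  \sum_(l < m.+1) scoef f (i + (m - l)%N%:Z) *: rcoef u (j + l%:Z).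
Proof.
move=> hf /rfilE hu; apply/rowP => c; rewrite !mxE summxE mulrC addrC.
rewrite (addrC i) addrC (scoef_conv _ (hu c) hf).
by apply: eq_bigr => l _; rewrite !mxE mulrC.
Qed.

Lemma rvar_exp_coef i u m : rcoef (svar ^ i *: u) m = rcoef u (m - i).
Proof. by apply/rowP => c; rewrite !mxE svar_exp_coef. Qed.

Lemma rvar_exp_fil i j u : rfil j u -> rfil (i + j) (svar ^ i *: u).
Proof. by move=> hu m mi; rewrite rvar_exp_coef hu//; lia. Qed.

Lemma rconst_coef v i : rcoef (rconst v) i = if i == 0 then v else 0.
Proof. by apply/rowP => c; rewrite !mxE scoef_const; case: eqP; rewrite ?mxE. Qed.

Lemma rconst_fil v : rfil 0 (rconst v).
Proof. by move=> m m0; rewrite rconst_coef ifF//; lia. Qed.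

Lemma rmono_coef i v m :
  rcoef (svar ^ i *: rconst v) m = if m == i then v else 0.
Proof. by rewrite rvar_exp_coef rconst_coef subr_eq0. Qed.

Lemma rmono_fil i v : rfil i (svar ^ i *: rconst v).
Proof. by have := rvar_exp_fil (i := i) (rconst_fil v); rewrite addr0. Qed.

Lemma rmono_lead i u : rfil i u ->
  rfil (i + 1) (u - svar ^ i *: rconst (rcoef u i)).
Proof.
move=> hu m mi; rewrite rcoefB rmono_coef; case: eqP => [->|e].
  by rewrite subrr.
by rewrite subr0 hu//; lia.
Qed.

End RowFiltration.

Lemma row_ext (n p : nat) (d : int) (f g : 'rV[K]_n -> 'rV[K]_p) :
    {morph f : x y / x - y} -> {morph g : x y / x - y} ->
    (forall i u, rfil i u -> rfil (i + d) (f u)) ->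
    (forall i u, rfil i u -> rfil (i + d) (g u)) ->
    (forall i v, f (svar ^ i *: rconst v) = g (svar ^ i *: rconst v)) ->
  f =1 g.
Proof.
move=> fB gB ff gf fg.
apply: (filtered_ext (rfil_filtration n) (rfil_filtration p)
  (S := @rmono n) fB gB ff gf).
  move=> i u hu; exists (svar ^ i *: rconst (rcoef u i)); first by eexists.
  exact: rmono_lead.
by move=> i u [v ->].
Qed.

Lemma series_row_ext (p : nat) (d : int) (f g : K -> 'rV[K]_p) :
    {morph f : x y / x - y} -> {morph g : x y / x - y} ->
    (forall i u, sfil i u -> rfil (i + d) (f u)) ->
    (forall i u, sfil i u -> rfil (i + d) (g u)) ->
    (forall i c, f (sconst c * svar ^ i) = g (sconst c * svar ^ i)) ->
  f =1 g.
Proof.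
move=> fB gB ff gf fg.
apply: (filtered_ext (sfil_filtration K) (rfil_filtration p)
  (S := fun i u => exists c, u = sconst c * svar ^ i) fB gB ff gf).
  move=> i u hu; exists (sconst (scoef u i) * svar ^ i); first by eexists.
  exact: smono_lead.
by move=> i u [v ->].
Qed.

Lemma series_ext (d : int) (f g : K -> K) :
    {morph f : x y / x - y} -> {morph g : x y / x - y} ->
    (forall i u, sfil i u -> sfil (i + d) (f u)) ->
    (forall i u, sfil i u -> sfil (i + d) (g u)) ->
    (forall i c, f (sconst c * svar ^ i) = g (sconst c * svar ^ i)) ->
  f =1 g.
Proof.
move=> fB gB ff gf fg.
apply: (filtered_ext (sfil_filtration K) (sfil_filtration K)
  (S := fun i u => exists c, u = sconst c * svar ^ i) fB gB ff gf).
  move=> i u hu; exists (sconst (scoef u i) * svar ^ i); first by eexists.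
  exact: smono_lead.
by move=> i u [v ->].
Qed.

(** On the graded piece of degree [i] the map is multiplication by the nonzero scalar [c i], so the
    filtered criterion applies; the second conclusion is strictness. *)
Lemma row_lead_bij (n : nat) (d : int) (f : 'rV[K]_n -> 'rV[K]_n) (c : int -> k) :
    {morph f : x y / x - y} ->
    (forall i u, rfil i u -> rfil (i + d) (f u)) ->
    (forall i u, rfil i u -> rcoef (f u) (i + d) = c i *: rcoef u i) ->
    (forall i, c i != 0) ->
  bijective f /\ forall i u, rfil (i + d) (f u) -> rfil i u.
Proof.
move=> fB ff fc c0; have hF := rfil_filtration n.
have finj i u : rfil i u -> rfil (i + d + 1) (f u) -> rfil (i + 1) u.
  move=> hu hfu m mi; have [/hu//|im] := ltP m i; have -> : m = i by lia.
  have := fc _ _ hu; rewrite hfu; last by lia.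
  by move/esym/eqP; rewrite scaler_eq0 (negPf (c0 i)) => /eqP.
split; last first.
  by move=> i u h; exact: (filtered_strict hF hF finj h).
apply: (filtered_bij hF hF fB ff finj) => i y hy.
pose x := svar ^ i *: rconst ((c i)^-1 *: rcoef y (i + d)).
have hx : rfil i x by apply: rmono_fil.
exists x => // m mi; rewrite rcoefB.
have [m'|m'] := ltP m (i + d); first by rewrite hy// (ff _ _ hx)// subrr.
have -> : m = i + d by lia.
by rewrite fc// rmono_coef eqxx scalerA divff// scale1r subrr.
Qed.

Section MonomialExtension.
Variables (n p : nat) (d : int) (g : int -> 'rV[k]_n -> 'rV[K]_p).
Hypothesis gB : forall i, {morph g i : x y / x - y}.
Hypothesis gf : forall i v, rfil (i + d) (g i v).

Let g0 i : g i 0 = 0. Proof. by rewrite -(subrr 0) gB subrr. Qed.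

(** Only finitely many monomials reach degree [m]: those below [a] are absent from [u], and the
    images of those from [a + M] on start above [m]. *)
Let coefE u (a m : int) (M : nat) : rfil a u -> m < a + d + M%:Z ->
  \row_c \sum_(i \in [set: int]) scoef (g i (rcoef u i) 0 c) m =
  \sum_(l < M) rcoef (g (a + l%:Z) (rcoef u (a + l%:Z))) m.
Proof.
move=> hu hm; apply/rowP => c; rewrite mxE summxE.
rewrite (@fsbig_int_interval _ _ a M).
  by apply: eq_bigr => l _; rewrite !mxE.
move=> i; have [ia|ai] := ltP i a; first by rewrite hu// g0 mxE scoef0 eqxx.
have [//|Mi] := ltP i (a + M%:Z).
have /rfilE/(_ c) -> := @gf i (rcoef u i); first by rewrite eqxx.
lia.
Qed.

Let ext_ex (u : 'rV[K]_n) : exists w : 'rV[K]_p, forall m, rcoef w m =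
  \row_c \sum_(i \in [set: int]) scoef (g i (rcoef u i) 0 c) m.
Proof.
have [a hu] := fil_ex (rfil_filtration n) u.
apply: (@rcoef_mk _ _ (a + d)) => m hm.
by rewrite (@coefE _ a _ 0)// ?big_ord0//; lia.
Qed.

(* The continuous extension of [Z^i v |-> g i v]. *)
Definition mono_ext (u : 'rV[K]_n) : 'rV[K]_p := xget 0 [set w : 'rV[K]_p |
  forall m, rcoef w m =
  \row_c \sum_(i \in [set: int]) scoef (g i (rcoef u i) 0 c) m]%classic.

Lemma mono_ext_coef u (a m : int) (M : nat) : rfil a u -> m < a + d + M%:Z ->
  rcoef (mono_ext u) m =
  \sum_(l < M) rcoef (g (a + l%:Z) (rcoef u (a + l%:Z))) m.
Proof.
move=> hu hm; rewrite /mono_ext; have [w hw] := ext_ex u.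
by case: xgetP => [x _ /= -> | /(_ w)//]; apply: coefE.
Qed.

Lemma mono_ext_fil i u : rfil i u -> rfil (i + d) (mono_ext u).
Proof.
by move=> hu m mi; rewrite (@mono_ext_coef _ i _ 0)// ?big_ord0//; lia.
Qed.

Lemma mono_extB : {morph mono_ext : u v / u - v}.
Proof.
move=> u v; have hF := rfil_filtration n.
have [a ha] := fil_ex hF u; have [b hb] := fil_ex hF v.
pose c := Order.min a b.
have hu : rfil c u by apply: (fil_le hF) ha; rewrite ge_min lexx.
have hv : rfil c v by apply: (fil_le hF) hb; rewrite ge_min lexx orbT.
apply: rcoefP => m; have hm : m < c + d + (absz (m - c - d)%R).+1%:Z by lia.
have huv : rfil c (u - v) := filB hF hu hv.
rewrite rcoefB (mono_ext_coef huv hm) (mono_ext_coef hu hm) (mono_ext_coef hv hm).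
rewrite -sumrB; apply: eq_bigr => l _; by rewrite rcoefB gB rcoefB.
Qed.

Lemma mono_ext_mono i v : mono_ext (svar ^ i *: rconst v) = g i v.
Proof.
apply: rcoefP => m.
have hm : m < i + d + (absz (m - i - d)%R).+1%:Z by lia.
rewrite (mono_ext_coef (@rmono_fil n i v) hm) big_ord_recl /= addr0.
rewrite rmono_coef eqxx big1 ?addr0// => l _.
by rewrite rmono_coef ifF ?g0 ?rcoef0//; rewrite /bump; lia.
Qed.

End MonomialExtension.

End Rows.

(** * Composition of series *)

Section Composition.
Variables (k : fieldType) (K : series_model k) (p : K).
Hypothesis p1 : sorder p 1.

Lemma exprz_order1 (i : int) : sorder (p ^ i) i.
Proof. by have := sorder_exprz i p1; rewrite mulr1. Qed.

Lemma scomp_fil (i : int) (f : K) : sfil i f -> sfil i (scomp f p).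
Proof.
by move=> hf m mi; rewrite (@scomp_conv _ _ _ _ i _ 0)// ?big_ord0//; lia.
Qed.

Lemma scomp_lead (i : int) (f : K) : sfil i f ->
  scoef (scomp f p) i = scoef f i * scoef (p ^ i) i.
Proof.
by move=> hf; rewrite (@scomp_conv _ _ _ _ i _ 1)// ?big_ord1 ?addr0//; lia.
Qed.

Lemma scompB (f g : K) : scomp (f - g) p = scomp f p - scomp g p.
Proof.
have hF := sfil_filtration K.
have [a ha] := fil_ex hF f; have [b hb] := fil_ex hF g.
pose c := Order.min a b.
have hf : sfil c f by apply: (fil_le hF) ha; rewrite ge_min lexx.
have hg : sfil c g by apply: (fil_le hF) hb; rewrite ge_min lexx orbT.
have hfg : sfil c (f - g) := filB hF hf hg.
apply: scoefP => m; have hm : m < c + (absz (m - c)%R).+1%:Z by lia.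
rewrite scoefB (scomp_conv p1 hfg hm) (scomp_conv p1 hf hm) (scomp_conv p1 hg hm).
by rewrite -sumrB; apply: eq_bigr => l _; rewrite scoefB mulrBl.
Qed.

Lemma scomp0 : scomp (0 : K) p = 0.
Proof. by have := scompB (0 : K) 0; rewrite !subrr. Qed.

Lemma scomp_mono (c : k) (i : int) :
  scomp (sconst c * svar ^ i : K) p = sconst c * p ^ i.
Proof.
have hc := @smono_fil _ K c i.
apply: scoefP => m; have hm : m < i + (absz (m - i)%R).+1%:Z by lia.
rewrite (scomp_conv p1 hc hm) scoef_constM.
under eq_bigr => l _ do rewrite smono_coef.
rewrite big_ord_recl /= addr0 eqxx big1 ?addr0// => l _.
by rewrite ifF ?mul0r//; rewrite /bump; lia.
Qed.

Lemma scomp_var_exp (i : int) : scomp (svar ^ i : K) p = p ^ i.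
Proof. by have := scomp_mono 1 i; rewrite sconst1 !mul1r. Qed.

Lemma scomp_var : scomp (svar : K) p = p. Proof. exact: scomp_var_exp 1. Qed.

Lemma scomp_const c : scomp (sconst c : K) p = sconst c.
Proof. by have := scomp_mono c 0; rewrite !expr0z !mulr1. Qed.

Lemma scomp1 : scomp (1 : K) p = 1.
Proof. by rewrite -sconst1 scomp_const. Qed.

Lemma scomp_mulvar (i : int) (f : K) : scomp (svar ^ i * f) p = p ^ i * scomp f p.
Proof.
move: f; apply: (series_ext (d := i)).
- by move=> f g; rewrite mulrBr scompB.
- by move=> f g; rewrite scompB mulrBr.
- by move=> j f hf; apply: scomp_fil; rewrite addrC; apply: svar_exp_fil.
- move=> j f hf; rewrite addrC; apply: sfilM; last exact: scomp_fil.
  exact: (exprz_order1 i).2.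
move=> j c; rewrite mulrCA -expfzDr ?svar_neq0// !scomp_mono mulrCA -expfzDr//.
exact: sorder_neq0 p1.
Qed.

(** By continuity in each factor separately, it is enough to multiply two monomials. *)
Lemma scompM (f g : K) : scomp (f * g) p = scomp f p * scomp g p.
Proof.
have [a hg] := fil_ex (sfil_filtration K) g.
move: f; apply: (series_ext (d := a)).
- by move=> f h; rewrite mulrBl scompB.
- by move=> f h; rewrite scompB mulrBl.
- by move=> j f hf; apply: scomp_fil; apply: sfilM.
- by move=> j f hf; apply: sfilM; apply: scomp_fil.
move=> j c; rewrite -mulrA mulrC -mulrA scomp_mulvar scomp_mono -!mulrA mulrCA.
congr (_ * _); move: g {hg}; apply: (series_ext (d := 0)).
- by move=> f h; rewrite mulrBl scompB.
- by move=> f h; rewrite scompB mulrBr.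
- move=> i f hf; apply: scomp_fil; apply: sfilM => //; exact: sconst_fil.
- move=> i f hf; rewrite addrC; apply: sfilM; first exact: sconst_fil.
  exact: scomp_fil.
move=> i d; rewrite mulrC mulrA -sconstM !scomp_mono mulrA -sconstM.
by rewrite mulrC.
Qed.

Lemma scomp_lead_neq0 (f : K) i : sorder f i -> sorder (scomp f p) i.
Proof.
move=> [f0 hf]; split; last exact: scomp_fil.
by rewrite scomp_lead// mulf_neq0//; case: (exprz_order1 i).
Qed.

Lemma scomp_neq0 (f : K) : f != 0 -> scomp f p != 0.
Proof.
by move=> /sorder_ex[i hf]; exact: sorder_neq0 (scomp_lead_neq0 hf).
Qed.

Lemma scompV (f : K) : scomp f^-1 p = (scomp f p)^-1.
Proof.
have [->|f0] := eqVneq f 0; first by rewrite invr0 scomp0 invr0.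
apply: (mulfI (scomp_neq0 f0)); rewrite -scompM !divff ?scomp_neq0//.
exact: scomp1.
Qed.

Lemma scomp_exprz (f : K) (i : int) : scomp (f ^ i) p = scomp f p ^ i.
Proof.
have nat_case (n : nat) : scomp (f ^+ n) p = scomp f p ^+ n.
  elim: n => [|n IH]; first exact: scomp1.
  by rewrite !exprS scompM IH.
case: i => n; first exact: nat_case.
by rewrite NegzE -!exprnN scompV nat_case.
Qed.

(** The chain rule for logarithmic derivations; on monomials it is the formula for
    [stheta (p ^ i)]. *)
Lemma stheta_scomp (f : K) :
  stheta (scomp f p) = stheta p / p * scomp (stheta f) p.
Proof.
have hp : sfil 0 (stheta p / p).
  have := sfilM (stheta_fil (sorder_fil p1)) (sorder_fil (sorderV p1)).
  by rewrite addrC.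
move: f; apply: (series_ext (d := 0)).
- by move=> f h; rewrite scompB sthetaB.
- by move=> f h; rewrite sthetaB scompB mulrBr.
- by move=> i f hf; rewrite addr0; apply: stheta_fil; apply: scomp_fil.
- move=> i f hf; rewrite addrC; apply: sfilM => //.
  by apply: scomp_fil; apply: stheta_fil.
move=> i c; rewrite sthetaM stheta_const mul0r add0r stheta_var mulrCA.
rewrite -sconst_int mulrA -sconstM !scomp_mono sthetaM stheta_const mul0r.
rewrite add0r stheta_exp ?(sorder_neq0 p1)// sconstM sconst_int.
by field; apply: sorder_neq0 p1.
Qed.

(** In degree [i] the composition multiplies the leading coefficient by that of [p ^ i], which is
    nonzero. *)
Lemma scomp_bij : bijective (fun f : K => scomp f p).
Proof.
apply: (@filtered_bij _ _ (sfil_filtration K) _ _ (sfil_filtration K) 0).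
- by move=> f g; exact: scompB.
- by move=> i f hf; rewrite addr0; apply: scomp_fil.
- move=> i f hf; rewrite addr0 => h m hm.
  have [/hf//|im] := ltP m i; have -> : m = i by lia.
  move: (h i); rewrite scomp_lead// => /(_ _)/eqP; rewrite mulf_eq0.
  by rewrite (negPf (exprz_order1 i).1) orbF => e; apply/eqP/e; lia.
move=> i g; rewrite addr0 => hg; pose c := scoef g i / scoef (p ^ i) i.
have pi0 := (exprz_order1 i).1.
exists (sconst c * svar ^ i).
  exact: smono_fil.
rewrite scomp_mono => m hm; rewrite scoefB scoef_constM.
have [mi|im] := ltP m i; first by rewrite hg// (exprz_order1 i).2// mulr0 subr0.
have -> : m = i by lia.
by rewrite /c divfK// subrr.
Qed.

End Composition.

Lemma scomp_id (k : fieldType) (K : series_model k) (f : K) : scomp f svar = f.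
Proof.
have v1 := svar_order K.
move: f; apply: (series_ext (d := 0)) => //.
- by move=> f g; exact: scompB.
- by move=> i f hf; rewrite addr0; apply: scomp_fil.
- by move=> i f hf; rewrite addr0.
by move=> i c; rewrite scomp_mono.
Qed.

Lemma scompA (k : fieldType) (K : series_model k) (f g h : K) :
  sorder g 1 -> sorder h 1 ->
  scomp (scomp f g) h = scomp f (scomp g h).
Proof.
move=> g1 h1; have gh1 := scomp_lead_neq0 h1 g1.
move: f; apply: (series_ext (d := 0)).
- by move=> f f'; rewrite !scompB.
- by move=> f f'; exact: scompB.
- by move=> i f hf; rewrite addr0; do 2!apply: scomp_fil => //.
- by move=> i f hf; rewrite addr0; apply: scomp_fil.
by move=> i c; rewrite !scomp_mono// scompM// scomp_const// scomp_exprz.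
Qed.

(** The inverse is the preimage of the variable under [f |-> f(g)]; it works on the other side as
    well, by associativity and injectivity of this map. *)
Lemma scomp_inverse (k : fieldType) (K : series_model k) (g : K) : sorder g 1 ->
  exists h, [/\ sorder h 1, scomp g h = svar & scomp h g = svar].
Proof.
move=> g1; have [c cK gK] := scomp_bij g1; exists (c svar).
have h1 : sorder (c svar) 1.
  have hne : c svar != 0.
    by apply/eqP => h; have := gK svar; rewrite h scomp0// => /esym/eqP;
      apply/negP/svar_neq0.
  have [i hi] := sorder_ex hne.
  have := scomp_lead_neq0 g1 hi; rewrite gK.
  by move/(sorder_uniq (svar_order K)) => e; rewrite [1]e.
split => //; apply: (can_inj cK); rewrite scompA// gK scomp_id.
by rewrite scomp_var.
Qed.

(** * Difference and differential equations *)

Section Characteristic0.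
Variables (k : fieldType) (char0 : [pchar k] =i pred0).

Lemma natf_neq0 (n : nat) : (0 < n)%N -> n%:R != 0 :> k.
Proof. by have /pcharf0P -> := char0; rewrite lt0n. Qed.

Lemma intf_neq0 (i : int) : i != 0 -> i%:~R != 0 :> k.
Proof.
case: i => n n0; first by rewrite -pmulrn natf_neq0// lt0n.
by rewrite NegzE mulrNz -pmulrn oppr_eq0 natf_neq0.
Qed.

Lemma intf_inj : injective (fun i : int => i%:~R : k).
Proof.
move=> i j /= /eqP; rewrite -subr_eq0 -rmorphB => ij; apply/eqP.
by rewrite -subr_eq0; apply: contraTT ij => /intf_neq0.
Qed.

Section Difference.
Variables (c : k) (c0 : c != 0).

(** The two top terms of the binomial expansion; [r] collects everything of degree below [m]. *)
Lemma shift_exp (m : nat) : exists2 r : {poly k}, (size r <= m)%N &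
  ('X + c%:P) ^+ m.+1 = 'X^(m.+1) + ((m.+1)%:R * c) *: 'X^m + r.
Proof.
elim: m => [|m [r sr IH]].
  by exists 0; rewrite ?size_poly0// !expr1 expr0 mul1r addr0 alg_polyC.
exists ('X * r + (m.+1%:R * c ^+ 2) *: ('X^m) + c *: r).
  rewrite (leq_trans (size_polyD _ _))// geq_max; apply/andP; split; last first.
    by rewrite (leq_trans (size_scale_leq _ _))// ltnW.
  rewrite (leq_trans (size_polyD _ _))// geq_max; apply/andP; split.
    by rewrite (leq_trans (size_polyMleq _ _))// size_polyX.
  by rewrite (leq_trans (size_scale_leq _ _))// size_polyXn.
rewrite exprS IH -!mul_polyC [in RHS]exprS !exprS -!natr1 !polyCM !polyCD.
by rewrite polyC_exp; ring.
Qed.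

(** Degree induction: the difference of ['X^(m.+1)] has top coefficient [m.+1 * c] in degree [m],
    nonzero in characteristic 0, so a multiple of it cancels the top term of [g]. *)
Lemma difference_surj (g : {poly k}) : exists u, u \Po ('X + c%:P) - u = g.
Proof.
elim: {g}(size g) {-2}g (leqnn (size g)) => [|m IH] g sg.
  exists 0; rewrite comp_poly0 subrr; apply/esym/eqP.
  by rewrite -size_poly_leq0.
have [r sr hr] := shift_exp m; have mc : m.+1%:R * c != 0.
  by rewrite mulf_neq0// natf_neq0.
pose a := g`_m / (m.+1%:R * c).
have [|u hu] := IH (g - g`_m *: 'X^m - a *: r).
  apply/leq_sizeP => j mj; rewrite !coefB !coefZ coefXn (leq_sizeP _ _ sr j mj).
  rewrite mulr0 subr0; have [->|jm] := eqVneq j m; first by rewrite mulr1 subrr.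
  by rewrite mulr0 subr0 (leq_sizeP _ _ sg)// ltn_neqAle eq_sym jm.
exists (u + a *: 'X^(m.+1)).
rewrite comp_polyD comp_polyZ comp_Xn_poly opprD addrACA hu -scalerBr hr.
have -> (x y z : {poly k}) : x + y + z - x = y + z by ring.
by rewrite scalerDr scalerA divfK//; ring.
Qed.

(** [u - u(0)] vanishes at all the points [n * c], of which there are infinitely many in
    characteristic 0. *)
Lemma periodic_const (u : {poly k}) :
  (forall n : nat, u.[n%:R * c + c] = u.[n%:R * c]) -> exists a, u = a%:P.
Proof.
move=> hc; exists u.[0]; apply/eqP; rewrite -subr_eq0.
set v := u - _; apply/eqP.
have hv (n : nat) : root v (n%:R * c).
  suff e : u.[n%:R * c] = u.[0] by rewrite /root !hornerE e subrr.
  by elim: n => [|n <-]; rewrite ?mul0r// -natr1 mulrDl mul1r hc.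
apply: (@roots_geq_poly_eq0 _ _ [seq n%:R * c | n <- iota 0 (size v)]).
- by apply/allP => x /mapP[n _ ->]; apply: hv.
- rewrite map_inj_uniq ?iota_uniq// => i j /(mulIf c0) e.
  have := @intf_inj i%:Z j%:Z; rewrite /= -!pmulrn => /(_ e) [].
  by [].
- by rewrite size_map size_iota.
Qed.

End Difference.

Variable K : series_model k.

(** Coefficients of the solution [exp (x * integral of Y dZ/Z)] of [theta g = x * Y * g], where
    [y l] is the coefficient of [Y] in degree [l + 1]. Keeping [x] as a polynomial variable allows
    evaluation both at 1 and at a matrix. *)
Lemma formal_ode_poly (y : nat -> k) : exists g : nat -> {poly k},
  g 0%N = 1 /\ forall m, (m.+1)%:R *: g m.+1 =
    'X * \sum_(l < m.+1) y (m - l)%N *: g l.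
Proof.
have [|g n|g hg] := @strong_recursion {poly k} 0 (fun g n t =>
  if n is m.+1 then (m.+1)%:R *: t = 'X * \sum_(l < m.+1) y (m - l)%N *: g l
  else t = 1).
- move=> f g [|m] t fg //= ->; congr (_ * _); apply: eq_bigr => l _.
  by rewrite fg.
- case: n => [|m]; first by exists 1.
  exists ((m.+1)%:R^-1 *: ('X * \sum_(l < m.+1) y (m - l)%N *: g l)).
  by rewrite scalerA divff ?scale1r// natf_neq0.
by exists g; split=> [|m]; [exact: (hg 0%N) | exact: (hg m.+1)].
Qed.

Lemma formal_ode (y : K) : sfil 1 y ->
  exists g : K, [/\ sorder g 0, scoef g 0 = 1 & stheta g = y * g].
Proof.
move=> hy; have [p [p0 hp]] := formal_ode_poly (fun l => scoef y (1 + l%:Z)).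
pose c (n : int) := if n < 0 then 0 else (p (absz n)).[1].
have [|g hg] := @scoef_mk _ K c 0; first by move=> n n0; rewrite /c n0.
have gf : sfil 0 g by move=> n n0; rewrite hg /c n0.
have g0 : scoef g 0 = 1 by rewrite hg /c /= p0 hornerE.
exists g; split => //; first by split; rewrite // g0 oner_neq0.
apply: scoefP => n; rewrite mulrC; have [n1|n1] := ltP n 1.
  rewrite (sfilM gf hy) ?add0r// scoef_theta.
  have [n0|n0] := ltP n 0; first by rewrite gf ?mulr0.
  have -> : n = 0 by lia.
  by rewrite mul0r.
have [m ->] : exists m : nat, n = 0 + 1 + m%:Z by exists (absz (n - 1)%R); lia.
rewrite (scoef_conv m gf hy) scoef_theta.
have -> : 0 + 1 + m%:Z = m.+1%:Z by lia.
have := congr1 (fun q => q.[1]) (hp m); rewrite hornerZ hornerM hornerX mul1r.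
rewrite hg /c /= => ->; rewrite horner_sum; apply: eq_bigr => l _.
by rewrite hornerZ hg add0r mulrC.
Qed.

Lemma stheta_eq0 (f : K) : stheta f = 0 -> f = sconst (scoef f 0).
Proof.
move=> hf; apply: scoefP => n; rewrite scoef_const; case: eqP => [->//|/eqP n0].
have := congr1 (fun h => scoef h n) hf; rewrite scoef_theta scoef0 => /eqP.
by rewrite mulf_eq0 (negPf (intf_neq0 n0)) => /eqP.
Qed.

End Characteristic0.

Section Roots.
Variables (k : closedFieldType) (char0 : [pchar k] =i pred0).
Variable K : series_model k.

Lemma closed_field_root (c : k) (n : nat) : (0 < n)%N -> exists x, x ^+ n = c.
Proof.
move=> n0; have /closed_rootP[x] : size ('X^n - c%:P : {poly k}) != 1%N.
  by rewrite size_XnsubC//; lia.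
by rewrite /root !hornerE subr_eq0 => /eqP <-; exists x.
Qed.

(** After a root of the leading monomial is split off, a unit [h] with constant term 1 remains; its
    root [exp (log h / n)] is obtained as the solution of [theta e = (theta h / h) / n * e]. *)
Lemma series_root (f : K) (n : nat) : (0 < n)%N -> sorder f n%:Z ->
  exists2 g, sorder g 1 & g ^+ n = f.
Proof.
move=> n0 [fn hf]; have nK : n%:R != 0 :> K.
  rewrite -sconst_nat; apply/eqP => h; have := natf_neq0 char0 n0.
  by have := congr1 (fun g => scoef g 0) h; rewrite scoef_const scoef0 /= => ->;
    rewrite eqxx.
have [x hx] := closed_field_root (scoef f n%:Z) n0.
have x0 : x != 0.
  by apply: contraNneq fn => x0; rewrite -hx x0 expr0n eqn0Ngt n0.
have xK : sconst x != 0 :> K.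
  apply/eqP => h; have := congr1 (fun g => scoef g 0) h.
  by rewrite scoef_const scoef0 /= => /eqP; apply/negP.
have vK := svar_neq0 K.
pose g0 := sconst x * svar : K.
have g00 : g0 != 0 by rewrite mulf_neq0.
have g01 : sorder g0 1.
  have -> : g0 = sconst x * svar ^ (1 : int) by [].
  by split; [rewrite smono_coef eqxx | apply: smono_fil].
pose h := f / g0 ^+ n.
have g0n : sorder (g0 ^+ n) n%:Z.
  by have := sorder_exprz n%:Z g01; rewrite mulr1.
have h_fil : sfil 0 h.
  by have := sfilM hf (sorder_fil (sorderV g0n)); rewrite subrr.
have h0 : scoef h 0 = 1.
  have e : f = h * g0 ^+ n by rewrite /h divfK// expf_neq0.
  have := scoef_lead h_fil (sorder_fil g0n); rewrite -e add0r.
  rewrite exprMn_comm; last exact: mulrC.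
  have -> : sconst x ^+ n = sconst (x ^+ n) :> K.
    by elim: (n) => [|m IH]; rewrite ?sconst1// !exprS IH sconstM.
  have -> : (svar ^+ n : K) = svar ^ n%:Z by [].
  rewrite smono_coef eqxx hx => /eqP.
  by rewrite -{1}[scoef f _]mul1r (inj_eq (mulIf fn)) => /eqP <-.
have hne : h != 0.
  by apply: contraTneq (oner_neq0 k) => e; rewrite -h0 e scoef0 eqxx.
have hV : sfil 0 h^-1.
  have h_ord : sorder h 0 by split; rewrite // h0 oner_neq0.
  by have := sorder_fil (sorderV h_ord); rewrite oppr0.
have th1 : sfil 1 (stheta h).
  move=> m m1; rewrite scoef_theta; have [m0|m0] := ltP m 0.
    by rewrite h_fil// mulr0.
  have -> : m = 0 by lia.
  by rewrite mul0r.
have y1 : sfil 1 (n%:R^-1 * (stheta h / h)).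
  rewrite -sconst_nat.
  have -> : (sconst n%:R)^-1 = sconst n%:R^-1 :> K.
    have nk : n%:R != 0 :> k by apply: natf_neq0.
    rewrite -sconst_nat in nK.
    by apply: (mulfI nK); rewrite divff// -sconstM divff// sconst1.
  by have := sfilM (@sconst_fil _ K n%:R^-1) (sfilM th1 hV); rewrite add0r addr0.
have [e [e_ord e0 he]] := formal_ode char0 y1.
have ene := sorder_neq0 e_ord.
(* Both sides have the same logarithmic derivative and constant term 1. *)
have en : e ^+ n = h.
  have : stheta (e ^+ n / h) = 0.
    rewrite sthetaM (stheta_exp n%:Z ene) sthetaV// he -pmulrn -exprnP.
    have : e ^+ n != 0 by rewrite expf_neq0.
    by move=> en0; field; rewrite nK hne ene.
  move/(stheta_eq0 char0) => E.
  have e_ordn : sorder (e ^+ n) 0.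
    by have := sorder_exprz n%:Z e_ord; rewrite mulr0.
  have en0 : scoef (e ^+ n) 0 = 1.
    elim: (n) => [|m IH]; first by rewrite expr0 -sconst1 scoef_const.
    have em : sorder (e ^+ m) 0.
      by have := sorder_exprz m%:Z e_ord; rewrite mulr0.
    have := scoef_lead (sorder_fil e_ord) (sorder_fil em).
    by rewrite -exprS addr0 e0 IH mulr1.
  have hV0 : scoef h^-1 0 = 1.
    have := scoef_lead h_fil hV; rewrite divff// addr0 h0 mul1r => <-.
    by rewrite -sconst1 scoef_const.
  have := scoef_lead (sorder_fil e_ordn) hV.
  rewrite addr0 en0 hV0 mulr1 => E1; move: E; rewrite E1 sconst1.
  by move/(congr1 (fun z => z * h)); rewrite mul1r divfK.
exists (g0 * e).
  by have := sorder_mul g01 e_ord; rewrite addr0.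
by rewrite exprMn_comm ?en /h 1?mulrC ?divfK ?expf_neq0//; apply: mulrC.
Qed.

(** The series [G] to be inverted has order [-(r + s)], so [-1/G] is the power of exponent [r + s]
    of some [q] of order 1. The equation [G(p) = - Z^(-(r+s))] then holds for the compositional
    inverse [p] of [q]. *)
Lemma stationary_ex (r s : nat) (a : K) : (0 < r)%N -> (0 < s)%N ->
  sorder a (- s%:Z) -> exists2 p : K, sorder p 1 &
  scomp ((r%:R * svar ^+ r.-1)^-1 * (svar^-1 * stheta a)) p + svar ^- (r + s) = 0.
Proof.
move=> r0 s0 [as0 ha]; have rk := natf_neq0 char0 r0.
have th : sorder (stheta a) (- s%:Z).
  split; last exact: stheta_fil.
  by rewrite scoef_theta mulf_neq0// (intf_neq0 char0)//; lia.
have v1 := svar_order K.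
have rX : sorder (r%:R * svar ^+ r.-1 : K) r.-1%:Z.
  have -> : r%:R * svar ^+ r.-1 = sconst r%:R * svar ^ r.-1%:Z :> K.
    by rewrite sconst_nat.
  by split; [rewrite smono_coef eqxx | apply: smono_fil].
set G := _^-1 * _.
have hG : sorder G (- (r + s)%N%:Z).
  have := sorder_mul (sorderV rX) (sorder_mul (sorderV v1) th).
  by congr sorder; lia.
have hGV : sorder (- G)^-1 (r + s)%N%:Z.
  have : sorder (- G) (- (r + s)%N%:Z).
    case: hG => G0 hG; split; first by rewrite scoefN oppr_eq0.
    by move=> n /hG; rewrite scoefN => ->; rewrite oppr0.
  by move/sorderV; rewrite opprK.
have [|q q1 hq] := series_root _ hGV; first by rewrite addn_gt0 r0.
have [p [p1 qp pq]] := scomp_inverse q1; exists p => //.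
have -> : G = - (q ^ (r + s)%N%:Z)^-1 by rewrite -exprnP hq invrK opprK.
rewrite -[- _]sub0r scompB// scomp0// scompV// scomp_exprz// qp.
by rewrite sub0r addNr.
Qed.

End Roots.

(** * The operator [theta + A] *)

Section MatrixPolynomial.
Variables (k : fieldType) (n : nat).
Implicit Types (p q : {poly k}) (B : 'M[k]_n).

(* Unlike [horner_mx], this also covers matrices of size [0]. *)
Definition pev p B : 'M[k]_n := \sum_(j < size p) p`_j *: B ^+ j.

Lemma pev_wide p B (m : nat) : (size p <= m)%N ->
  pev p B = \sum_(j < m) p`_j *: B ^+ j.
Proof.
move=> pm; rewrite /pev -!(big_mkord predT (fun j => p`_j *: B ^+ j)).
rewrite [RHS](big_cat_nat (n := size p))//= [X in _ + X]big_nat_cond.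
rewrite [X in _ + X]big1 ?addr0// => j /andP[/andP[hj _] _].
by rewrite nth_default// scale0r.
Qed.

Lemma pev_lin a p q B : pev (a *: p + q) B = a *: pev p B + pev q B.
Proof.
pose m := maxn (size (a *: p + q)) (maxn (size p) (size q)).
rewrite !(@pev_wide _ _ m) /m; [|lia..].
rewrite scaler_sumr -big_split; apply: eq_bigr => j _.
by rewrite coefD coefZ scalerDl scalerA.
Qed.

Lemma pev0 B : pev 0 B = 0. Proof. by rewrite /pev size_poly0 big_ord0. Qed.

Lemma pevD p q B : pev (p + q) B = pev p B + pev q B.
Proof. by rewrite -[p]scale1r pev_lin !scale1r. Qed.

Lemma pevZ a p B : pev (a *: p) B = a *: pev p B.
Proof. by rewrite -[a *: p]addr0 pev_lin pev0 addr0. Qed.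

Lemma pevB p q B : pev (p - q) B = pev p B - pev q B.
Proof. by rewrite pevD -scaleN1r pevZ scaleN1r. Qed.

Lemma pev_sum (I : Type) (s : seq I) (P : pred I) (F : I -> {poly k}) B :
  pev (\sum_(i <- s | P i) F i) B = \sum_(i <- s | P i) pev (F i) B.
Proof.
by elim/big_rec2: _ => [|i y1 y2 _ <-]; rewrite ?pev0 ?pevD.
Qed.

Lemma pevC a B : pev a%:P B = a%:M.
Proof.
rewrite (@pev_wide _ _ 1) ?size_polyC_leq1// big_ord1 coefC expr0.
by apply/matrixP => i j; rewrite !mxE mulr_natr.
Qed.

Lemma pev_one B : pev 1 B = 1%:M. Proof. by rewrite -polyC1 pevC. Qed.

Lemma pevMX p B : pev (p * 'X) B = B *m pev p B.
Proof.
rewrite (@pev_wide _ _ (size p).+1); last first.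
  by rewrite (leq_trans (size_polyMleq _ _))// size_polyX; lia.
rewrite big_ord_recl coefMX eqxx scale0r add0r mulmx_sumr.
by apply: eq_bigr => j _; rewrite coefMX /= exprS -scalemxAr.
Qed.

Lemma pev_comm p B : B *m pev p B = pev p B *m B.
Proof.
rewrite /pev mulmx_sumr mulmx_suml; apply: eq_bigr => j _.
by rewrite -scalemxAr -scalemxAl; congr (_ *: _); rewrite -[LHS]exprS -[RHS]exprSr.
Qed.

Lemma pevMXaddC p a B : pev (p * ('X + a%:P)) B = (a%:M + B) *m pev p B.
Proof.
rewrite mulrDr pevD pevMX mulrC mul_polyC pevZ mulmxDl mul_scalar_mx.
by rewrite addrC.
Qed.

Lemma pevMXaddCr p a B : pev (p * ('X + a%:P)) B = pev p B *m (a%:M + B).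
Proof. by rewrite pevMXaddC mulmxDl mulmxDr pev_comm scalar_mxC. Qed.

Lemma pev_shift p a B : pev (p \Po ('X + a%:P)) B = pev p (a%:M + B).
Proof.
elim/poly_ind: p => [|p c IH]; first by rewrite comp_poly0 !pev0.
rewrite comp_polyD comp_polyM comp_polyX comp_polyC !pevD !pevC pevMX.
by rewrite pevMXaddC IH.
Qed.

End MatrixPolynomial.

Lemma pev1 (k : fieldType) (p : {poly k}) (a : k) :
  pev p (a%:M : 'M_1) = (p.[a])%:M.
Proof.
elim/poly_ind: p => [|p c IH]; first by rewrite pev0 horner0 raddf0.
rewrite pevD pevMX pevC IH hornerD hornerM hornerX hornerC -scalar_mxM.
by rewrite [a * _]mulrC -raddfD.
Qed.

Section Delta.
Variables (k : fieldType) (K : series_model k) (n : nat) (A : 'M[k]_n).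
Local Notation V := 'rV[K]_n.

Definition mconst (B : 'M[k]_n) : 'M[K]_n := map_mx sconst B.

Definition sdelta (u : V) : V := map_mx (@stheta k K) u + u *m mconst A.

Lemma rcoef_mulmx (u : V) (B : 'M[k]_n) i : rcoef (u *m mconst B) i = rcoef u i *m B.
Proof.
apply/rowP => c; rewrite !mxE scoef_sum; apply: eq_bigr => j _.
by rewrite !mxE mulrC scoef_constM mulrC.
Qed.

Lemma rcoef_theta (u : V) i : rcoef (map_mx (@stheta k K) u) i = i%:~R *: rcoef u i.
Proof. by apply/rowP => c; rewrite !mxE scoef_theta. Qed.

Lemma rcoef_delta (u : V) i :
  rcoef (sdelta u) i = rcoef u i *m (i%:~R%:M + A).
Proof. by rewrite rcoefD rcoef_theta rcoef_mulmx mulmxDr mul_mx_scalar. Qed.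

Lemma sdelta_fil i (u : V) : rfil i u -> rfil i (sdelta u).
Proof. by move=> hu m mi; rewrite rcoef_delta hu// mul0mx. Qed.

Lemma sdeltaB (u v : V) : sdelta (u - v) = sdelta u - sdelta v.
Proof.
by apply: rcoefP => i; rewrite rcoefB !rcoef_delta rcoefB mulmxBl.
Qed.

Lemma sdelta_mono i v :
  sdelta (svar ^ i *: rconst K v) = svar ^ i *: rconst K (v *m (i%:~R%:M + A)).
Proof.
apply: rcoefP => m; rewrite rcoef_delta !rmono_coef.
by case: eqP => [->|_]; rewrite ?mul0mx.
Qed.

Lemma sdelta_leibniz (f : K) (u : V) :
  sdelta (f *: u) = stheta f *: u + f *: sdelta u.
Proof.
rewrite /sdelta scalerDr -scalemxAl addrA; congr (_ + _).
by apply/rowP => c; rewrite !mxE sthetaM.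
Qed.

(** The series [sum_m Z^m (v g_m(i + A))]. Since [theta + A] acts in degree [i] as right
    multiplication by [i + A], its product with [Z^i] is the image of [Z^i v] under
    [sum_m Z^m g_m(theta + A)]. *)
Definition pser (g : nat -> {poly k}) (i : int) (v : 'rV[k]_n) : V :=
  xget 0 [set w : V | forall m, rcoef w m =
    if m < 0 then 0 else v *m pev (g (absz m)) (i%:~R%:M + A)]%classic.

Lemma pser_coef g i v m : rcoef (pser g i v) m =
  if m < 0 then 0 else v *m pev (g (absz m)) (i%:~R%:M + A).
Proof.
rewrite /pser; case: xgetP => // none.
have [|w hw] := @rcoef_mk _ K n (fun m =>
  if m < 0 then 0 else v *m pev (g (absz m)) (i%:~R%:M + A)) 0.
  by move=> m' ->.
by case: (none w).
Qed.

Lemma pser_mono_coef g i v (l : nat) :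
  rcoef (svar ^ i *: pser g i v) (i + l%:Z) = v *m pev (g l) (i%:~R%:M + A).
Proof. by rewrite rvar_exp_coef addrC addKr pser_coef. Qed.

Lemma pser_fil g i v : rfil 0 (pser g i v).
Proof. by move=> m m0; rewrite pser_coef m0. Qed.

Lemma pserB g i v w : pser g i (v - w) = pser g i v - pser g i w.
Proof.
apply: rcoefP => m; rewrite rcoefB !pser_coef.
by case: ifP; rewrite ?subrr// mulmxBl.
Qed.

Lemma pserD g i v w : pser g i (v + w) = pser g i v + pser g i w.
Proof.
apply: rcoefP => m; rewrite rcoefD !pser_coef.
by case: ifP; rewrite ?addr0// mulmxDl.
Qed.

Lemma rcoef_constZ c (u : V) m : rcoef (sconst c *: u) m = c *: rcoef u m.
Proof. by apply/rowP => j; rewrite !mxE scoef_constM. Qed.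

Lemma rconstZ c (v : 'rV[k]_n) : rconst K (c *: v) = sconst c *: rconst K v.
Proof. by apply/rowP => j; rewrite !mxE sconstM. Qed.

Lemma pserZ g i c v : pser g i (c *: v) = sconst c *: pser g i v.
Proof.
apply: rcoefP => m; rewrite pser_coef.
rewrite rcoef_constZ pser_coef; case: ifP => _; first by rewrite scaler0.
by rewrite scalemxAl.
Qed.

End Delta.

Lemma mono_extZ (k : fieldType) (K : series_model k) (n p : nat) (d : int)
    (g : int -> 'rV[k]_n -> 'rV[K]_p) :
    (forall i, {morph g i : x y / x - y}) -> (forall i v, rfil (i + d) (g i v)) ->
    (forall i c v, g i (c *: v) = sconst c *: g i v) ->
  forall c u, mono_ext g (sconst c *: u) = sconst c *: mono_ext g u.
Proof.
move=> gB gf gZ c; apply: (row_ext (d := d)).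
- by move=> u v; rewrite scalerBr (mono_extB gB gf).
- by move=> u v; rewrite (mono_extB gB gf) scalerBr.
- move=> i u hu; apply: (mono_ext_fil gB gf).
  by have := rfilZ (@sconst_fil _ K c) hu; rewrite add0r.
- move=> i u /(mono_ext_fil gB gf) hu.
  by have := rfilZ (@sconst_fil _ K c) hu; rewrite add0r.
move=> i v; rewrite scalerA mulrC -scalerA -rconstZ.
by rewrite !(mono_ext_mono gB gf).
Qed.

(* The substitution [T = p(Z)] on [K^n] with [T d/dT] acting by [theta + A]:    *)
(* it sends [T^i v] to [p^i (p / (p_1 Z))^A v].                                *)
Section Substitution.
Variables (k : fieldType) (char0 : [pchar k] =i pred0) (K : series_model k).
Variables (n : nat) (A : 'M[k]_n) (p : K) (p1 : sorder p 1).
Local Notation V := 'rV[K]_n.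

Let p_neq0 := sorder_neq0 p1.

(** A series of order 1 has a logarithmic derivative with constant term 1. *)
Lemma dlog_fil : sfil 1 (stheta p / p - 1).
Proof.
have hV := sorder_fil (sorderV p1).
have hp : sfil 0 (stheta p / p).
  by have := sfilM (stheta_fil (sorder_fil p1)) hV; rewrite subrr.
move=> m m1; rewrite scoefB -sconst1 scoef_const; case: eqP => [->|m0].
  have := scoef_lead (stheta_fil (sorder_fil p1)) hV.
  rewrite subrr => ->; rewrite scoef_theta mul1r.
  have := scoef_lead (sorder_fil p1) hV; rewrite divff// subrr => <-.
  by rewrite -sconst1 scoef_const subrr.
by rewrite subr0 hp//; lia.
Qed.

Lemma dlog_neq0 : stheta p != 0.
Proof.
apply: contraTneq (oner_neq0 k) => h; have := dlog_fil (m := 0).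
rewrite h mul0r sub0r scoefN -sconst1 scoef_const => /(_ isT)/eqP.
by rewrite oppr_eq0 => /eqP ->; rewrite eqxx.
Qed.

Lemma substitution : exists C : V -> V,
  [/\ {morph C : u v / u - v},
      (forall i u, rfil i u -> rfil i (C u)),
      (forall i u, rfil i u -> rcoef (C u) i = scoef (p ^ i) i *: rcoef u i),
      (forall (f : K) u, C (f *: u) = scomp f p *: C u) &
      (forall u, sdelta A (C u) = (stheta p / p) *: C (sdelta A u))].
Proof.
have [g [g0 hg]] := formal_ode_poly char0
  (fun l => scoef (stheta p / p - 1) (1 + l%:Z)).
(* [G v] is the expansion of [v (p / (p_1 Z))^A]; [GA] is its commutation with [A] and [Gt] its
   derivative. *)
pose G v := pser K A g 0 v.
have Gc v m : rcoef (G v) m = if m < 0 then 0 else v *m pev (g (absz m)) A.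
  rewrite pser_coef; case: ifP => // _; congr (_ *m pev _ _).
  by rewrite -[RHS]add0r; congr (_ + _); rewrite raddf0.
have GA v : G v *m mconst K A = G (v *m A).
  apply: rcoefP => m; rewrite rcoef_mulmx !Gc; case: ifP => _.
    by rewrite mul0mx.
  by rewrite -!mulmxA pev_comm.
have Gt v : map_mx (@stheta k K) (G v) = (stheta p / p - 1) *: G (v *m A).
  apply: rcoefP => m; rewrite rcoef_theta.
  have [m1|m1] := ltP m 1.
    rewrite (rfilZ dlog_fil (@pser_fil _ _ _ A g 0 _)); last by [].
    have [m0|m0] := ltP m 0; first by rewrite Gc m0 scaler0.
    by have -> : m = 0 by [lia]; rewrite scale0r.
  have [l ->] : exists l : nat, m = 1 + 0 + l%:Z by exists (absz (m - 1)%R); lia.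
  rewrite (rcoef_conv _ dlog_fil (@pser_fil _ _ _ A g 0 _)) Gc.
  have -> : 1 + 0 + l%:Z = l.+1%:Z by lia.
  rewrite /= scalemxAr -pevZ -pmulrn hg mulrC pevMX mulmxA pev_sum.
  rewrite mulmx_sumr; apply: eq_bigr => j _; rewrite pevZ -scalemxAr Gc.
  by rewrite ltNge.
have GB : forall i, {morph (fun v => p ^ i *: G v) : x y / x - y}.
  by move=> i x y; rewrite /G pserB scalerBr.
have Gf i v : rfil (i + 0) (p ^ i *: G v).
  apply: rfilZ; last exact: pser_fil.
  exact: sorder_fil (exprz_order1 p1 i).
pose C := mono_ext (fun i v => p ^ i *: G v).
have CB : {morph C : u v / u - v} := mono_extB GB Gf.
have Cf i u : rfil i u -> rfil i (C u).
  by move=> hu; have := mono_ext_fil GB Gf hu; rewrite addr0.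
have Cm i v : C (svar ^ i *: rconst K v) = p ^ i *: G v := mono_ext_mono GB Gf i v.
have Cmul f u : C (f *: u) = scomp f p *: C u.
  have [j hf] := scoef_bounded f.
  have hcf := scomp_fil p1 hf.
  move: u; apply: (row_ext (d := j)).
  - by move=> u v; rewrite scalerBr CB.
  - by move=> u v; rewrite CB scalerBr.
  - by move=> i u hu; apply: Cf; rewrite addrC; apply: rfilZ.
  - by move=> i u hu; rewrite addrC; apply: rfilZ => //; apply: Cf.
  move=> i v; rewrite Cm; move: {hf hcf} f; apply: (series_row_ext (d := i)).
  - by move=> f h; rewrite scalerBl CB.
  - by move=> f h; rewrite scompB// scalerBl.
  - by move=> l f hf; apply: Cf; apply: rfilZ => //; apply: rmono_fil.
  - move=> l f hf; apply: rfilZ; first exact: scomp_fil.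
    by have := Gf i v; rewrite addr0.
  move=> l c; rewrite scalerA -mulrA -expfzDr ?svar_neq0// mulrC -scalerA.
  rewrite -rconstZ Cm scomp_mono// /G pserZ !scalerA expfzDr//.
  by congr (_ *: _); ring.
exists C; split => //.
  move=> i u hu; have hm : i < i + 0 + 1%:Z by lia.
  rewrite /C (mono_ext_coef GB Gf hu hm) big_ord1 !addr0.
  have := rcoef_lead (sorder_fil (exprz_order1 p1 i)) (@pser_fil _ K _ A g 0 (rcoef u i)).
  by rewrite addr0 Gc ltxx /= g0 pevC mul_mx_scalar scale1r.
have hr : sfil 0 (stheta p / p).
  have h01 : (0 : int) <= 1 by [].
  have := filD (sfil_filtration K) (fil_le (sfil_filtration K) h01 dlog_fil)
    (@sconst_fil _ K 1).
  by rewrite sconst1 subrK.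
apply: (row_ext (d := 0)).
- by move=> u v; rewrite CB sdeltaB.
- by move=> u v; rewrite sdeltaB CB scalerBr.
- by move=> i u hu; rewrite addr0; apply: sdelta_fil; apply: Cf.
- move=> i u hu; rewrite addrC; apply: rfilZ => //.
  by apply: Cf; apply: sdelta_fil.
move=> i v; rewrite sdelta_mono !Cm sdelta_leibniz stheta_exp// {1}/sdelta.
rewrite Gt GA mulmxDr mul_mx_scalar.
have -> : G (i%:~R *: v + v *m A) = i%:~R *: G v + G (v *m A).
  by rewrite /G pserD pserZ sconst_int.
move: (G v) (G (v *m A)) => x y.
rewrite -[X in _ + _ *: (_ + X)]scale1r -scalerDl subrK !scalerDr !scalerA.
by congr (_ *: _ + _ *: _); ring.
Qed.

End Substitution.

Lemma scalar_mx_intD (k : fieldType) (n : nat) (i j : int) :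
  (i + j)%:~R%:M = i%:~R%:M + j%:~R%:M :> 'M[k]_n.
Proof. by rewrite -raddfD rmorphD. Qed.

Section Operator.
Variables (k : fieldType) (K : series_model k) (n : nat) (A : 'M[k]_n).
Variable (g : nat -> {poly k}).
Local Notation V := 'rV[K]_n.

(* The operator [\sum_m Z^m g_m(Z d/dZ + A)]. *)
Definition pop : V -> V :=
  locked (mono_ext (fun i v => svar ^ i *: pser K A g i v)).

Let popE : pop = mono_ext (fun i v => svar ^ i *: pser K A g i v).
Proof. by rewrite /pop -lock. Qed.

Let gB i : {morph (fun v => svar ^ i *: pser K A g i v) : v w / v - w}.
Proof. by move=> v w; rewrite pserB scalerBr. Qed.

Let gf i v : rfil (i + 0) (svar ^ i *: pser K A g i v).
Proof. exact: rvar_exp_fil (@pser_fil _ _ _ _ _ _ _). Qed.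

Lemma popB u v : pop (u - v) = pop u - pop v.
Proof. by rewrite popE; exact: mono_extB gB gf u v. Qed.

Lemma pop0 : pop 0 = 0. Proof. by have := popB 0 0; rewrite !subrr. Qed.

Lemma popD u v : pop (u + v) = pop u + pop v.
Proof. by rewrite -[v in LHS]opprK popB -[- v]sub0r popB pop0 sub0r opprK. Qed.

Lemma pop_constZ c u : pop (sconst c *: u) = sconst c *: pop u.
Proof.
rewrite popE; apply: (mono_extZ gB gf) => i d v.
by rewrite pserZ !scalerA [_ * svar ^ i]mulrC.
Qed.

Lemma pop_fil i u : rfil i u -> rfil i (pop u).
Proof. by rewrite popE => /(mono_ext_fil gB gf); rewrite addr0. Qed.

Lemma pop_mono i v : pop (svar ^ i *: rconst K v) = svar ^ i *: pser K A g i v.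
Proof. by rewrite popE; exact: mono_ext_mono gB gf i v. Qed.

Lemma pop_mono_coef i v (l : nat) : rcoef (pop (svar ^ i *: rconst K v)) (i + l%:Z) =
  v *m pev (g l) (i%:~R%:M + A).
Proof. by rewrite pop_mono pser_mono_coef. Qed.

Lemma pop_coef i (j : nat) u : rfil i u -> rcoef (pop u) (i + j%:Z) =
  \sum_(l < j.+1) rcoef u (i + l%:Z) *m pev (g (j - l)%N) ((i + l%:Z)%:~R%:M + A).
Proof.
move=> hu; have hm : i + j%:Z < i + 0 + j.+1%:Z by lia.
rewrite popE (mono_ext_coef gB gf hu hm); apply: eq_bigr => l _.
have -> : i + j%:Z = i + l%:Z + (j - l)%N%:Z by have := ltn_ord l; lia.
by rewrite pser_mono_coef.
Qed.

End Operator.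

(** * The intertwining operator *)

Section Intertwiner.
Variables (k : fieldType) (char0 : [pchar k] =i pred0) (K : series_model k).
Variables (r s : nat) (r_gt0 : (0 < r)%N) (s_gt0 : (0 < s)%N).
Local Notation q := (r + s)%N.
Variables (tau : K) (tau_order : sorder tau r%:Z) (tau_q : scoef tau q%:Z = 0).

(** [kappa * theta] is the derivation [d/dtau]; [b] and [mu] are coefficients of the operator
    [- q * opD * tau], and [b] turns out to be [theta beta]. *)
Let kappa : K := (stheta tau)^-1.
Let b : K := - (q%:R * tau * svar ^ (- q%:Z)).
Let mu : K := q%:R * kappa * tau.

Let theta_tau : sorder (stheta tau) r%:Z.
Proof.
case: tau_order => t0 ht; split; last exact: stheta_fil.
by rewrite scoef_theta mulf_neq0// (intf_neq0 char0)//; lia.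
Qed.

Let kappa_fil : sfil (- r%:Z) kappa.
Proof. exact: sorder_fil (sorderV theta_tau). Qed.

(** This relation makes the constant term of the weight independent of [tau]. *)
Let kappa_lead : scoef kappa (- r%:Z) * (r%:R * scoef tau r%:Z) = 1.
Proof.
have := scoef_lead kappa_fil (sorder_fil theta_tau).
rewrite /kappa mulVf ?(sorder_neq0 theta_tau)// addNr scoef_theta -pmulrn => <-.
by rewrite -sconst1 scoef_const.
Qed.

Let b_coef m : scoef b m = - (q%:R * scoef tau (m + q%:Z)).
Proof.
by rewrite scoefN -mulrA scoef_natM mulrC mulrC [tau * _]mulrC svar_exp_coef opprK.
Qed.

Let b_fil : sfil (- s%:Z) b.
Proof.
by move=> m hm; rewrite b_coef (sorder_fil tau_order) ?mulr0 ?oppr0//; lia.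
Qed.

Let mu_fil : sfil 0 mu.
Proof.
rewrite /mu -mulrA; have := sfilM kappa_fil (sorder_fil tau_order).
rewrite addNr => h; have := sfilM (@sconst_fil _ K q%:R) h.
by rewrite sconst_nat addr0.
Qed.

Section Operators.
Variables (n : nat) (A : 'M[k]_n).
Local Notation V := 'rV[K]_n.

(* [opD] is [- d/dt] and [opTheta] is [q z' d/dz' = q d/dt t], in the coordinate *)
(* [Z] with [t = tau(Z)]; they are related by [opThetaE].                       *)
Definition opD (u : V) : V := svar ^ (- q%:Z) *: u - kappa *: sdelta A u.
Definition opTheta (u : V) : V := b *: u + q%:R *: u + mu *: sdelta A u.

Lemma opDB u v : opD (u - v) = opD u - opD v.
Proof.
rewrite /opD sdeltaB; move: (sdelta A u) (sdelta A v) => x y.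
by apply/rowP => c; rewrite !mxE; ring.
Qed.

(** The Heisenberg relation between [- d/dt] and [t]. *)
Lemma opD_tau u : opD (tau *: u) = tau *: opD u - u.
Proof.
rewrite /opD sdelta_leibniz /kappa; move: (sdelta A u) => x.
by apply/rowP => c; rewrite !mxE; field; apply: sorder_neq0 theta_tau.
Qed.

Lemma opThetaE u : opTheta u = - (q%:R *: opD (tau *: u)).
Proof.
rewrite /opTheta /opD /mu /b sdelta_leibniz /kappa; move: (sdelta A u) => x.
apply/rowP => c; rewrite !mxE; move: (svar ^ _) => z.
by field; apply: sorder_neq0 theta_tau.
Qed.

Lemma opD_fil i u : rfil i u -> rfil (i - q%:Z) (opD u).
Proof.
move=> hu; apply: (filB (rfil_filtration K n)).
  by rewrite addrC; apply: rvar_exp_fil.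
apply: (fil_le (rfil_filtration K n)) (rfilZ kappa_fil (sdelta_fil A hu)).
lia.
Qed.

Lemma opD_lead i u : rfil i u -> rcoef (opD u) (i - q%:Z) = rcoef u i.
Proof.
move=> hu; rewrite rcoefB rvar_exp_coef opprK subrK.
rewrite (rfilZ kappa_fil (sdelta_fil A hu)) ?subr0//; lia.
Qed.

Lemma opTheta_fil i u : rfil i u -> rfil (i - s%:Z) (opTheta u).
Proof.
move=> hu; have hR := rfil_filtration K n.
apply: (filD hR); first apply: (filD hR).
- by rewrite addrC; apply: rfilZ.
- rewrite -sconst_nat; apply: (fil_le hR) (rfilZ (@sconst_fil _ K _) hu); lia.
apply: (fil_le hR) (rfilZ mu_fil (sdelta_fil A hu)); lia.
Qed.

Lemma opThetaB u v : opTheta (u - v) = opTheta u - opTheta v.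
Proof.
rewrite /opTheta sdeltaB; move: (sdelta A u) (sdelta A v) => x y.
by apply/rowP => c; rewrite !mxE; ring.
Qed.

Lemma opD_constZ c u : opD (sconst c *: u) = sconst c *: opD u.
Proof.
rewrite /opD sdelta_leibniz stheta_const; move: (sdelta A u) => x.
by apply/rowP => j; rewrite !mxE; ring.
Qed.

(** A consequence of [opD_tau] and [opThetaE]: [opD] plays the role of [1/z'], which has weight
    [- q] under [q z' d/dz']. *)
Lemma opD_theta u : opD (opTheta u) = opTheta (opD u) + q%:R *: opD u.
Proof.
rewrite !opThetaE -[- _]sub0r opDB; have -> : opD 0 = 0.
  by have := opDB 0 0; rewrite !subrr.
rewrite -sconst_nat opD_constZ (opD_tau u).
rewrite opDB; move: (opD (tau *: opD u)) => x.
by apply/rowP => j; rewrite !mxE; ring.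
Qed.

End Operators.

(** The term of degree [i + m] of [f * (theta + A) * U], for [U = sum_l Z^l u_l(x)], as a polynomial
    in [x]: moving [theta + A] past [Z^l] turns [x] into [x + l]. *)
Definition delta_part (f : K) (u : nat -> {poly k}) (i : int) (m : nat) : {poly k} :=
  \sum_(l < m.+1) scoef f (i + (m - l)%N%:Z) *: (u l * ('X + (l%:R)%:P)).

Lemma delta_part_coef (f : K) (u : nat -> {poly k}) (a : int) (m : nat) n
    (A : 'M[k]_n) i v : sfil a f ->
  rcoef (f *: sdelta A (pop A u (svar ^ i *: rconst K v))) (a + i + m%:Z) =
  v *m pev (delta_part f u a m) (i%:~R%:M + A).
Proof.
move=> hf; have hd : rfil i (sdelta A (pop A u (svar ^ i *: rconst K v))).
  by apply: sdelta_fil; apply: pop_fil; apply: rmono_fil.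
rewrite (rcoef_conv m hf hd) pev_sum mulmx_sumr; apply: eq_bigr => l _.
rewrite rcoef_delta pop_mono_coef pevZ pevMXaddCr -scalemxAr mulmxA.
by rewrite (addrC i) scalar_mx_intD -addrA -pmulrn.
Qed.

Lemma pop_series_coef (f : K) (u : nat -> {poly k}) (a : int) (m : nat) n
    (A : 'M[k]_n) i v : sfil a f ->
  rcoef (f *: pop A u (svar ^ i *: rconst K v)) (a + i + m%:Z) =
  v *m pev (\sum_(l < m.+1) scoef f (a + (m - l)%N%:Z) *: u l) (i%:~R%:M + A).
Proof.
move=> hf; have hd : rfil i (pop A u (svar ^ i *: rconst K v)).
  by apply: pop_fil; apply: rmono_fil.
rewrite (rcoef_conv m hf hd) pev_sum mulmx_sumr; apply: eq_bigr => l _.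
by rewrite pop_mono_coef pevZ -scalemxAr.
Qed.

Let minus_q : - q%:R != 0 :> k.
Proof. by rewrite oppr_eq0 natf_neq0// addn_gt0 r_gt0. Qed.

(* The coefficients of [opD U = U Z^(-q)] for [U = \sum_m Z^m u_m(x)].          *)
Lemma wave_ex : exists u : nat -> {poly k},
  [/\ u 0%N = 1, (forall m, (0 < m < s)%N -> u m = 0) &
  forall m, u m \Po ('X + (- q%:R)%:P) - u m =
    - (if (s <= m)%N then delta_part kappa u (- r%:Z) (m - s) else 0)].
Proof.
have [|u m|u hu] := @strong_recursion {poly k} 0 (fun u m t =>
  if m == 0%N then t = 1 else
  (* Below [s] the equation is homogeneous; the solution 0 is chosen so that the low coefficients of
     the weight can be read off. *)
  if (m < s)%N then t = 0 else
  t \Po ('X + (- q%:R)%:P) - t = - delta_part kappa u (- r%:Z) (m - s)).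
(* The right-hand side involves [u l] for [l <= m - s] only, and [m - s < m] since [s > 0]. *)
- move=> f g m t fg; case: eqP => // m0; case: ltnP => // sm ->; congr (- _).
  apply: eq_bigr => l _; rewrite fg//.
  by apply: leq_trans (ltn_ord l) _; rewrite ltn_subrL s_gt0; lia.
- case: eqP => _; first by exists 1.
  by case: ltnP => _; [exists 0 | apply: difference_surj].
exists u; split=> [|m /andP[m0 ms]|m].
- exact: (hu 0%N).
- by have := hu m; rewrite ms -(prednK m0).
have := hu m; case: eqP => [-> ->|m0].
  by rewrite leqNgt s_gt0 /= -polyC1 comp_polyC subrr oppr0.
case: ltnP => [ms ->|//].
by rewrite comp_poly0 subrr oppr0.
Qed.

Section Wave.
Variable u : nat -> {poly k}.
Hypothesis u0 : u 0%N = 1.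
Hypothesis u_small : forall m, (0 < m < s)%N -> u m = 0.
Hypothesis u_eq : forall m, u m \Po ('X + (- q%:R)%:P) - u m =
    - (if (s <= m)%N then delta_part kappa u (- r%:Z) (m - s) else 0).

(** On [Z^i v] the coefficients of the two sides are [u_j(x)] minus its [delta_part] term and
    [u_j(x - q)], equated by [u_eq]. These are polynomial identities, so they may be evaluated at
    any [i + A]. *)
Lemma opD_pop n (A : 'M[k]_n) x : opD A (pop A u x) = pop A u (svar ^ (- q%:Z) *: x).
Proof.
move: x; apply: (row_ext (d := - q%:Z)).
- by move=> x y; rewrite popB opDB.
- by move=> x y; rewrite scalerBr popB.
- by move=> i x hx; apply: opD_fil; apply: pop_fil.
- by move=> i x hx; apply: pop_fil; rewrite addrC; apply: rvar_exp_fil.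
move=> i v; apply: rcoefP => m; rewrite scalerA -expfzDr ?svar_neq0//.
have [mi|im] := ltP m (- q%:Z + i).
  rewrite (pop_fil A u (@rmono_fil _ K n _ _))//.
  rewrite (@opD_fil _ A i)//; last by lia.
  by apply: pop_fil; apply: rmono_fil.
have [j ->] : exists j : nat, m = - q%:Z + i + j%:Z.
  by exists (absz (m - (- q%:Z + i))%R); lia.
rewrite pop_mono_coef rcoefB rvar_exp_coef.
have -> : - q%:Z + i + j%:Z - - q%:Z = i + j%:Z by lia.
rewrite pop_mono_coef.
have e : u j \Po ('X + (- q%:R)%:P) = u j -
    (if (s <= j)%N then delta_part kappa u (- r%:Z) (j - s) else 0).
  by move/eqP: (u_eq j); rewrite subr_eq => /eqP ->; rewrite [LHS]addrC.
have -> : pev (u j) ((- q%:Z + i)%:~R%:M + A) =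
    pev (u j \Po ('X + (- q%:R)%:P)) (i%:~R%:M + A).
  by rewrite pev_shift addrA scalar_mx_intD rmorphN /= -pmulrn.
rewrite e pevB mulmxBr; congr (_ - _); case: leqP => sj.
  rewrite -delta_part_coef//; congr rcoef; lia.
rewrite pev0 mulmx0.
have hd : rfil i (sdelta A (pop A u (svar ^ i *: rconst K v))).
  by apply: sdelta_fil; apply: pop_fil; apply: rmono_fil.
apply: (rfilZ kappa_fil hd); lia.
Qed.

(* The coefficient of degree [j - s] of [opTheta U - U (x + w)], where [w] has  *)
(* the coefficients [w l] in the degrees [l - s], [l < j].                      *)
Definition wave_error (w : nat -> k) (j : nat) : {poly k} :=
  \sum_(l < j.+1) scoef b (- s%:Z + (j - l)%N%:Z) *: u l
  + (if (s <= j)%N then q%:R *: u (j - s)%N + delta_part mu u 0 (j - s)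
       - u (j - s)%N * 'X else 0)
  - \sum_(l < j) w l *: (u (j - l)%N \Po ('X + ((l%:Z - s%:Z)%:~R)%:P)).

(** Since [u 0 = 1], the coefficient of [f] in degree [j - s] enters only as the subtracted
    constant, and those of higher degree do not enter at all. *)
Lemma wave_error_coef n (A : 'M[k]_n) (f : K) i v (j : nat) : sfil (- s%:Z) f ->
  rcoef (opTheta A (pop A u (svar ^ i *: rconst K v)) -
         pop A u (sdelta A (svar ^ i *: rconst K v) +
                  f *: (svar ^ i *: rconst K v))) (- s%:Z + i + j%:Z) =
  v *m pev (wave_error (fun l => scoef f (- s%:Z + l%:Z)) j
            - (scoef f (- s%:Z + j%:Z))%:P) (i%:~R%:M + A).
Proof.
move=> hf; have hU : rfil i (pop A u (svar ^ i *: rconst K v)).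
  by apply: pop_fil; apply: rmono_fil.
rewrite rcoefB popD /opTheta !rcoefD pop_series_coef//.
have hfu : rfil (- s%:Z + i) (f *: (svar ^ i *: rconst K v)).
  by apply: rfilZ => //; apply: rmono_fil.
rewrite (@pop_coef _ K n A u (- s%:Z + i) j _ hfu).
have -> : \sum_(l < j.+1) rcoef (f *: (svar ^ i *: rconst K v)) (- s%:Z + i + l%:Z)
    *m pev (u (j - l)%N) ((- s%:Z + i + l%:Z)%:~R%:M + A) =
  v *m pev (\sum_(l < j) scoef f (- s%:Z + l%:Z) *:
     (u (j - l)%N \Po ('X + ((l%:Z - s%:Z)%:~R)%:P)) + (scoef f (- s%:Z + j%:Z))%:P)
     (i%:~R%:M + A).
  have e (l : nat) : rcoef (f *: (svar ^ i *: rconst K v)) (- s%:Z + i + l%:Z) =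
      scoef f (- s%:Z + l%:Z) *: v.
    apply/rowP => c; rewrite !mxE mulrC mulrAC mulrC mulrC -!mulrA svar_exp_coef.
    rewrite mulrC scoef_constM mulrC; congr (scoef f _ * _); lia.
  rewrite big_ord_recr pevD mulmxDr /= e subnn u0 pev_one mulmx1.
  rewrite pevC mul_mx_scalar pev_sum mulmx_sumr; congr (_ + _).
  apply: eq_bigr => l _; rewrite e pevZ -scalemxAr -scalemxAl pev_shift.
    congr (_ *: (_ *m pev _ _)); rewrite addrA -scalar_mx_intD; congr (_%:~R%:M + _).
    lia.
have hp : sdelta A (svar ^ i *: rconst K v) =
    svar ^ i *: rconst K (v *m (i%:~R%:M + A)) by rewrite sdelta_mono.
have e2 : rcoef (q%:R *: pop A u (svar ^ i *: rconst K v)) (- s%:Z + i + j%:Z) +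
  rcoef (mu *: sdelta A (pop A u (svar ^ i *: rconst K v))) (- s%:Z + i + j%:Z) -
  rcoef (pop A u (sdelta A (svar ^ i *: rconst K v))) (- s%:Z + i + j%:Z) =
  v *m pev (if (s <= j)%N then q%:R *: u (j - s)%N + delta_part mu u 0 (j - s)
       - u (j - s)%N * 'X else 0) (i%:~R%:M + A).
  case: leqP => sj; last first.
    rewrite -sconst_nat hp (rfilZ (@sconst_fil _ K _) hU); last by lia.
    rewrite (rfilZ mu_fil (sdelta_fil A hU)); last by lia.
    rewrite (pop_fil A u (@rmono_fil _ K n _ _)); last by lia.
    by rewrite pev0 mulmx0 subr0 addr0.
  have -> : - s%:Z + i + j%:Z = 0 + i + (j - s)%N%:Z by lia.
  rewrite delta_part_coef// -sconst_nat hp add0r rcoef_constZ !pop_mono_coef.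
  rewrite pevB pevD pevZ pevMX mulmxBr mulmxA; congr (_ - _).
  by rewrite [RHS]mulmxDr -scalemxAr.
rewrite /wave_error !pevB !pevD !mulmxBr !mulmxDr -e2.
move: (rcoef _ _) (rcoef _ _) (rcoef _ _) (_ *m _) (_ *m _) (_ *m _) => x1 x2 x3 x4 x5 x6.
by apply/rowP => c; rewrite !mxE; ring.
Qed.

Lemma wave_error_eq w w' j : (forall l, (l < j)%N -> w l = w' l) ->
  wave_error w j = wave_error w' j.
Proof. by move=> e; congr (_ - _); apply: eq_bigr => l _; rewrite e. Qed.

(* [E = opTheta U - U (x + w)] satisfies [opD E = E Z^(-q)], so its leading      *)
(* coefficient, a polynomial in [x], is invariant under [x |-> x - q].          *)
Lemma wave_error_const (w : nat -> k) (j : nat) :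
  (forall l, (l < j)%N -> wave_error w l = (w l)%:P) ->
  exists c, wave_error w j = c%:P.
Proof.
(* [w] is cut off at [j], so that [E] vanishes below degree [j - s] and the polynomial in question
   is its leading coefficient. *)
move=> hw; pose c (m : int) := if m < - s%:Z then 0 else
  if (absz (m + s%:Z)%R < j)%N then w (absz (m + s%:Z)%R) else 0.
have [|f hf] := @scoef_mk _ K c (- s%:Z); first by move=> m ms; rewrite /c ms.
have ff : sfil (- s%:Z) f by move=> m ms; rewrite hf /c ms.
have fw (l : nat) : scoef f (- s%:Z + l%:Z) = if (l < j)%N then w l else 0.
  rewrite hf /c ifF; last by lia.
  by have -> : absz (- s%:Z + l%:Z + s%:Z)%R = l by lia.
pose w' l := scoef f (- s%:Z + l%:Z).
pose E (x : 'rV[K]_1) := opTheta 0 (pop 0 u x) - pop 0 u (sdelta 0 x + f *: x).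
have DE x : opD 0 (E x) = E (svar ^ (- q%:Z) *: x).
  rewrite /E opDB opD_theta !opD_pop scalerDr sdelta_leibniz stheta_var.
  rewrite rmorphN /= -pmulrn !popD.
  have -> : pop 0 u ((- q%:R * svar ^ (- q%:Z)) *: x) =
      - (q%:R *: pop 0 u (svar ^ (- q%:Z) *: x)).
    rewrite mulNr scaleNr -scalerA -sconst_nat -[- (_ *: _) in LHS]sub0r.
    by rewrite popB pop0 pop_constZ sub0r.
  rewrite !scalerA [f * _]mulrC.
  move: (opTheta 0 (pop 0 u (svar ^ (- q%:Z) *: x))) => x1.
  move: (pop 0 u _) (pop 0 u _) (pop 0 u _) => x2 x3 x4.
  by apply/rowP => i; rewrite !mxE; ring.
pose v : 'rV[k]_1 := 1%:M.
have Ec i l : rcoef (E (svar ^ i *: rconst K v)) (- s%:Z + i + l%:Z) =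
    v *m pev (wave_error w' l - (w' l)%:P) (i%:~R%:M + 0).
  exact: wave_error_coef.
have w'e l : (l <= j)%N -> wave_error w' l = wave_error w l.
  by move=> lj; apply: wave_error_eq => m ml; rewrite /w' fw (leq_trans ml lj).
have Ef i : rfil (- s%:Z + i + j%:Z) (E (svar ^ i *: rconst K v)).
  move=> m mj; have [mi|im] := ltP m (- s%:Z + i).
    suff h : rfil (- s%:Z + i) (E (svar ^ i *: rconst K v)) by apply: h.
    have hx := @rmono_fil _ K 1 i v; have hF := rfil_filtration K 1.
    apply: (filB hF).
      by rewrite addrC; apply: opTheta_fil; apply: pop_fil.
    apply: pop_fil; apply: (filD hF); last exact: rfilZ.
    by apply: (fil_le hF) (sdelta_fil 0 hx); lia.
  have [l e] : exists l : nat, m = - s%:Z + i + l%:Z.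
    by exists (absz (m - (- s%:Z + i))%R); lia.
  have lj : (l < j)%N by lia.
  by rewrite e Ec w'e 1?ltnW// hw// /w' fw lj subrr pev0 mulmx0.
pose e := wave_error w j.
have Ee i : rcoef (E (svar ^ i *: rconst K v)) (- s%:Z + i + j%:Z) = (e.[i%:~R])%:M.
  by rewrite Ec w'e// /w' fw ltnn subr0 addr0 pev1 mul1mx.
(* Rank one with [A = 0] suffices: there [x] is the integer [i], and the points [- m * q] determine
   a polynomial. *)
apply: (periodic_const char0 minus_q) => m; apply/eqP; rewrite -subr_eq0.
pose i : int := - (m%:Z * q%:Z).
have := opD_lead 0 (@Ef i); rewrite DE scalerA -expfzDr ?svar_neq0//.
have -> : - s%:Z + i + j%:Z - q%:Z = - s%:Z + (- q%:Z + i) + j%:Z by lia.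
rewrite !Ee => /matrixP/(_ 0 0); rewrite !mxE /= => h.
have -> : m%:R * - q%:R = i%:~R :> k.
  by rewrite /i rmorphN rmorphM /= -!pmulrn mulrN.
have -> : i%:~R - q%:R = (- q%:Z + i)%:~R :> k.
  by rewrite intrD mulrNz -pmulrn addrC.
by move: h; rewrite !mulr1n => h; rewrite -/e h subrr.
Qed.

(** Each coefficient of [w] is the constant supplied by [wave_error_const]. The errors are
    polynomials in [x] that do not involve [A], so one series [w] serves all ranks and matrices. *)
Lemma wave_ex_weight : exists w : K, [/\ sfil (- s%:Z) w,
  (forall j, wave_error (fun l => scoef w (- s%:Z + l%:Z)) j =
     (scoef w (- s%:Z + j%:Z))%:P) &
  forall n (A : 'M[k]_n) x,
    opTheta A (pop A u x) = pop A u (sdelta A x + w *: x)].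
Proof.
have [|w j|w hw] := @strong_recursion k 0 (fun w j t =>
  (forall l, (l < j)%N -> wave_error w l = (w l)%:P) -> wave_error w j = t%:P).
- move=> w w' j t ww' h h'; rewrite -(wave_error_eq ww'); apply: h => l lj.
  rewrite ww'// -h'//; apply: wave_error_eq => m ml; apply: ww'.
  exact: ltn_trans ml lj.
- have [h|h] := pselect (forall l, (l < j)%N -> wave_error w l = (w l)%:P).
    by have [c hc] := wave_error_const h; exists c.
  by exists 0 => /h.
(* The recursive relation was conditional on the vanishing of the earlier errors; induction
   discharges the condition. *)
have {}hw j : wave_error w j = (w j)%:P.
  by elim/ltn_ind: j => j IH; apply: hw.
have [|f hf] := @scoef_mk _ K (fun m => if m < - s%:Z then 0 else
  w (absz (m + s%:Z)%R)) (- s%:Z); first by move=> m ->.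
have ff : sfil (- s%:Z) f by move=> m ms; rewrite hf ms.
have fw (l : nat) : scoef f (- s%:Z + l%:Z) = w l.
  rewrite hf ifF; last by lia.
  by congr w; lia.
have hf' j : wave_error (fun l => scoef f (- s%:Z + l%:Z)) j =
     (scoef f (- s%:Z + j%:Z))%:P.
  by rewrite fw -hw; apply: wave_error_eq => l _; rewrite fw.
exists f; split => // n A; have hF := rfil_filtration K n.
apply: (row_ext (d := - s%:Z)).
- by move=> x y; rewrite popB opThetaB.
- by move=> x y; rewrite sdeltaB scalerBr addrACA -opprD popB.
- by move=> i x hx; apply: opTheta_fil; apply: pop_fil.
- move=> i x hx; apply: pop_fil; apply: (filD hF).
    by apply: (fil_le hF) (sdelta_fil A hx); lia.
  by rewrite addrC; apply: rfilZ.
move=> i v; apply/eqP; rewrite -subr_eq0; apply/eqP.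
apply: rcoefP => m; rewrite rcoef0.
have hx := @rmono_fil _ K n i v.
have [mi|im] := ltP m (- s%:Z + i).
  suff h : rfil (- s%:Z + i) (opTheta A (pop A u (svar ^ i *: rconst K v)) -
    pop A u (sdelta A (svar ^ i *: rconst K v) + f *: (svar ^ i *: rconst K v))).
    exact: h.
  apply: (filB hF).
    by rewrite addrC; apply: opTheta_fil; apply: pop_fil.
  apply: pop_fil; apply: (filD hF); last exact: rfilZ.
  by apply: (fil_le hF) (sdelta_fil A hx); lia.
have [l ->] : exists l : nat, m = - s%:Z + i + l%:Z.
  by exists (absz (m - (- s%:Z + i))%R); lia.
by rewrite wave_error_coef// hf' subrr pev0 mulmx0.
Qed.

(* [u s] is quadratic, with [u_s(x - q) - u_s(x) = - kappa_(-r) x]; the term    *)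
(* [s / 2] comes from [u_s(0) - u_s(- s)].                                       *)
Lemma wave_weight_low (w : K) :
    (forall j, wave_error (fun l => scoef w (- s%:Z + l%:Z)) j =
      (scoef w (- s%:Z + j%:Z))%:P) -> sfil (- s%:Z) w ->
  (forall m, m < 0 -> scoef w m = scoef b m) /\
  scoef w 0 = r%:R + s%:R / 2.
Proof.
move=> hw wf.
have head j : (j <= s)%N ->
    \sum_(l < j.+1) scoef b (- s%:Z + (j - l)%N%:Z) *: u l =
    (scoef b (- s%:Z + j%:Z))%:P +
    (if (j == s)%N then scoef b (- s%:Z) *: u s else 0).
  move=> js; pose F l := scoef b (- s%:Z + (j - l)%N%:Z) *: u l.
  rewrite -(big_mkord predT F) big_ltn// /F subn0 u0 alg_polyC; congr (_ + _).
  case: eqP js => [->|/eqP jns] js.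
    rewrite big_nat_recr//= subnn addr0 big_nat_cond big1 ?add0r//.
    by move=> l /andP[/andP[l1 ls] _]; rewrite u_small ?scaler0// l1.
  rewrite big_nat_cond big1// => l /andP[/andP[l1 ls] _].
  by rewrite u_small ?scaler0//; lia.
have low j : (j < s)%N -> scoef w (- s%:Z + j%:Z) = scoef b (- s%:Z + j%:Z).
  move=> js; apply: polyC_inj; rewrite -hw /wave_error (head _ (ltnW js)).
  rewrite (ltn_eqF js) leqNgt js !addr0 big1 ?subr0// => l _; rewrite u_small ?comp_poly0 ?scaler0//.
  by have := ltn_ord l; lia.
split=> [m m0|].
  have [ms|sm] := ltP m (- s%:Z); first by rewrite wf// b_fil.
  have -> : m = - s%:Z + (absz (m + s%:Z)%R)%:Z by lia.
  by apply: low; lia.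
have us m : (u s).[m + - q%:R] = (u s).[m] - scoef kappa (- r%:Z) * m.
  have := congr1 (fun p => p.[m]) (u_eq s).
  rewrite leqnn subnn /delta_part big_ord1 u0 mul1r addr0 !hornerE horner_comp.
  rewrite !hornerE => /eqP; rewrite subr_eq => /eqP ->.
  by rewrite addrC.
have q0 : q%:R != 0 :> k by rewrite -oppr_eq0.
have two0 : 2%:R != 0 :> k by apply: natf_neq0.
(* [a x^2 + a q x] changes by [- 2 a q x] under [x |-> x - q]; [a] is chosen so that this is
   [- kappa_(-r) x]. *)
pose a := scoef kappa (- r%:Z) / (2%:R * q%:R).
have [|c hc] := periodic_const char0 minus_q (u := u s - a *: 'X^2 - (a * q%:R) *: 'X).
  move=> m; rewrite !(hornerD, hornerN, hornerZ, hornerXn, hornerX) us /a.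
  move: (m%:R * _) => x.
  by move: (q%:R) q0 => y y0; field; rewrite y0 two0.
have us0 : (u s).[0] - (u s).[- s%:R] = a * s%:R * r%:R.
  have e x : (u s).[x] = c + a * x ^+ 2 + a * q%:R * x.
    have := congr1 (fun p => p.[x]) hc.
    by rewrite !(hornerD, hornerN, hornerZ, hornerXn, hornerX, hornerC) => <-; ring.
  by rewrite !e natrD; ring.
(* The equation of degree 0 is evaluated at [x = 0], where the terms with a factor [x] drop out. *)
have := congr1 (fun p => p.[0]) (hw s); rewrite /wave_error head// eqxx leqnn subnn.
rewrite addNr /delta_part big_ord1 u0 mul1r addr0.
pose F l := scoef w (- s%:Z + l%:Z) *:
  (u (s - l)%N \Po ('X + ((l%:Z - s%:Z)%:~R)%:P)).
have F0 : \sum_(1 <= l < s) F l = 0.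
  rewrite big_nat_cond big1// => l /andP[/andP[l1 ls] _].
  by rewrite /F u_small ?comp_poly0 ?scaler0//; lia.
rewrite -(big_mkord predT F) big_ltn// F0 addr0 /F.
rewrite subn0 (low 0%N s_gt0) addr0 -polyC1.
rewrite !(hornerD, hornerN, hornerZ, hornerM, hornerX, hornerC, horner_comp).
rewrite !add0r !mulr0 subr0 !addr0 mulr1 mulrNz -pmulrn => <-.
have -> : scoef b 0 = 0 by rewrite b_coef add0r tau_q mulr0 oppr0.
have -> : scoef b (- s%:Z) = - (q%:R * scoef tau r%:Z).
  by rewrite b_coef; congr (- (_ * scoef tau _)); lia.
transitivity (q%:R - q%:R * scoef tau r%:Z * ((u s).[0] - (u s).[- s%:R])).
  by move: (q%:R) (scoef tau _) => y z; ring.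
rewrite us0 /a.
transitivity (q%:R - s%:R * (scoef kappa (- r%:Z) * (r%:R * scoef tau r%:Z)) / 2%:R).
  by move: (q%:R) q0 => y y0; field; rewrite y0 two0.
by rewrite kappa_lead natrD; field.
Qed.

End Wave.

(** [Phi] is [U] composed with a gauge factor [h = Z^(-r) g] whose logarithmic derivative is
    [b + s/2 - w]. Such an [h] exists because [w] and [b] agree in negative degrees, [b] has no
    constant term, and that of [w] differs from [s/2] by the integer [r], absorbed by [Z^(-r)]. *)
Lemma phase_operator n (A : 'M[k]_n) : exists Phi : 'rV[K]_n -> 'rV[K]_n,
  [/\ bijective Phi /\ {morph Phi : x y / x - y},
      (forall i x, rfil i x <-> rfil (i - r%:Z) (Phi x)),
      (forall c x, Phi (sconst c *: x) = sconst c *: Phi x),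
      (forall x, opD A (Phi x) = Phi (svar ^ (- q%:Z) *: x)) &
      (forall x, opTheta A (Phi x) = Phi (sdelta A x + (b + s%:R / 2) *: x))].
Proof.
have [u [u0 u_small u_eq]] := wave_ex.
have [w [wf hw wE]] := wave_ex_weight u0 u_eq.
have [wlow w0] := wave_weight_low u0 u_small u_eq hw wf.
have two0 : 2%:R != 0 :> k by apply: natf_neq0.
have e2 : sconst (r%:R + s%:R / 2) = r%:R + s%:R / 2 :> K.
  have h2 : 2%:R * sconst 2^-1 = 1 :> K.
    by rewrite -sconst_nat -sconstM divff// sconst1.
  have h2' : 2%:R != 0 :> K.
    by apply: contraTneq (oner_neq0 K) => h; rewrite -h2 h mul0r eqxx.
  rewrite sconstD sconstM !sconst_nat; congr (_ + _ * _).
  by apply: (mulfI h2'); rewrite divff.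
pose y := r%:R + s%:R / 2 + b - w.
have yf : sfil 1 y.
  move=> m m1; rewrite /y -e2 scoefB scoefD scoef_const.
  case: eqP => [->|m0]; first by rewrite w0 b_coef add0r tau_q mulr0 oppr0 addr0 subrr.
  by rewrite wlow ?add0r ?subrr//; lia.
have [g [g_ord g0 hg]] := formal_ode char0 yf.
pose h := svar ^ (- r%:Z) * g.
have h_ord : sorder h (- r%:Z).
  have := sorder_mul (sorder_exprz (- r%:Z) (svar_order K)) g_ord.
  by rewrite mulr1 addr0.
have hh : stheta h = (b + s%:R / 2 - w) * h.
  rewrite sthetaM stheta_var hg /h /y rmorphN /= -pmulrn.
  by move: (svar ^ _) => z; ring.
pose Phi x := pop A u (h *: x).
have PhiB : {morph Phi : x y / x - y}.
  by move=> x z; rewrite /Phi scalerBr popB.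
have Phif i x : rfil i x -> rfil (i + - r%:Z) (Phi x).
  move=> hx; apply: pop_fil; rewrite addrC; apply: rfilZ => //.
  exact: sorder_fil h_ord.
have Phil i x : rfil i x -> rcoef (Phi x) (i + - r%:Z) =
    (fun=> scoef h (- r%:Z)) i *: rcoef x i.
  move=> hx; have hhx := rfilZ (sorder_fil h_ord) hx.
  have := pop_coef A u 0 hhx; rewrite big_ord1 addr0 subnn u0 pev_one mulmx1.
  by rewrite (rcoef_lead (sorder_fil h_ord) hx) [i + _]addrC.
have [Phib Phis] := row_lead_bij PhiB Phif Phil (fun=> h_ord.1).
exists Phi; split => //.
- by move=> i x; split; [apply: Phif | apply: Phis].
- by move=> c x; rewrite /Phi scalerA mulrC -scalerA pop_constZ.
- by move=> x; rewrite /Phi (opD_pop u_eq) !scalerA mulrC.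
move=> x; rewrite /Phi wE; congr (pop A u _).
rewrite sdelta_leibniz hh; move: (sdelta A x) => z.
by apply/rowP => j; rewrite !mxE; ring.
Qed.

End Intertwiner.

(** * Stationary phase: from [alpha] to its Legendre transform [beta] *)

Section StationaryPhase.
Variables (k : fieldType) (char0 : [pchar k] =i pred0) (K : series_model k).
Variables (r s : nat) (r_gt0 : (0 < r)%N) (s_gt0 : (0 < s)%N).
Local Notation q := (r + s)%N.
Variables (alpha phi beta : K).
Hypothesis phi_order : sorder phi 1.
Hypothesis phi_stationary :
  scomp ((r%:R * svar ^+ r.-1)^-1 * (svar^-1 * stheta alpha)) phi +
  svar ^- q = 0.
Hypothesis betaE : scomp alpha phi + phi ^+ r * svar ^- q = beta.

Let tau := phi ^+ r.
Let rho := stheta phi / phi.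

Let phi_neq0 := sorder_neq0 phi_order.

Let natK_neq0 (m : nat) : (0 < m)%N -> m%:R != 0 :> K.
Proof.
move=> m0; rewrite -sconst_nat; apply/eqP => /(congr1 (fun f => scoef f 0)).
by rewrite scoef_const scoef0 /= => /eqP; apply/negP/natf_neq0.
Qed.

Let tau_order : sorder tau r%:Z.
Proof. by have := exprz_order1 phi_order r%:Z. Qed.

Let theta_tau : stheta tau = r%:R * tau * rho.
Proof. by have := stheta_exp r%:Z phi_neq0; rewrite -pmulrn. Qed.

(** The stationarity equation rewritten with [theta], since [d/dt] is [theta] divided by [r T^r]. *)
Let theta_alpha : scomp (stheta alpha) phi = - (r%:R * tau * svar ^- q).
Proof.
move/eqP: phi_stationary; rewrite addr_eq0 => /eqP.
rewrite !scompM// scompV// scompM// -sconst_nat scomp_const// sconst_nat.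
rewrite scompV// scomp_var//.
have -> : scomp (svar ^+ r.-1) phi = phi ^+ r.-1 := scomp_var_exp phi_order r.-1%:Z.
have -> : tau = phi * phi ^+ r.-1 by rewrite /tau -exprS prednK.
move: (svar ^- _) => z.
have pr : phi ^+ r.-1 != 0 by rewrite expf_neq0.
move: (phi ^+ r.-1) pr (natK_neq0 r_gt0) => y y0 r0 e.
rewrite -[LHS]mul1r -(divff (mulf_neq0 (mulf_neq0 r0 phi_neq0) y0)) -[in RHS]mulrN -e.
by field; rewrite r0 y0 phi_neq0.
Qed.

(** By stationarity the contributions of the variation of [phi] cancel, and only the explicit factor
    [Z^(-q)] gets differentiated. *)
Lemma theta_beta : stheta beta = - (q%:R * tau * svar ^ (- q%:Z)).
Proof.
rewrite -betaE sthetaD stheta_scomp// theta_alpha sthetaM -/tau theta_tau -/rho.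
have -> : svar ^- q = svar ^ (- q%:Z) :> K by rewrite -exprnN.
rewrite stheta_var rmorphN /= -pmulrn; move: (svar ^ _) (q%:R) => z y.
by ring.
Qed.

(** The coefficient in question is, up to the factor [- q], the constant term of [theta beta], which
    is 0. *)
Let tau_q : scoef tau q%:Z = 0.
Proof.
have := congr1 (fun f => scoef f 0) theta_beta.
rewrite scoef_theta mul0r scoefN -mulrA scoef_natM mulrC mulrC [tau * _]mulrC.
rewrite svar_exp_coef sub0r opprK => /esym/eqP; rewrite oppr_eq0 mulf_eq0.
by rewrite (negPf (natf_neq0 char0 _)) ?addn_gt0 ?r_gt0// => /eqP.
Qed.

Lemma beta_order : sorder beta (- s%:Z).
Proof.
have e m : m%:~R * scoef beta m = - (q%:R * scoef tau (m + q%:Z)).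
  rewrite -scoef_theta theta_beta scoefN -mulrA scoef_natM [tau * _]mulrC.
  by rewrite svar_exp_coef opprK.
have [t0 tf] := tau_order.
split=> [|m ms].
  apply/eqP => h; have := e (- s%:Z); rewrite h mulr0 => /esym/eqP.
  have -> : - s%:Z + q%:Z = r%:Z by lia.
  by rewrite oppr_eq0 mulf_eq0 (negPf t0) orbF; apply/negP/natf_neq0;
    rewrite ?addn_gt0 ?r_gt0.
have := e m; rewrite tf ?mulr0 ?oppr0; last by lia.
by move/eqP; rewrite mulf_eq0 (negPf (intf_neq0 char0 _))/=; [move/eqP|lia].
Qed.

(** [iota] is the substitution [C] followed by the inverse of [Phi]. [C] carries [- d/dt] to [opD],
    and [Phi] carries [Z^(-q)] to [opD] and the derivation of the right-hand side to [opTheta];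
    multiplication by [t] is then recovered from [opThetaE]. *)
Lemma stationary_phase n (A : 'M[k]_n) : exists iota : 'rV[K]_n -> 'rV[K]_n,
  [/\ bijective iota /\
        (forall c u v, iota (sconst c *: u + v) = sconst c *: iota u + iota v),
      (forall i u, rfil i u <-> rfil (i + r%:Z) (iota u)),
      (forall u, iota (svar ^+ r *: u) = - ((q%:R^-1 * svar ^+ q) *:
         (sdelta A (iota u) + (stheta beta + s%:R / 2) *: iota u))) &
      (forall u, iota ((r%:R^-1 * svar ^- r) *: (sdelta A u + stheta alpha *: u)) =
         - (svar ^- q *: iota u))].
Proof.
have [C [CB Cf Cl CM Cd]] := substitution char0 A phi_order.
have Cz c u : C (sconst c *: u) = sconst c *: C u by rewrite CM scomp_const.
have [|||Cbij Cs] := @row_lead_bij _ K n 0 C (fun i => scoef (phi ^ i) i) CB.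
- by move=> i u; rewrite addr0; apply: Cf.
- by move=> i u; rewrite addr0; apply: Cl.
- by move=> i; case: (exprz_order1 phi_order i).
have [Phi [[Phib PhiB] Phif Phiz PhiD PhiT]] :=
  phase_operator char0 r_gt0 s_gt0 tau_order tau_q A.
have [Psi PhiK PsiK] := Phib.
have PsiB u v : Psi (u - v) = Psi u - Psi v.
  by apply: (can_inj PhiK); rewrite PhiB !PsiK.
have PsiZ c u : Psi (sconst c *: u) = sconst c *: Psi u.
  by apply: (can_inj PhiK); rewrite Phiz !PsiK.
have [||||Dbij _] := @row_lead_bij _ K n (- q%:Z) (opD r s tau A) (fun=> 1).
- by move=> u v; apply: opDB.
- by move=> i u; apply: opD_fil.
- by move=> i u hu; rewrite scale1r; apply: opD_lead.
- by move=> i; apply: oner_neq0.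
have qK : q%:R != 0 :> K by apply: natK_neq0; rewrite addn_gt0 r_gt0.
have rK : r%:R != 0 :> K by apply: natK_neq0.
have vK := svar_neq0 K.
have bE : - (q%:R * tau * svar ^ (- q%:Z)) = stheta beta by rewrite theta_beta.
have Psi0 : Psi 0 = 0 by have := PsiB 0 0; rewrite !subrr.
have PsiN u : Psi (- u) = - Psi u by rewrite -sub0r PsiB Psi0 sub0r.
have rhoK : stheta phi != 0 := dlog_neq0 phi_order.
exists (fun u => Psi (C u)); split.
- split.
    by apply: bij_comp => //; exists Phi.
  move=> c u v; rewrite -[v in LHS]opprK CB PsiB -[- v]sub0r CB.
  have -> : C 0 = 0 by have := CB 0 0; rewrite !subrr.
  by rewrite sub0r PsiN opprK Cz PsiZ.
- move=> i u; have hC : rfil i u <-> rfil i (C u).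
    by split=> [h|h]; [exact: Cf h | apply: (Cs i u); rewrite addr0].
  have := Phif (i + r%:Z) (Psi (C u)); rewrite PsiK addrK => hP.
  by rewrite hC hP.
- move=> u; set x := Psi (C u).
  have Cx : C u = Phi x by rewrite PsiK.
  apply: (can_inj PhiK); rewrite PsiK CM.
  have -> : scomp (svar ^+ r) phi = tau := scomp_var_exp phi_order r%:Z.
  (* [opD] is injective, so the formula may be checked after applying it, where [opTheta]
     appears. *)
  rewrite Cx; apply: (bij_inj Dbij); rewrite PhiD.
  set y := sdelta A x + _.
  have -> : svar ^ (- q%:Z) *: - ((q%:R^-1 * svar ^+ q) *: y) =
      sconst (- q%:R^-1) *: y.
    rewrite scalerN scalerA sconstN scaleNr; congr (- (_ *: _)).
    have -> : sconst q%:R^-1 = q%:R^-1 :> K.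
      apply: (mulfI qK); rewrite divff// -sconst_nat -sconstM divff ?sconst1//.
      by rewrite natf_neq0// addn_gt0 r_gt0.
    by rewrite mulrCA -exprnN mulVf ?mulr1// expf_neq0.
  rewrite Phiz /y -bE -PhiT opThetaE//.
  have -> : sconst (- q%:R^-1) = - q%:R^-1 :> K.
    rewrite sconstN; congr (- _).
    apply: (mulfI qK); rewrite divff// -sconst_nat -sconstM divff ?sconst1//.
    by rewrite natf_neq0// addn_gt0 r_gt0.
  by rewrite scalerN scaleNr opprK scalerA mulVf// scale1r.
move=> u; set x := Psi (C u).
have Cx : C u = Phi x by rewrite PsiK.
apply: (can_inj PhiK); rewrite PsiK.
have -> : Phi (- (svar ^- q *: x)) = - opD r s tau A (C u).
  have Phi0 : Phi 0 = 0 by have := PhiB 0 0; rewrite !subrr.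
  by rewrite -[- (_ *: x)]sub0r PhiB Phi0 sub0r Cx PhiD exprnN.
have CD x' y' : C (x' + y') = C x' + C y'.
  rewrite -[y' in LHS]opprK CB -[- y']sub0r CB.
  have -> : C 0 = 0 by have := CB 0 0; rewrite !subrr.
  by rewrite sub0r opprK.
have hd := Cd u.
rewrite CM CD CM theta_alpha /opD theta_tau hd.
rewrite scompM// -sconst_nat scompV// scomp_const// sconst_nat scompV//.
have -> : scomp (svar ^+ r) phi = tau := scomp_var_exp phi_order r%:Z.
rewrite (exprnN svar q) -/rho -/tau; move: (svar ^ _) (C (sdelta A u)) (C u) => z x1 x2.
have t0 : tau != 0 := sorder_neq0 tau_order.
have r0 : rho != 0 by rewrite mulf_neq0// invr_eq0.
apply/rowP => j; rewrite !mxE; move: tau t0 rho r0 => t t0 y y0.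
by field; rewrite rK t0 y0.
Qed.

End StationaryPhase.

(** * Regular connections *)

Section Gauge.
Variables (k : fieldType) (K : series_model k).

Definition mtheta m n (P : 'M[K]_(m, n)) : 'M[K]_(m, n) := map_mx (@stheta k K) P.

Lemma mthetaM m n p (P : 'M[K]_(m, n)) (Q : 'M[K]_(n, p)) :
  mtheta (P *m Q) = mtheta P *m Q + P *m mtheta Q.
Proof.
apply/matrixP => i j; rewrite !mxE -big_split /=.
rewrite (big_morph _ (@sthetaD k K) (stheta0 K)).
by apply: eq_bigr => l _; rewrite sthetaM !mxE.
Qed.

Lemma mtheta0 m n : mtheta (0 : 'M[K]_(m, n)) = 0.
Proof. by apply/matrixP => i j; rewrite !mxE stheta0. Qed.

Lemma mtheta1 n : mtheta (1%:M : 'M[K]_n) = 0.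
Proof.
apply/matrixP => i j; rewrite !mxE; case: eqP => _; last exact: stheta0.
exact: stheta1.
Qed.

Lemma mtheta_block m1 m2 n1 n2 (P : 'M[K]_(m1, n1)) (Q : 'M[K]_(m1, n2))
    (R : 'M[K]_(m2, n1)) (S : 'M[K]_(m2, n2)) :
  mtheta (block_mx P Q R S) = block_mx (mtheta P) (mtheta Q) (mtheta R) (mtheta S).
Proof. exact: map_block_mx. Qed.

(** The rows of [P] are a basis in which the connection [theta + A] has matrix [B]. *)
Definition gauge n (A B : 'M[K]_n) : Prop :=
  exists2 P, P \in unitmx & mtheta P + P *m A = B *m P.

Lemma gauge_trans n (A B C : 'M[K]_n) : gauge A B -> gauge B C -> gauge A C.
Proof.
move=> [P Pu eP] [Q Qu eQ]; exists (Q *m P); first by rewrite unitmx_mul Qu Pu.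
by rewrite mthetaM -mulmxA -addrA -mulmxDr eP !mulmxA -mulmxDl eQ.
Qed.

End Gauge.

Section Regular.
Variables (k : closedFieldType) (char0 : [pchar k] =i pred0).
Variable K : series_model k.

(* Representatives of the classes of [k] modulo the integers. *)
Definition rep (a : k) : k := xget 0 [set b | exists m : int, b = a + m%:~R]%classic.

Lemma repP a : exists m : int, rep a = a + m%:~R.
Proof.
rewrite /rep; case: xgetP => [x _ [m ->]|/(_ a)]; first by exists m.
by case; exists 0; rewrite addr0.
Qed.

(** [xget] depends only on the set, here the class modulo the integers. *)
Lemma rep_shift a (m : int) : rep (a + m%:~R) = rep a.
Proof.
rewrite /rep; congr (xget _ _); apply/predeqP => b; split=> -[l ->].
  by exists (m + l); rewrite rmorphD /=; ring.
by exists (l - m); rewrite rmorphB /=; ring.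
Qed.

Lemma rep_id a : rep (rep a) = rep a.
Proof. by have [m e] := repP a; rewrite {1}e rep_shift. Qed.

Definition normalized n (A : 'M[k]_n) : Prop := forall a, eigenvalue A a -> rep a = a.

(** There are finitely many eigenvalues, so one can step down from a given one by integers only
    boundedly far. *)
Lemma lowest_eigenvalue n (A : 'M[k]_n.+1) : exists2 c, eigenvalue A c &
  forall m : nat, (0 < m)%N -> ~~ eigenvalue A (c - m%:R).
Proof.
have [c0 hc0] : exists c, eigenvalue A c.
  have /closed_rootP[c hc] : size (char_poly A) != 1%N by rewrite size_char_poly.
  by exists c; rewrite eigenvalue_root_char.
have [rs hrs] := closed_field_poly_normal (char_poly A).
have [N hN] : exists N, forall m : nat, c0 - m%:R \in rs -> (m <= N)%N.
  elim: rs {hrs} => [|z rs [N hN]]; first by exists 0%N.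
  have [[l hl]|h] := pselect (exists l : nat, c0 - l%:R = z).
    exists (maxn l N) => m; rewrite inE => /orP[/eqP e|/hN mN].
      have /(intf_inj char0)[->] : (m%:Z)%:~R = (l%:Z)%:~R :> k.
        by rewrite -!pmulrn; apply: oppr_inj; apply: (addrI c0); rewrite e hl.
      exact: leq_maxl.
    by rewrite leq_max mN orbT.
  exists N => m; rewrite inE => /orP[/eqP e|/hN//].
  by case: h; exists m.
have mem a : eigenvalue A a -> a \in rs.
  rewrite eigenvalue_root_char hrs rootZ ?lead_coef_eq0 ?monic_neq0 ?char_poly_monic//.
  by rewrite root_prod_XsubC.
have ex : exists m, eigenvalue A (c0 - m%:R) by exists 0%N; rewrite subr0.
have ub m : eigenvalue A (c0 - m%:R) -> (m <= N)%N by move/mem/hN.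
case: (ex_maxnP ex ub) => m hm max; exists (c0 - m%:R) => // l l0.
apply/negP; rewrite -addrA -opprD -natrD => /max; lia.
Qed.

Lemma noneigen_unit n (A : 'M[k]_n) a : ~~ eigenvalue A a -> A - a%:M \in unitmx.
Proof. by rewrite /eigenvalue negbK /eigenspace kermx_eq0 row_free_unit. Qed.

Definition mcoef m n (A : 'M[K]_(m, n)) (i : int) : 'M[k]_(m, n) :=
  \matrix_(a, b) scoef (A a b) i.

Lemma rcoef_mulmx_conv n (A : 'M[K]_n) (u : 'rV[K]_n) (m : nat) :
    (forall i j, sfil 0 (A i j)) -> rfil 0 u ->
  rcoef (u *m A) m%:Z =
  \sum_(l < m.+1) rcoef u l%:Z *m mcoef A (m - l)%N%:Z.
Proof.
move=> hA /rfilE hu; apply/rowP => c; rewrite !mxE summxE scoef_sum.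
under [RHS]eq_bigr => l _ do rewrite mxE.
rewrite exchange_big; apply: eq_bigr => j _ /=.
have := scoef_conv m (hu j) (hA j c); rewrite !add0r => ->.
by apply: eq_bigr => l _; rewrite !mxE !add0r.
Qed.

(** Frobenius' method: the exponent [c] is lowest in its class modulo the integers, so
    [A_0 - (c - m)] is invertible for every [m > 0] and the recursion meets no resonance. *)
Lemma eigenvector n (A : 'M[K]_n.+1) : (forall i j, sfil 0 (A i j)) ->
  exists c (u : 'rV[K]_n.+1), [/\ rfil 0 u, rcoef u 0 != 0 &
    mtheta u + u *m A = sconst c *: u].
Proof.
move=> hA; have [c /eigenvalueP[v0 ev v0n] hc] := lowest_eigenvalue (mcoef A 0).
have [|w m|w hw] := @strong_recursion 'rV[k]_n.+1 0 (fun w m t =>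
  if m == 0%N then t = v0 else
  t *m (mcoef A 0 - (c - m%:R)%:M) =
    - \sum_(l < m) w l *m mcoef A (m - l)%N%:Z).
- move=> w w' m t e; case: eqP => // _ ->; congr (- _).
  by apply: eq_bigr => l _; rewrite e.
- case: eqP => m0; first by exists v0.
  have Mu : mcoef A 0 - (c - m%:R)%:M \in unitmx.
    by apply: noneigen_unit; apply: hc; lia.
  exists ((- \sum_(l < m) w l *m mcoef A (m - l)%N%:Z) *m
    invmx (mcoef A 0 - (c - m%:R)%:M)).
  by rewrite mulmxKV.
have w0 : w 0%N = v0 := hw 0%N.
have [|u hu] := @rcoef_mk _ K n.+1
  (fun m => if m < 0 then 0 else w (absz m)) 0; first by move=> m ->.
have uf : rfil 0 u by move=> m m0; rewrite hu m0.
exists c, u; split => //; first by rewrite hu ltxx /= w0.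
apply: rcoefP => m; rewrite rcoef_constZ rcoefD rcoef_theta.
have uA : rfil 0 (u *m A).
  apply/rfilE => b i i0; rewrite !mxE scoef_sum big1// => j _.
  have /rfilE uf' := uf.
  by have := sfilM (uf' j) (hA j b); rewrite addr0; apply.
have [m0|m0] := ltP m 0; first by rewrite uA// uf// !scaler0 addr0.
have -> : m = (absz m)%:Z by lia.
move: (absz m) => {m0} {}m; rewrite rcoef_mulmx_conv//.
have wE l : rcoef u l%:Z = w l by rewrite hu.
rewrite big_ord_recr subnn /= !wE.
under eq_bigr => l _ do rewrite wE.
have := hw m; case: eqP => [->|m0 h].
  by rewrite big_ord0 add0r scale0r add0r => ->; rewrite ev.
have -> : \sum_(l < m) w l *m mcoef A (m - l)%N%:Z =
    - (w m *m (mcoef A 0 - (c - m%:R)%:M)) by rewrite h opprK.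
rewrite mulmxBr mul_mx_scalar scalerBl -pmulrn; move: (w m *m _) => x; move: (w m) => y.
by apply/rowP => j; rewrite !mxE; ring.
Qed.

(** Some coordinate [j] of [u] is a unit of [k[[t]]]. Replacing the standard basis vector of index
    [j] by [u] involves division by this unit only, so the quotient matrix [A'] stays integral. *)
Lemma complete_eigenvector n (A : 'M[K]_n.+1) c (u : 'rV[K]_n.+1) :
    (forall i j, sfil 0 (A i j)) -> rfil 0 u -> rcoef u 0 != 0 ->
    mtheta u + u *m A = sconst c *: u ->
  exists (b : 'cV[K]_n) (A' : 'M[K]_n), (forall i j, sfil 0 (A' i j)) /\
    gauge A (block_mx (sconst c)%:M 0 b A' : 'M_(1 + n)).
Proof.
move=> hA /rfilE uf u0 ue.
have [j uj] : exists j, scoef (u 0 j) 0 != 0.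
  apply: contrapT => /forallNP h; move/eqP: u0; apply; apply/rowP => j.
  by rewrite !mxE; apply/eqP; have /negP := h j; rewrite negbK.
have u_ord : sorder (u 0 j) 0 by split=> //; apply: uf.
have ujn := sorder_neq0 u_ord.
have ujV : sfil 0 (u 0 j)^-1 by have := sorder_fil (sorderV u_ord); rewrite oppr0.
pose Q : 'M[K]_(n, n.+1) := row' j 1%:M.
have Qj i : Q i j = 0 by rewrite !mxE eq_sym (negPf (neq_lift _ _)).
have Ql i l : Q i (lift j l) = (i == l)%:R.
  by rewrite !mxE (inj_eq lift_inj).
pose b : 'cV[K]_n := \col_i (A (lift j i) j / u 0 j).
pose A' : 'M[K]_n := \matrix_(i, l)
  (A (lift j i) (lift j l) - A (lift j i) j / u 0 j * u 0 (lift j l)).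
exists b, A'; split.
  move=> i l; rewrite mxE; apply: (filB (sfil_filtration K)) => //.
  have := sfilM (sfilM (hA (lift j i) j) ujV) (uf (lift j l)).
  by rewrite !addr0.
exists (col_mx u Q : 'M_(1 + n)).
  rewrite -row_free_unit; apply: inj_row_free => y.
  rewrite -(@hsubmxK _ 1 1 n y) (@mul_row_col _ 1 1 n n.+1) => hy.
  move: hy; move: (lsubmx _) (rsubmx _) => y1 y2 hy.
  have y10 : y1 = 0.
    have := congr1 (fun z : 'rV_n.+1 => z 0 j) hy.
    rewrite !mxE big_ord1 big1 ?addr0; last by move=> l _; rewrite Qj mulr0.
    move/eqP; rewrite mulf_eq0 (negPf ujn) orbF => /eqP h.
    by apply/rowP => i; rewrite ord1 h mxE.
  move: hy; rewrite y10 mul0mx add0r => hy.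
  have -> : y2 = 0.
    apply/rowP => l; have := congr1 (fun z : 'rV_n.+1 => z 0 (lift j l)) hy.
    rewrite !mxE (bigD1 l)//= Ql eqxx mulr1 big1 ?addr0// => i il.
    by rewrite Ql (negPf il) mulr0.
  by rewrite row_mx0.
have Q0 : mtheta Q = 0.
  apply/matrixP => i l; rewrite !mxE; case: eqP => _; last exact: stheta0.
  exact: stheta1.
have -> : mtheta (col_mx u Q : 'M_(1 + n)) = col_mx (mtheta u) (mtheta Q).
  exact: map_col_mx.
rewrite Q0.
rewrite (@mul_col_mx _ 1 n n.+1 n.+1) (@add_col_mx _ 1 n n.+1) ue add0r (@mul_block_col _ 1 n 1 n n.+1).
rewrite mul0mx addr0 mul_scalar_mx.
apply: (congr1 (@col_mx _ 1 n n.+1 (sconst c *: u))).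
apply/matrixP => i l.
have -> : (Q *m A) i l = A (lift j i) l.
  rewrite !mxE (bigD1 (lift j i))//= Ql eqxx mul1r big1 ?addr0// => m mi.
  by rewrite !mxE eq_sym (negPf mi) mul0r.
rewrite !mxE big_ord1 !mxE; have [l' ->|->] := unliftP j l.
  rewrite (bigD1 l')//= Ql eqxx mulr1 big1 ?addr0; last first.
    by move=> m ml; rewrite Ql (negPf ml) mulr0.
  by rewrite mxE addrCA subrr addr0.
by rewrite big1 ?addr0 ?divfK// => m _; rewrite Qj mulr0.
Qed.

Lemma gauge_block n c (b : 'cV[K]_n) (A B : 'M[K]_n) : gauge A B ->
  exists b', gauge (block_mx c%:M 0 b A : 'M_(1 + n)) (block_mx c%:M 0 b' B).
Proof.
move=> [P Pu eP]; exists (P *m b); exists (block_mx 1%:M 0 0 P).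
  by rewrite unitmxE det_ublock det1 mul1r -unitmxE.
rewrite mtheta_block mtheta1 !mtheta0.
rewrite !mulmx_block add_block_mx !mul0mx !mulmx0 !mul1mx !mulmx1 !addr0 !add0r.
by rewrite -eP.
Qed.

(** Rescaling the first basis vector by [Z^m] adds [m] to its exponent. *)
Lemma gauge_scale n (c : k) (m : int) (b : 'cV[K]_n) (A : 'M[K]_n) :
  exists b', gauge (block_mx (sconst c)%:M 0 b A : 'M_(1 + n))
    (block_mx (sconst (c + m%:~R))%:M 0 b' A).
Proof.
have vm : svar ^ m != 0 :> K by rewrite expfz_neq0// svar_neq0.
exists (svar ^ (- m) *: b); exists (block_mx (svar ^ m)%:M 0 0 1%:M).
  by rewrite unitmxE det_ublock det1 mulr1 det_scalar1 unitfE.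
rewrite mtheta_block mtheta1 !mtheta0.
have -> : mtheta ((svar ^ m)%:M : 'M[K]_1) = (m%:~R * svar ^ m)%:M.
  by apply/matrixP => i j; rewrite !ord1 !mxE eqxx stheta_var.
rewrite !mulmx_block add_block_mx !mul0mx !mulmx0 !mul1mx !mulmx1 !addr0 !add0r.
rewrite -!scalar_mxM -raddfD mul_mx_scalar; congr block_mx.
  by rewrite sconstD sconst_int; congr _%:M; ring.
by rewrite scalerA -expfzDr ?svar_neq0// addrN expr0z scale1r.
Qed.

(* Without resonances, [theta h + c h - A h = b0 - b] is solvable coefficientwise, *)
(* [b0] being the constant term of [b].                                           *)
Lemma gauge_column n (c : k) (b : 'cV[K]_n) (A : 'M[k]_n) :
    normalized A -> rep c = c ->
  exists b0 : 'cV[k]_n, gauge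
    (block_mx (sconst c)%:M 0 b (mconst K A) : 'M_(1 + n))
    (mconst K (block_mx c%:M 0 b0 A : 'M_(1 + n))).
Proof.
move=> nA rc; pose bc i := rcoef b^T i; pose M m := A - (c + m%:~R)%:M.
have Mu m : m != 0 -> M m \in unitmx.
  move=> m0; apply: noneigen_unit; apply/negP => /nA; rewrite rep_shift rc.
  move/eqP; rewrite -subr_eq0 opprD addrA subrr sub0r oppr_eq0.
  by apply/negP; apply: intf_neq0.
have [N hN] := fil_ex (rfil_filtration K n) b^T.
have [|h hh] := @rcoef_mk _ K n (fun m => if m == 0 then 0 else
    bc m *m invmx (M m)^T) N.
  by move=> m mN; case: eqP => // _; rewrite /bc hN// mul0mx.
exists (bc 0)^T; exists (block_mx 1%:M 0 h^T 1%:M).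
  by rewrite unitmxE det_lblock !det1 mulr1 unitr1.
rewrite mtheta_block !mtheta1 !mtheta0 /mconst map_block_mx.
have -> : map_mx sconst c%:M = (sconst c)%:M :> 'M[K]_1.
  by apply/matrixP => i j; rewrite !ord1 !mxE eqxx.
have -> : map_mx sconst (0 : 'M_(1, n)) = 0 :> 'M[K]_(1, n).
  by apply/matrixP => i j; rewrite !mxE sconst0.
rewrite !mulmx_block add_block_mx.
rewrite !mul0mx !mulmx0 !mul1mx !mulmx1 !addr0 !add0r; congr block_mx.
apply: trmx_inj; apply: rcoefP => m.
rewrite !linearD /= !trmx_mul ?trmxK tr_scalar_mx ?trmxK.
have -> : (mtheta h^T)^T = mtheta h by apply/matrixP => i j; rewrite !mxE.
have -> : (map_mx sconst (bc 0)^T)^T = rconst K (bc 0).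
  by apply/matrixP => i j; rewrite !mxE.
have -> : (map_mx sconst A)^T = mconst K A^T.
  by apply/matrixP => i j; rewrite !mxE.
rewrite !rcoefD rcoef_theta rconst_coef rcoef_mulmx mul_scalar_mx rcoef_constZ.
rewrite -/(bc m) hh; case: eqP => [->|/eqP m0].
  by rewrite !scaler0 !mul0mx !add0r addr0.
have : bc m *m invmx (M m)^T *m (M m)^T = bc m.
  by rewrite mulmxKV// unitmx_tr Mu.
move: (bc m *m _) => x.
rewrite add0r linearB /= tr_scalar_mx mulmxBr mul_mx_scalar => <-.
move: (x *m A^T) => y.
by apply/rowP => j; rewrite !mxE; ring.
Qed.

Lemma normalized_block n c (b : 'cV[k]_n) (A : 'M[k]_n) :
  normalized A -> rep c = c -> normalized (block_mx c%:M 0 b A : 'M_(1 + n)).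
Proof.
move=> nA rc a /eigenvalueP[v ev v0]; move: ev v0.
rewrite -[v]hsubmxK (@mul_row_block _ 1 1 n 1 n) mulmx0 add0r scale_row_mx.
move: (lsubmx v) (rsubmx v) => y z /(@eq_row_mx _ 1 1 n)[ey ez].
have [z0|z0 _] := eqVneq z 0; last first.
  by apply: nA; apply/eigenvalueP; exists z.
move: ey; rewrite z0 mul0mx addr0 mul_mx_scalar => ey y0.
have y00 : y != 0 by apply: contraNneq y0 => ->; rewrite row_mx0.
move/eqP: ey; rewrite -subr_eq0 -scalerBl scaler_eq0 (negPf y00) orbF subr_eq0.
by move/eqP <-.
Qed.

(** Induction on the rank, splitting off one eigenvector. Normalization belongs to the induction
    because it excludes resonances when the column linking the eigenvector to the quotient is made
    constant. *)
Lemma gauge_constant n (A : 'M[K]_n) : (forall i j, sfil 0 (A i j)) ->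
  exists2 A0 : 'M[k]_n, normalized A0 & gauge A (mconst K A0).
Proof.
elim: n A => [|n IH] A hA.
  exists 0; first by move=> a /eigenvalueP[v _]; rewrite [v]thinmx0 eqxx.
  exists 1%:M; first exact: unitmx1.
  by apply/matrixP => -[].
have [c [u [uf u0 ue]]] := eigenvector hA.
have [b [A' [hA' g1]]] := complete_eigenvector hA uf u0 ue.
have [A0 nA0 g2] := IH A' hA'.
have [b1 g3] := gauge_block (sconst c) b g2.
have [m hm] := repP c.
have [b2 g4] := gauge_scale c m b1 (mconst K A0).
rewrite -hm in g4.
have [b0 g5] := gauge_column b2 nA0 (rep_id c).
exists (block_mx (rep c)%:M 0 b0 A0 : 'M_(1 + n)).
  by apply: normalized_block => //; apply: rep_id.
exact: gauge_trans g1 (gauge_trans g3 (gauge_trans g4 g5)).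
Qed.

End Regular.

(** * Bases of finitely generated modules over power series *)

Section LatticeBasis.
Variables (k : fieldType) (K : series_model k) (V : lmodType K).

Definition integral_span n (e : 'I_n -> V) (u : V) : Prop :=
  exists2 c : 'I_n -> K, (forall i, sfil 0 (c i)) & u = \sum_(i < n) c i *: e i.

Lemma row_order n (u : 'rV[K]_n) : u != 0 ->
  exists i, rfil i u /\ rcoef u i != 0.
Proof.
move=> u0; have hF := rfil_filtration K n; have [a ha] := fil_ex hF u.
have ex : exists m : nat, rcoef u (a + m%:Z) != 0.
  apply: contrapT => /forallNP h; move/eqP: u0; apply; apply: rcoefP => i.
  rewrite rcoef0; have [/ha//|ai] := ltP i a.
  have -> : i = a + (absz (i - a)%R)%:Z by lia.
  by apply/eqP; have /negP := h (absz (i - a)%R); rewrite negbK.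
exists (a + (ex_minn ex)%:Z); case: ex_minnP => m um hm; split => // i im.
have [/ha//|ai] := ltP i a; apply/eqP; apply: contraTT im => ui.
have e : i = a + (absz (i - a)%R)%:Z by lia.
by rewrite e in ui; move/hm: ui; lia.
Qed.

Lemma lattice_basis n (e : 'I_n -> V) : exists m (b : 'I_m -> V),
  (forall c : 'I_m -> K, \sum_(i < m) c i *: b i = 0 -> forall i, c i = 0) /\
  forall u, integral_span e u <-> integral_span b u.
Proof.
elim: n e => [|n IH] e; first by exists 0%N, e; split=> // c _ [].
have [free|] := pselect (forall c : 'I_n.+1 -> K,
  \sum_(i < n.+1) c i *: e i = 0 -> forall i, c i = 0).
  by exists n.+1, e.
move=> /existsNP[c0 /not_implyP[c0e /existsNP[i0 ci0]]].
have [v [vf v0]] : exists v, rfil v (\row_i c0 i) /\ rcoef (\row_i c0 i) v != 0.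
  by apply: row_order; apply: contra_not_neq ci0 => /rowP/(_ i0); rewrite !mxE.
pose c i := svar ^ (- v) * c0 i.
have cf i : sfil 0 (c i).
  move/rfilE: vf => /(_ i); rewrite mxE => /(svar_exp_fil (i := - v)).
  by rewrite addNr.
have ce : \sum_(i < n.+1) c i *: e i = 0.
  transitivity (svar ^ (- v) *: \sum_(i < n.+1) c0 i *: e i).
    by rewrite scaler_sumr; apply: eq_bigr => i _; rewrite scalerA.
  by rewrite c0e scaler0.
have [j cj] : exists j, scoef (c j) 0 != 0.
  apply: contrapT => /forallNP h; move/eqP: v0; apply; apply/rowP => j.
  apply/eqP; have /negP := h j; rewrite negbK !mxE /c svar_exp_coef.
  by rewrite sub0r opprK.
have cj_ord : sorder (c j) 0 by split=> //; apply: cf.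
have cj0 := sorder_neq0 cj_ord.
have cjV : sfil 0 (c j)^-1 by have := sorder_fil (sorderV cj_ord); rewrite oppr0.
have hF := sfil_filtration K.
have [m [b [bfree hb]]] := IH (fun l => e (lift j l)).
exists m, b; split=> // u; rewrite -hb; split=> -[d df ->].
  exists (fun l => d (lift j l) - d j / c j * c (lift j l)).
    move=> l; apply: (filB hF) => //.
    by have := sfilM (sfilM (df j) cjV) (cf (lift j l)); rewrite !addr0.
  rewrite (bigD1_ord j)//=; have -> : d j *: e j =
      - \sum_(l < n) (d j / c j * c (lift j l)) *: e (lift j l).
    move/eqP: ce; rewrite (bigD1_ord j)//= addr_eq0 => /eqP h.
    rewrite -[e j](scalerK cj0) h scalerN scalerN scalerA scaler_sumr.
    by congr (- _); apply: eq_bigr => l _; rewrite scalerA.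
  rewrite addrC -sumrB; apply: eq_bigr => l _.
  by rewrite scalerBl.
pose d' i := if unlift j i is Some l then d l else 0.
exists d'.
  move=> i; rewrite /d'; case: unliftP => [l _|_] //.
  exact: fil0 hF 0.
rewrite (bigD1_ord j)//= /d' unlift_none scale0r add0r.
by apply: eq_bigr => l _; rewrite liftK.
Qed.

End LatticeBasis.

(** * Connections over [laurent k] *)

Section LaurentModel.
Variable k : fieldType.
Local Notation K := (laurent k).

Fact laurent_mk (c : int -> k) (i : int) : (forall n, n < i -> c n = 0) ->
  exists f : K, forall n, f n = c n.
Proof. by move=> h; exists (Laurent (ex_intro _ i h)). Qed.

Fact laurent_comp_conv (f p : K) (i m : int) (M : nat) :
    has_order p 1 -> (forall n, n < i -> f n = 0) -> m < i + M%:Z ->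
  lcomp f p m = \sum_(l < M) f (i + l%:Z) * (p ^ (i + l%:Z)) m.
Proof.
move=> p1 hf hm; rewrite lcomp_coef// (@fsbig_int_interval _ _ i M)//.
move=> j; have [ji|ij] := ltP j i; first by rewrite hf// mul0r eqxx.
have [//|Mj] := ltP j (i + M%:Z).
by have [_ ->] := has_order_exprz j p1; rewrite ?mulr0 ?eqxx//; lia.
Qed.

Definition laurent_model : series_model k :=
  @SeriesModel k K (@lcoef k) (@lconst k) lvar (@ltheta k) (@lcomp k)
    (@laurentP k) (@lcoef_bounded k) (fun f g i => erefl) laurent_mk
    (fun f g i j m hf hg => @lmul_conv k f g i j m hf hg)
    (fun c i => erefl) (@lcoef_const_mul k) (fun i => erefl) (fun f i => erefl)
    (@lthetaM k) (@has_order_ex k) (fun f g i j => @has_order_mul k f g i j)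
    (fun f i n => @has_order_exprz k f i n) laurent_comp_conv.

End LaurentModel.

Section Isomorphisms.
Variable k : fieldType.
Local Notation K := (laurent k).
Local Notation L := (laurent_model k).

Lemma linear_of (V W : lmodType K) (f : V -> W) :
  (forall a u v, f (a *: u + v) = a *: f u + f v) ->
  exists phi : {linear V -> W}, phi =1 f.
Proof.
move=> fl; pose phi : {linear V -> W} :=
  HB.pack f (GRing.isLinear.Build K V W *:%R f fl).
by exists phi.
Qed.

Lemma conn_isoI (M N : connection k) (f : M -> N) : bijective f ->
  (forall a u v, f (a *: u + v) = a *: f u + f v) ->
  (forall u, f (cdelta u) = cdelta (f u)) -> conn_iso M N.
Proof.
move=> fb /linear_of[phi hphi] fd; exists phi; split.
  by apply: (eq_bij fb) => u; rewrite hphi.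
by move=> u; rewrite !hphi.
Qed.

Lemma conn_iso_sym (M N : connection k) : conn_iso M N -> conn_iso N M.
Proof.
move=> [phi [[g phiK gK] hd]]; apply: (@conn_isoI _ _ g).
- by exists phi.
- by move=> a u v; apply: (can_inj phiK); rewrite linearP !gK.
- by move=> u; apply: (can_inj phiK); rewrite hd !gK.
Qed.

Lemma conn_iso_trans (M N P : connection k) :
  conn_iso M N -> conn_iso N P -> conn_iso M P.
Proof.
move=> [f [fb fd]] [g [gb gd]]; apply: (@conn_isoI _ _ (g \o f)).
- exact: bij_comp.
- by move=> a u v /=; rewrite !linearP.
- by move=> u /=; rewrite fd gd.
Qed.

Section Twist.
Variables (f : K) (M : connection k).

Definition twist_delta (u : M) : M := cdelta u + f *: u.

Fact twist_linear (c : k) (u v : M) : twist_delta (lconst c *: u + v) =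
  lconst c *: twist_delta u + twist_delta v.
Proof.
rewrite /twist_delta cdelta_linear scalerDr [lconst c *: (_ + _)]scalerDr.
by rewrite addrACA !scalerA [f * _]mulrC.
Qed.

Fact twist_leibniz (g : K) (u : M) :
  twist_delta (g *: u) = ltheta g *: u + g *: twist_delta u.
Proof.
by rewrite /twist_delta cdelta_leibniz scalerDr addrA !scalerA [f * _]mulrC.
Qed.

Definition twist : connection k := Connection twist_linear twist_leibniz.

End Twist.

Lemma twist_iso (f : K) (M N : connection k) :
  conn_iso M N -> conn_iso (twist f M) (twist f N).
Proof.
move=> [phi [phib hd]]; apply: (@conn_isoI (twist f M) (twist f N) phi) => //.
  by move=> a u v; rewrite linearP.
by move=> u; rewrite /= /twist_delta addrC linearP hd addrC.
Qed.

Lemma tensor_rank1_iso (f : K) (M : connection k) :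
  conn_iso (twist f M) (tensor (rank1 f) M).
Proof.
pose e : rank1 f := (1 : K); pose bR := vbasis {: rank1 f}.
have bE (x : rank1 f) : x = (x : K) *: e.
  by rewrite /e [RHS]/GRing.scale /= mulr1.
(* Tensors are stored in coordinates of an unspecified basis of the line; one nonzero coordinate of
   [e] is enough for injectivity. *)
have [i0 hi0] : exists i, coord bR i e != 0.
  apply: contrapT => /forallNP h.
  have /eqP : e = 0.
    rewrite [LHS](coord_vbasis (memvf e)) big1// => i _.
    by have /negP := h i; rewrite negbK => /eqP ->; rewrite scale0r.
  by apply/negP; apply: oner_neq0.
pose t (u : twist f M) : tensor (rank1 f) M := tens e (u : M).
have tl a u v : t (a *: u + v) = a *: t u + t v by exact: tens_lin_r.
apply: (@conn_isoI _ _ t) => //.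
  have tinj : injective t.
    move=> u v huv; apply/eqP; rewrite -subr_eq0 addrC -scaleN1r; apply/eqP.
    have h : t (-1 *: v + u) = 0 by rewrite tl huv scaleN1r addNr.
    rewrite [LHS](coord_vbasis (memvf (-1 *: v + u : M))) big1// => j _.
    have := congr1 (fun X : tens_space (rank1 f) M => X i0 j) h.
    rewrite mxE [in RHS]mxE => /eqP; rewrite mulf_eq0 (negPf hi0) => /eqP ->.
    by rewrite scale0r.
  have tsurj X : exists u, t u = X.
    exists (\sum_j (\sum_i X i j * (bR`_i : K)) *: (vbasis {:M})`_j).
    rewrite [RHS]tens_basis exchange_big /t.
    rewrite tens_sumr; apply: eq_bigr => j _; rewrite scaler_suml.
    apply: eq_bigr => i _; rewrite -scalerA; congr (_ *: _).
    rewrite {2}(bE bR`_i).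
    by apply/matrixP => a b; rewrite !mxE linearZ /= mulrA.
  have [g hg] := choice tsurj; exists g => // u.
  by apply: tinj; rewrite hg.
move=> u; rewrite /t tensor_delta.
have -> : cdelta e = f *: e :> rank1 f.
  by rewrite /= /rank1_delta [ltheta e](ltheta_const 1) add0r.
rewrite -[@cdelta k (twist f M) u]/(@cdelta k M u + f *: (u : M)).
by apply/matrixP => i j; rewrite !mxE !linearD !linearZ /=; ring.
Qed.

Section MatrixConnection.
Variables (n : nat) (A : 'M[K]_n).

Definition matrix_delta (u : 'rV[K]_n) : 'rV[K]_n :=
  @mtheta k L 1 n u + u *m A.

Fact matrix_leibniz (f : K) (u : 'rV[K]_n) :
  matrix_delta (f *: u) = ltheta f *: u + f *: matrix_delta u.
Proof.
rewrite /matrix_delta scalerDr -scalemxAl addrA; congr (_ + _).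
by apply/rowP => c; rewrite !mxE; apply: lthetaM.
Qed.

Fact matrix_linear (c : k) (u v : 'rV[K]_n) : matrix_delta (lconst c *: u + v) =
  lconst c *: matrix_delta u + matrix_delta v.
Proof.
have D : matrix_delta (lconst c *: u + v) =
    matrix_delta (lconst c *: u) + matrix_delta v.
  rewrite /matrix_delta mulmxDl addrACA; congr (_ + _).
  by apply/rowP => i; rewrite !mxE; apply: lthetaD.
by rewrite D matrix_leibniz ltheta_const scale0r add0r.
Qed.

Definition matrix_conn : connection k :=
  @Connection k 'rV[K]_n matrix_delta matrix_linear matrix_leibniz.

End MatrixConnection.

Lemma gauge_iso n (A B : 'M[K]_n) : @gauge k L n A B ->
  conn_iso (matrix_conn A) (matrix_conn B).
Proof.
move=> [P Pu eP]; apply: conn_iso_sym.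
apply: (@conn_isoI (matrix_conn B) (matrix_conn A) (fun u : 'rV[K]_n => u *m P)).
- by exists (fun u => u *m invmx P) => u; [apply: mulmxK | apply: mulmxKV].
- by move=> a u v; rewrite mulmxDl scalemxAl.
move=> u; rewrite /= /matrix_delta mulmxDl -mulmxA.
rewrite -[B *m P]eP mulmxDr addrA mulmxA; congr (_ + _).
exact/esym/(@mthetaM k L).
Qed.

(** A stable lattice has a basis over [k[[t]]], in which the matrix of the derivation is
    integral. *)
Lemma regular_matrix (R : connection k) : regular R ->
  exists n, exists2 A : 'M[K]_n, forall i j, lintegral (A i j) &
    conn_iso (matrix_conn A) R.
Proof.
move=> [M [n [e [espan ->]]] Mdelta].
have [m [b [bfree hb]]] := @lattice_basis k L R n (tnth e).
have memb i : exists2 c : 'I_m -> K, (forall j, lintegral (c j)) &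
    cdelta (b i) = \sum_j c j *: b j.
  have /hb : @integral_span k L R m b (b i).
    exists (fun j => (i == j)%:R).
      by move=> j; case: eqP => _ l l0 //=; rewrite ifF//; lia.
    rewrite (bigD1 i)//= eqxx scale1r big1 ?addr0// => j ji.
    by rewrite eq_sym (negPf ji) scale0r.
  by move/Mdelta; move/(hb _).1.
have /fin_all_exists2[C hC hbC] := memb.
pose A : 'M[K]_m := \matrix_(i, j) C i j.
exists m, A; first by move=> i j; rewrite mxE; apply: hC.
pose f (u : matrix_conn A) : R := \sum_i (u : 'rV[K]_m) 0 i *: b i.
have fl a u v : f (a *: u + v) = a *: f u + f v.
  rewrite /f scaler_sumr -big_split; apply: eq_bigr => i _.
  by rewrite !mxE scalerDl scalerA.
have finj : injective f.
  move=> u v huv; apply/eqP; rewrite -subr_eq0 addrC -scaleN1r; apply/eqP.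
  have h : f (-1 *: v + u) = 0 by rewrite fl huv scaleN1r addNr.
  by apply/rowP => i; rewrite [RHS]mxE; apply: (bfree _ h).
have espanb i : exists c : 'I_m -> K, tnth e i = \sum_j c j *: b j.
  have /hb[c _ ->] : @integral_span k L R n (tnth e) (tnth e i).
    exists (fun j => (i == j)%:R).
      by move=> j; case: eqP => _ l l0 //=; rewrite ifF//; lia.
    rewrite (bigD1 i)//= eqxx scale1r big1 ?addr0// => j ji.
    by rewrite eq_sym (negPf ji) scale0r.
  by exists c.
have [D hD] := choice espanb.
have fsurj u : exists x, f x = u.
  have : u \in <<e>>%VS by rewrite espan memvf.
  move/coord_span => ->.
  exists (\row_j \sum_i coord e i u * D i j).
  rewrite /f; under eq_bigr => j _ do rewrite mxE scaler_suml.
  rewrite exchange_big; apply: eq_bigr => i _.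
  rewrite -tnth_nth hD scaler_sumr; apply: eq_bigr => j _.
  by rewrite scalerA.
apply: (@conn_isoI _ _ f) => //.
  have [g hg] := choice fsurj; exists g => // u.
  by apply: finj; rewrite hg.
move=> u; rewrite /f cdelta_sum.
under [RHS]eq_bigr => i _ do rewrite cdelta_leibniz hbC.
rewrite big_split /=.
under eq_bigr => i _ do rewrite mxE scalerDl.
rewrite big_split /=; congr (_ + _).
  by apply: eq_bigr => i _; rewrite mxE.
under eq_bigr => i _ do rewrite mxE scaler_suml.
rewrite exchange_big; apply: eq_bigr => i _ /=.
rewrite scaler_sumr; apply: eq_bigr => j _.
by rewrite scalerA mxE.
Qed.

End Isomorphisms.

(** * Lattices of a direct image and the filtration by order *)

Section Lattices.
Variable k : fieldType.
Local Notation K := (laurent k).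
Local Notation L := (laurent_model k).

Lemma lvar_exp_mono (i m : int) : (lvar ^ i : K) m = (m == i)%:R.
Proof. exact: (@svar_exp_mono k L). Qed.

Lemma lattice_span (M : connection k) n (e : n.-tuple M) (u : M) :
  <<e>>%VS = fullv -> exists c : 'I_n -> K, u = \sum_i c i *: tnth e i.
Proof.
move=> espan; have : u \in <<e>>%VS by rewrite espan memvf.
move/coord_span => h; exists (fun i => coord e i u); rewrite {1}h.
by apply: eq_bigr => i _; rewrite -tnth_nth.
Qed.

Lemma lattice_absorbs (M : connection k) (X : set M) (u : M) : is_lattice X ->
  exists m : int, forall f : K, @sfil k L m f -> X (f *: u).
Proof.
move=> [n [e [espan ->]]]; have [c ->] := lattice_span u espan.
have [a ha] := fil_ex (rfil_filtration L n) (\row_i c i).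
exists (- a) => f hf; exists (fun i => f * c i).
  move=> i; have /rfilE/(_ i) := ha; rewrite mxE => hc.
  have h := @sfilM k L _ _ f (c i) hf hc.
  by move=> l l0; apply: h; rewrite addNr.
by rewrite scaler_sumr; apply: eq_bigr => i _; rewrite scalerA.
Qed.

Lemma lattice_add (M : connection k) (X : set M) (u v : M) :
  is_lattice X -> X u -> X v -> X (u + v).
Proof.
move=> [n [e [_ ->]]] [c hc ->] [d hd ->]; exists (fun i => c i + d i).
  by move=> i l l0 /=; rewrite hc// hd// addr0.
by rewrite -big_split; apply: eq_bigr => i _; rewrite scalerDl.
Qed.

Lemma lattice0 (M : connection k) (X : set M) : is_lattice X -> X 0.
Proof.
move=> [n [e [_ ->]]]; exists (fun=> 0) => //.
by rewrite big1// => i _; rewrite scale0r.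
Qed.

Lemma lattice_image (M N : connection k) (phi : {linear M -> N}) (X : set M) :
  bijective phi -> is_lattice X ->
  is_lattice (fun v => exists2 u, X u & v = phi u).
Proof.
move=> [psi phiK psiK] [n [e [espan ->]]].
have tE i : tnth (map_tuple phi e) i = phi (tnth e i) by rewrite tnth_map.
exists n, (map_tuple phi e); split.
  apply/vspaceP => v; rewrite memvf; have [c hc] := lattice_span (psi v) espan.
  rewrite -[v]psiK hc linear_sum; apply: memv_suml => i _.
  rewrite linearZ; apply: memvZ; apply: memv_span.
  by rewrite -tE mem_tnth.
apply/predeqP => v; split.
  move=> [u [c hc ->] ->]; exists c => //; rewrite linear_sum.
  by apply: eq_bigr => i _; rewrite linearZ tE.
move=> [c hc ->]; exists (\sum_i c i *: tnth e i); first by exists c.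
by rewrite linear_sum; apply: eq_bigr => i _; rewrite linearZ tE.
Qed.

Lemma local_fourier_iso (M N F : connection k) : conn_iso M N ->
  is_local_fourier_0oo N F -> is_local_fourier_0oo M F.
Proof.
move=> [phi [phib hd]] [iota [[ib il] i1 i2 ic]].
exists (fun u => iota (phi u)); split.
- by split=> [|c u v]; [exact: bij_comp | rewrite linearP il].
- by move=> u; rewrite linearZ i1.
- by move=> u; rewrite /cderiv linearZ hd -/(cderiv _) i2.
move=> X hX; have [X' hX' h] := ic _ (lattice_image phib hX).
exists X' => // u /h[v Xv /(bij_inj phib) ->//].
Qed.

Section PushforwardLattice.
Variables (r : nat) (r_gt0 : (0 < r)%N).

Lemma lsubst_fil (i : int) (f : K) : @sfil k L i f -> @sfil k L (i * r%:Z) (lsubst r_gt0 f).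
Proof.
by move=> hf m mi /=; case: ifP => // _; apply: hf; rewrite ltz_divLR.
Qed.

Lemma lsubst_coef (f : K) m : lsubst r_gt0 f m =
  if (r%:Z %| m)%Z then f (m %/ r%:Z)%Z else 0.
Proof. by []. Qed.

Lemma lsubst_var_exp (m : int) : lsubst r_gt0 (lvar ^ m) = lvar ^ (r%:Z * m) :> K.
Proof.
apply: laurentP => n; rewrite lsubst_coef !lvar_exp_mono.
case: ifP => [/dvdzP[p ->]|rn].
  rewrite mulzK; last by lia.
  by rewrite mulrC; congr (_%:R); congr nat_of_bool; apply/eqP/eqP => h; nia.
case: eqP => // h; move: rn; rewrite h dvdz_mulr//.
Qed.

Lemma root_expansion (f : K) :
  f = \sum_(i < r) lsubst r_gt0 (lsplit r_gt0 f i) * lvar ^ i%:Z.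
Proof.
apply: laurentP => n.
have sumE (F : 'I_r -> K) : (\sum_i F i) n = \sum_i F i n.
  exact: (@scoef_sum k L).
rewrite sumE.
have e (i : 'I_r) : (lsubst r_gt0 (lsplit r_gt0 f i) * lvar ^ i%:Z : K) n =
    if (r%:Z %| n - i%:Z)%Z then f n else 0.
  rewrite mulrC [LHS](@svar_exp_coef k L) [LHS]lsubst_coef; case: ifP => // /dvdzP[p hp].
  by rewrite hp mulzK /=; [congr (f _); lia | lia].
have m0 : (0 <= n %% r%:Z)%Z by apply: modz_ge0; lia.
have mr : ((n %% r%:Z)%Z < r%:Z)%R by apply: ltz_pmod; lia.
have lt : (absz (n %% r%:Z)%Z < r)%N by lia.
rewrite (eq_bigr _ (fun i _ => e i)) (bigD1 (Ordinal lt)) //= ifT; last first.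
  apply/dvdzP; exists (n %/ r%:Z)%Z => /=.
  by have := divz_eq n r%:Z; lia.
rewrite big1 ?addr0// => i ine; rewrite ifF//; apply: contraNF ine => /dvdzP[p hp].
have ni : n = p * r%:Z + i%:Z by lia.
have ir := ltn_ord i.
have h : (n %% r%:Z)%Z = i%:Z by rewrite ni modzMDl modz_small//; lia.
by apply/eqP/val_inj; rewrite /= h.
Qed.

Variables (char0 : [pchar k] =i pred0) (n : nat) (A : 'M[K]_n) (f : K).
Let W := pushforward char0 r_gt0 (twist f (matrix_conn A)).

Lemma pushforward_scaleE (g : K) (u : W) :
  g *: u = lsubst r_gt0 g *: (u : 'rV[K]_n) :> 'rV[K]_n.
Proof. by []. Qed.

(** Any basis, multiplied by a high power of the variable, spans such a lattice. With
    [lattice_open], the lattices of a direct image and the filtration by order upstairs define the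
    same topology. *)
Lemma small_lattice (N : int) : exists2 X : set W, is_lattice X &
  forall u : W, X u -> @rfil k L n N u.
Proof.
pose d := \dim {:W}; pose e := vbasis {:W}.
have hF := rfil_filtration L n.
pose a i := xget 0 [set a : int | @rfil k L n a (tnth e i)]%classic.
have ha i : @rfil k L n (a i) (tnth e i).
  rewrite /a; case: xgetP => // none; have [b hb] := fil_ex hF (tnth e i).
  by case: (none b).
pose a0 := \big[Order.min/0]_i a i.
have ha0 i : @rfil k L n a0 (tnth e i).
  by apply: (fil_le hF) (ha i); apply: bigmin_le.
pose m : int := (absz (N - a0)%R)%:Z.
pose e' := map_tuple (fun u : W => (lvar ^ m : K) *: u) e.
have e'E i : tnth e' i = (lvar ^ m : K) *: tnth e i by rewrite tnth_map.
have vm : (lvar ^ m : K) != 0.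
  by rewrite expfz_neq0//; apply: (@svar_neq0 k L).
exists [set u | exists2 c : 'I_d -> K, (forall i, lintegral (c i)) &
                   u = \sum_(i < d) c i *: tnth e' i]%classic.
  exists d, e'; split=> //.
  apply/vspaceP => u; rewrite memvf; have eb := vbasisP {:W}.
  have [c ->] := @lattice_span W d e u (span_basis eb).
  apply: memv_suml => i _; apply: memvZ.
  rewrite -[tnth e i](scalerK vm) -e'E; apply: memvZ; apply: memv_span.
  exact: mem_tnth.
move=> u [c hc ->]; apply: (fil_sum hF) => i _.
rewrite e'E scalerA pushforward_scaleE lsubstM lsubst_var_exp.
have h1 := lsubst_fil (hc i); rewrite mul0r in h1.
have h2 : @sfil k L (r%:Z * m) (lvar ^ (r%:Z * m)).
  by move=> l hl; apply: etrans (lvar_exp_mono _ _) _; case: eqP => // ?; lia.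
apply: (fil_le hF) (rfilZ (sfilM h1 h2) (ha0 i)); rewrite /m; nia.
Qed.

(** The products [T^i e_l] with [i < r] generate the direct image, and a lattice contains all large
    multiples, in the adic sense, of each of them. *)
Lemma lattice_open (X : set W) : is_lattice X ->
  exists N : int, forall u : W, @rfil k L n N u -> X u.
Proof.
move=> hX; pose w (ij : 'I_r * 'I_n) : W :=
  (lvar ^ ij.1%:Z : K) *: (delta_mx 0 ij.2 : 'rV[K]_n).
have /fin_all_exists[m hm] ij : exists m : int,
    forall g : K, @sfil k L m g -> X (g *: w ij) := lattice_absorbs (w ij) hX.
(* The sum of absolute values is a convenient common upper bound of the [m ij]. *)
pose m0 : int := \sum_ij (absz (m ij))%:Z.
have mm ij : m ij <= m0.
  rewrite /m0 (bigD1 ij)//=; have h : m ij <= (absz (m ij))%:Z by lia.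
  apply: le_trans h _.
  by rewrite lerDl sumr_ge0.
exists (m0 * r%:Z) => u /rfilE hu.
have -> : u = \sum_(ij : 'I_r * 'I_n) lsplit r_gt0 ((u : 'rV[K]_n) 0 ij.2) ij.1 *: w ij.
  apply/rowP => j; rewrite summxE -(pair_bigA _ (fun (i : 'I_r) (l : 'I_n) =>
    (lsplit r_gt0 ((u : 'rV[K]_n) 0 l) i *: w (i, l) : 'rV[K]_n) 0 j)) /=.
  rewrite {1}(root_expansion ((u : 'rV[K]_n) 0 j)); apply: eq_bigr => i _.
  rewrite (bigD1 j)//= big1 ?addr0.
    by rewrite pushforward_scaleE /w !mxE !eqxx mulr1.
  move=> l lj; rewrite pushforward_scaleE /w !mxE eq_sym (negPf lj).
  by rewrite andbF !mulr0.
elim/big_ind: _ => [|x y hx hy|ij _]; first exact: lattice0 hX.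
  exact: lattice_add.
apply: hm => l hl /=; apply: hu; have ir := ltn_ord ij.1.
have lm : l + 1 <= m0 by have := mm ij; lia.
have : (l + 1) * r%:Z <= m0 * r%:Z by rewrite ler_wpM2r.
by rewrite mulrDl mul1r; apply: lt_le_trans; rewrite ltrD2l ltz_nat.
Qed.

End PushforwardLattice.

End Lattices.

(** * Continuity forces linearity over series *)

Section FourierUniqueness.
Variable k : fieldType.
Local Notation K := (laurent k).
Local Notation L := (laurent_model k).

Lemma lconst_linearN (M N : connection k) (f : M -> N) :
    (forall c u v, f (lconst c *: u + v) = lconst c *: f u + f v) ->
  forall u, f (- u) = - f u.
Proof.
move=> fl u; have one : lconst 1 = 1 :> K by [].
have fD v w : f (v + w) = f v + f w by have := fl 1 v w; rewrite one !scale1r.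
have f0 : f 0 = 0 by apply: (addrI (f 0)); rewrite -fD !addr0.
by apply: (addrI (f u)); rewrite -fD !subrr.
Qed.

(** For fixed [u] the defect [phi (f u) - f phi(u)] is additive in [f] and vanishes on monomials, so
    its value does not change when [f] is replaced by a tail of high order, where both terms are
    small. *)
Lemma continuous_linear (F N : connection k) (phi : F -> N)
    (fil : int -> N -> Prop) : filtration fil ->
    (forall c u v, phi (lconst c *: u + v) = lconst c *: phi u + phi v) ->
    (forall u, phi (lvar^-1 *: u) = lvar^-1 *: phi u) ->
    (forall j, exists2 X : set F, is_lattice X & forall u, X u -> fil j (phi u)) ->
    (forall w j, exists m : int, forall f : K, @sfil k L m f -> fil j (f *: w)) ->
  forall a u v, phi (a *: u + v) = a *: phi u + phi v.
Proof.
move=> hF phil phiV phic absorb.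
have one : lconst 1 = 1 :> K by [].
have phiD u v : phi (u + v) = phi u + phi v.
  by have := phil 1 u v; rewrite one !scale1r.
have phi0 : phi 0 = 0 by apply: (addrI (phi 0)); rewrite -phiD !addr0.
have phiB u v : phi (u - v) = phi u - phi v.
  by apply: (addIr (phi v)); rewrite -phiD !subrK.
have phic' c u : phi (lconst c *: u) = lconst c *: phi u.
  by have := phil c u 0; rewrite phi0 !addr0.
have vK : (lvar : K) != 0 by apply: (@svar_neq0 k L).
have phiVn (m : nat) u : phi (lvar ^- m *: u) = lvar ^- m *: phi u.
  elim: m u => [|m IH] u; first by rewrite expr0 invr1 !scale1r.
  by rewrite exprS invfM -!scalerA phiV IH.
have phiX (i : int) u : phi (lvar ^ i *: u) = lvar ^ i *: phi u.
  case: i => m; last by rewrite NegzE -exprnN phiVn.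
  have vm : (lvar : K) ^+ m != 0 by rewrite expf_neq0.
  apply: (scalerI (invr_neq0 vm)); rewrite -phiVn.
  by rewrite -!exprnP !scalerA mulVf// !scale1r.
suff phiZ a u : phi (a *: u) = a *: phi u by move=> a u v; rewrite phiD phiZ.
apply/eqP; rewrite -subr_eq0; apply/eqP; apply: (fil_sep hF) => j.
have [X hX Xj] := phic j; have [m1 hm1] := lattice_absorbs u hX.
have [m2 hm2] := absorb (phi u) j.
pose g (f : K) := phi (f *: u) - f *: phi u.
pose m := Order.max m1 m2.
have hS := sfil_filtration L.
have small f : @sfil k L m f -> fil j (g f).
  move=> hf; apply: (filB hF).
    by apply: Xj; apply: hm1; apply: (fil_le hS) hf; rewrite le_max lexx.
  by apply: hm2; apply: (fil_le hS) hf; rewrite le_max lexx orbT.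
have [i hi] := @scoef_bounded k L a.
have [f hf e] : exists2 f : K, @sfil k L (i + (absz (m - i)%R)%:Z) f & g a = g f.
  elim: (absz (m - i)%R) => [|l [f hf ->]]; first by exists a; rewrite ?addr0.
  pose n := i + l%:Z; exists (f - lconst (f n) * lvar ^ n).
    have := @smono_lead k L n f hf.
    by have -> : i + l.+1%:Z = n + 1 by rewrite /n; lia.
  rewrite /g !scalerBl phiB -!scalerA phic' phiX.
  by rewrite opprB addrA subrK.
rewrite -/(g a) e; apply: small; apply: (fil_le hS) hf; lia.
Qed.

Lemma pushforward_iso (char0 : [pchar k] =i pred0) (r : nat) (r_gt0 : (0 < r)%N)
  (M N : connection k) : conn_iso M N ->
  conn_iso (pushforward char0 r_gt0 M) (pushforward char0 r_gt0 N).
Proof.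
move=> [phi [phib hd]].
apply: (@conn_isoI _ (pushforward char0 r_gt0 M) (pushforward char0 r_gt0 N) phi).
- exact: phib.
- by move=> a u v; rewrite -[RHS]linearP.
move=> u; rewrite /= /pushforward_delta.
by rewrite -hd -[LHS]/(phi ((r%:R^-1 : K) *: cdelta (u : M))) linearZ.
Qed.

End FourierUniqueness.

(** * The local Fourier transform *)

Section LocalFourier.
Variables (k : closedFieldType) (char0 : [pchar k] =i pred0).
Variables (r s : nat) (r_gt0 : (0 < r)%N) (s_gt0 : (0 < s)%N).
Local Notation K := (laurent k).
Local Notation L := (laurent_model k).
Local Notation q := (r + s)%N.
Variables (alpha phi beta : K).
Hypothesis phi_stationary : stationary_point r s alpha phi.
Hypothesis betaE : lcomp alpha phi + phi ^+ r * lvar ^- q = beta.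
Variables (n : nat) (A : 'M[k]_n).

Let R0 : connection k := matrix_conn (mconst L A).
Let M0 := pushforward char0 r_gt0 (twist (ltheta alpha) R0).
Let N0 := pushforward char0 (ltn_addr s r_gt0) (twist (ltheta beta + s%:R / 2) R0).

Lemma lsubst_inv_var (m : nat) (m_gt0 : (0 < m)%N) :
  lsubst m_gt0 lvar^-1 = lvar ^- m :> K.
Proof.
have := @lsubst_var_exp k m m_gt0 (-1); rewrite mulrN1 => h.
by rewrite -[LHS]/(lsubst m_gt0 (lvar ^ (-1))) h exprnN.
Qed.

Lemma lsubst_var (m : nat) (m_gt0 : (0 < m)%N) :
  lsubst m_gt0 lvar = lvar ^+ m :> K.
Proof. by have := @lsubst_var_exp k m m_gt0 1; rewrite mulr1. Qed.

(** Scalars of a direct image act through [lsubst]; read that way, with [t = T^r] and [z' = Z^q],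
    the claim is [stationary_phase]. *)
Lemma phase_transform : exists iota : M0 -> N0,
  [/\ bijective iota /\ (forall (c : k) (u v : M0),
        iota (lconst c *: u + v) = lconst c *: iota u + iota v),
      forall u : M0, iota (lvar *: u) = - (lvar ^+ 2 *: cderiv (iota u)),
      forall u : M0, iota (cderiv u) = - (lvar^-1 *: iota u)
    & forall i (u : M0), @rfil k L n i u <-> @rfil k L n (i + r%:Z) (iota u)].
Proof.
have [phi1 phis] := phi_stationary.
have [iota [[ib il] ifil i1 i2]] := @stationary_phase k char0 L r s r_gt0 s_gt0
  alpha phi beta phi1 phis betaE n A.
have v0 : (lvar : K) != 0 by apply: (@svar_neq0 k L).
exists iota; split => //.
- split=> // c u v.
  have sc (m : nat) (m_gt0 : (0 < m)%N) (w : 'rV[K]_n) :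
    lsubst m_gt0 (lconst c) *: w = lconst c *: w by rewrite lsubst_const.
  apply: etrans (congr1 (fun w : 'rV[K]_n => iota (w + v)) (sc _ r_gt0 u)) _.
  apply: etrans (il c u v) _.
  exact/esym/(congr1 (fun w : 'rV[K]_n => w + iota v) (sc _ (ltn_addr s r_gt0) _)).
- move=> u; rewrite -[lvar *: u]/(lsubst r_gt0 lvar *: (u : 'rV[K]_n)) lsubst_var.
  apply: etrans (i1 u) _; congr (- _).
  rewrite /cderiv -[RHS]/(lsubst _ (lvar ^+ 2) *: (lsubst _ lvar^-1 *:
    ((q%:R^-1 : K) *: (_ : 'rV[K]_n)))).
  rewrite !scalerA expr2 lsubstM !lsubst_var lsubst_inv_var.
  congr (_ *: _); rewrite mulrC; congr (_ * _).
  by rewrite mulfK// expf_neq0.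
move=> u.
have e1 (x : 'rV[K]_n) : lsubst r_gt0 lvar^-1 *: ((r%:R^-1 : K) *: x) =
    (r%:R^-1 * lvar ^- r) *: x by rewrite lsubst_inv_var scalerA mulrC.
have e2 (x : 'rV[K]_n) : lvar ^- q *: x = lsubst (ltn_addr s r_gt0) lvar^-1 *: x.
  by rewrite lsubst_inv_var.
apply: etrans (congr1 iota (e1 (@cdelta k (twist (ltheta alpha) R0) u))) _.
apply: etrans (i2 u) _.
exact: (congr1 (fun x : 'rV[K]_n => - x) (e2 (iota u))).
Qed.

(** Continuity holds because [iota] shifts the order by exactly [r], and lattices are comparable
    with the filtration by order. *)
Lemma phase_is_fourier : is_local_fourier_0oo M0 N0.
Proof.
have [iota [ib i1 i2 ifil]] := phase_transform.
exists iota; split => // X hX; have [N hN] := lattice_open hX.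
have [X' hX' h] := small_lattice (ltn_addr s r_gt0) char0 (mconst L A)
  (ltheta beta + s%:R / 2) (N + r%:Z).
by exists X' => // u /h hu; apply: hN; apply/ifil.
Qed.

(** The comparison map [f] commutes with [1/z'] and with [z'^2 d/dz'], since these correspond on
    [M0] to [- d/dt] and to [- t]; continuity makes it linear over [k((z'))]. *)
Lemma fourier_unique (F : connection k) : is_local_fourier_0oo M0 F -> conn_iso F N0.
Proof.
move=> [j [[[g jK gK] jl] j1 j2 jc]].
have [iota [[ib il] i1 i2 ifil]] := phase_transform.
pose f (u : F) : N0 := iota (g u).
have gl c u v : g (lconst c *: u + v) = lconst c *: g u + g v.
  by apply: (can_inj jK); rewrite jl !gK.
have fb : bijective f by apply: bij_comp => //; exists j.
have fl c u v : f (lconst c *: u + v) = lconst c *: f u + f v.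
  by rewrite /f gl il.
have gN := lconst_linearN gl.
have iN := lconst_linearN il.
have v0 : (lvar : K) != 0 by apply: (@svar_neq0 k L).
have fV u : f (lvar^-1 *: u) = lvar^-1 *: f u.
  rewrite /f -{1}(gK u) -[lvar^-1 *: j _]opprK -j2 gN jK iN i2 opprK.
  by [].
have hF : filtration (fun i (w : N0) => @rfil k L n i w) by exact: rfil_filtration L n.
have flin a u v : f (a *: u + v) = a *: f u + f v.
  apply: (continuous_linear hF) a u v => //.
    move=> i; have [Y hY hYi] := small_lattice r_gt0 char0 (mconst L A)
      (ltheta alpha) (i - r%:Z).
    have [X hX h] := jc Y hY; exists X => // u Xu.
    rewrite -[u]gK in Xu; have /hYi/ifil := h _ Xu.
    by rewrite subrK.
  move=> w i; have [X hX hXi] := small_lattice (ltn_addr s r_gt0) char0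
    (mconst L A) (ltheta beta + s%:R / 2) i.
  by have [m hm] := lattice_absorbs w hX; exists m => a /hm/hXi.
apply: (@conn_isoI _ F N0 f fb flin) => u.
have fcd : f (lvar ^+ 2 *: cderiv u) = lvar ^+ 2 *: cderiv (f u).
  rewrite -{1}(gK u) -[X in f X]opprK -j1 /f gN jK iN i1 opprK.
  by [].
have e (V : connection k) (w : V) : cdelta w = lvar^-1 *: (lvar ^+ 2 *: cderiv w).
  by rewrite /cderiv !scalerA expr2 mulKf// divff// scale1r.
by rewrite (e F u) fV fcd -e.
Qed.

End LocalFourier.

Theorem theorem1 (k : closedFieldType) (char0 : [pchar k] =i pred0)
    (r s : nat) (r_gt0 : (0 < r)%N) (s_gt0 : (0 < s)%N)
    (alpha : laurent k) (alpha_order : has_order alpha (- s%:Z)) :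
  (exists phi : laurent k, stationary_point r s alpha phi) /\
  forall phi beta : laurent k,
    stationary_point r s alpha phi ->
    lcomp alpha phi + phi ^+ r * lvar ^- (r + s) = beta ->
    has_order beta (- s%:Z) /\
    forall R : connection k, regular R ->
      let M := pushforward char0 r_gt0 (tensor (rank1 (ltheta alpha)) R) in
      let N := pushforward char0 (ltn_addr s r_gt0)
                 (tensor (rank1 (ltheta beta + s%:R / 2)) R) in
      (exists F : connection k, is_local_fourier_0oo M F) /\
      (forall F : connection k, is_local_fourier_0oo M F -> conn_iso F N).
Proof.
split.
  have [p p1 hp] := @stationary_ex k char0 (laurent_model k) r s alpha
    r_gt0 s_gt0 alpha_order.
  by exists p.
move=> phi beta hphi hbeta; split.
  by have [p1 hp] := hphi; exact: (@beta_order k char0 (laurent_model k) r s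
    r_gt0 s_gt0 alpha phi beta p1 hp hbeta).
move=> R /regular_matrix[n [A hA RA]] M N.
have [A0 _ gA] := @gauge_constant k char0 (laurent_model k) n A hA.
have iR : conn_iso R (matrix_conn (mconst (laurent_model k) A0)).
  exact: conn_iso_trans (conn_iso_sym RA) (gauge_iso gA).
have model f : conn_iso (tensor (rank1 f) R)
    (twist f (matrix_conn (mconst (laurent_model k) A0))).
  exact: conn_iso_trans (conn_iso_sym (tensor_rank1_iso f R)) (twist_iso f iR).
have iM := pushforward_iso char0 r_gt0 (model (ltheta alpha)).
have iN := pushforward_iso char0 (ltn_addr s r_gt0) (model (ltheta beta + s%:R / 2)).
split.
  eexists; apply: local_fourier_iso iM _.
  exact: (phase_is_fourier char0 r_gt0 s_gt0 hphi hbeta A0).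
move=> F /(local_fourier_iso (conn_iso_sym iM)) hF.
have FN := fourier_unique s_gt0 hphi hbeta hF.
exact: conn_iso_trans FN (conn_iso_sym iN).
Qed.
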